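(* Let $V:S^1\to\mathbb{C}$ be a Zygmund vector field vanishing at $1,i,-1$ and let $\dot{s}:\mathcal{F}\to\mathbb{R}$ be the corresponding infinitesimal shear function on the Farey tesselation $\mathcal{F}$ of the unit disk. Then for every $n\in\mathbb{Z}$ the $n$-th Fourier coefficient $\widehat V(n)=\frac1{2\pi}\int_0^{2\pi}V(e^{i\phi})e^{-in\phi}d\phi$ is given by $$\widehat{V}(n)=\sum_{p\in\mathcal{F}^0}\widehat{V}_p(n),$$ where $\mathcal{F}^0$ is the set of vertices of $\mathcal{F}$, the convergence is absolute, and for each $p\in\mathcal{F}^0$ with fan $\mathcal{F}_p=\{e_j\}_{j\in\mathbb{Z}}$, $e_j=(e^{i\phi_0^j},e^{i\phi_1^j})$, $$\widehat{V}_p(n)=\sum_{j\in\mathbb{Z}}\frac{\dot{s}(e_j)}{4\pi(e^{i\phi_0^j}-e^{i\phi_1^j})}\Big[\frac{e^{i(2-n)\phi_1^j}-e^{i(2-n)\phi_0^j}}{i(2-n)}-(e^{i\phi_0^j}+e^{i\phi_1^j})\frac{e^{i(1-n)\phi_1^j}-e^{i(1-n)\phi_0^j}}{i(1-n)}+e^{i(\phi_0^j+\phi_1^j)}\frac{e^{-in\phi_1^j}-e^{-in\phi_0^j}}{-in}\Big],$$ where for $m=0$ the quotient $\frac{e^{im\phi_1}-e^{im\phi_0}}{im}$ is read as $\phi_1-\phi_0$.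
   Context: Farey tesselation: the Farey tesselation of the upper half-plane $\mathbb{H}$ consists of all geodesics with endpoints $\frac ab,\frac cd\in\mathbb{Q}\cup\{\infty\}$ (lowest terms, $\infty=\frac10$), $|ad-bc|=1$. Let $B(z)=\frac{1+iz}{1-iz}$, mapping $\mathbb{H}$ to the unit disk and $0,1,\infty$ to $1,i,-1$; $\mathcal{F}$ is the image under $B$ of the Farey tesselation of $\mathbb{H}$. Each edge $e$ of $\mathcal{F}$ is written $e=(e^{i\phi_0},e^{i\phi_1})$ with $0\le\phi_0<\phi_1\le2\pi$ chosen so that the arc $\{e^{i\phi}:\phi_0<\phi<\phi_1\}$ contains none of the points $1,i,-1$. Fans: $\mathcal{F}_p$ is the set of edges of $\mathcal{F}$ with endpoint $p$, enumerated $\{e_j\}_{j\in\mathbb{Z}}$ with $e_j$ adjacent to $e_{j+1}$; the sum over $j$ is the limit of the sums over $-N\le j\le N$. Elementary shear fields and $V_p$: $V_{\phi_0,\phi_1}(z)=\frac{(z-e^{i\phi_0})(z-e^{i\phi_1})}{e^{i\phi_0}-e^{i\phi_1}}$ for $z=e^{i\phi}$, $\phi_0<\phi<\phi_1$, and $0$ otherwise; $V_p=\sum_{j}\frac12\dot s(e_j)V_{\phi_0^j,\phi_1^j}$, and $\widehat V_p(n)$ is the $n$-th Fourier coefficient of $V_p$. Vector fields: a vector field on $\hat{\mathbb{R}}$ is a continuous $W:\mathbb{R}\to\mathbb{R}$ such that $\lim_{x\to\pm\infty}W(x)/x^2$ exist, are equal and finite; it is Zygmund if for some $C$ both $W(x)$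 and $x^2W(1/x)$ satisfy $|W(x+t)+W(x-t)-2W(x)|\le Ct$ for $x\in[-2,2]$, $t\in[0,1]$. A vector field $V:S^1\to\mathbb{C}$ (tangent to $S^1$) is Zygmund if $V(B(x))=B'(x)W(x)$ for a Zygmund $W$ on $\hat{\mathbb{R}}$. Infinitesimal shear function: for an edge $e=(b,d)$ whose two adjacent complementary triangles have third vertices $a,c$, with $a,b,c,d$ in counterclockwise order on $S^1$, $\dot s(e)=\frac{V(c)-V(b)}{c-b}+\frac{V(d)-V(a)}{d-a}-\frac{V(b)-V(a)}{b-a}-\frac{V(d)-V(c)}{d-c}$. *)

(* Defs.v *)
From Stdlib Require Import Reals ZArith List ClassicalEpsilon.
From Coquelicot Require Import Coquelicot.

Open Scope R_scope.

Definition expi (t : R) : C := (cos t, sin t).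

Definition S1 (z : C) : Prop := Cmod z = 1.

Definition cayley (z : C) : C := ((1 + Ci * z) / (1 - Ci * z))%C.

(* [option R] is the projective line, [None] being the point at infinity. *)
Definition cayley_bd (x : option R) : C :=
  match x with
  | Some x => cayley (RtoC x)
  | None => RtoC (-1)
  end.

Definition cusp (a b : Z) : option R :=
  if Z.eq_dec b 0 then None else Some (IZR a / IZR b).

(* A geodesic is determined by its endpoints, so the tesselation is recorded by
   the relation "p and q are the endpoints of an edge".  A lowest terms
   representation is only used up to a common sign of (a, b). *)
Definition farey_adj (p q : C) : Prop :=
  exists a b c d : Z,
    Z.gcd a b = 1%Z /\ Z.gcd c d = 1%Z /\ Z.abs (a * d - b * c) = 1%Z /\
    p = cayley_bd (cusp a b) /\ q = cayley_bd (cusp c d).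

(* The condition on the arc selects exactly one pair of angles for each
   unordered pair of endpoints, so [edge] is the set of edges itself (up to
   proof irrelevance).  The value [phi1 = 2 * PI] occurs when an edge ends at 1
   from below. *)
Record edge : Type := Edge {
  phi0 : R;
  phi1 : R;
  edge_adj : farey_adj (expi phi0) (expi phi1);
  edge_range : 0 <= phi0 /\ phi0 < phi1 /\ phi1 <= 2 * PI;
  edge_arc : forall phi : R, phi0 < phi < phi1 ->
    expi phi <> RtoC 1 /\ expi phi <> Ci /\ expi phi <> RtoC (-1)
}.

Definition src (e : edge) : C := expi (phi0 e).
Definition tgt (e : edge) : C := expi (phi1 e).

Definition incident (p : C) (e : edge) : Prop := p = src e \/ p = tgt e.

Definition joins (e : edge) (p q : C) : Prop :=
  (src e = p /\ tgt e = q) \/ (src e = q /\ tgt e = p).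

Definition farey_vertex (p : C) : Prop := exists e : edge, incident p e.

(* Edges do not cross, so the complementary triangles are the ideal triangles
   all of whose sides are edges. *)
Definition farey_triangle (p q r : C) : Prop :=
  farey_adj p q /\ farey_adj q r /\ farey_adj p r.

Definition edges_adjacent (e f : edge) : Prop :=
  exists p q r : C, farey_triangle p q r /\ joins e p q /\ joins f p r.

Definition is_fan (p : C) (e : Z -> edge) : Prop :=
  (forall j : Z, incident p (e j)) /\
  (forall j k : Z, e j = e k -> j = k) /\
  (forall f : edge, incident p f -> exists j : Z, e j = f) /\
  (forall j : Z, edges_adjacent (e j) (e (j + 1)%Z)).

Definition vector_field_line (W : R -> R) : Prop :=
  (forall x : R, continuous W x) /\
  exists L : R, is_lim (fun x => W x / x ^ 2) p_infty (Finite L) /\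
                is_lim (fun x => W x / x ^ 2) m_infty (Finite L).

(* x^2 W(1/x), extended to x = 0 by continuity. *)
Definition inverted (W : R -> R) (x : R) : R :=
  if Req_EM_T x 0 then real (Lim (fun y => W y / y ^ 2) p_infty)
  else x ^ 2 * W (1 / x).

Definition zygmund_bound (M : R) (f : R -> R) : Prop :=
  forall x t : R, -2 <= x <= 2 -> 0 <= t <= 1 ->
    Rabs (f (x + t) + f (x - t) - 2 * f x) <= M * t.

Definition zygmund_line (W : R -> R) : Prop :=
  vector_field_line W /\
  exists M : R, zygmund_bound M W /\ zygmund_bound M (inverted W).

(* Only the values of [V] on the circle matter.  Continuity on the circle fixes
   the value at -1 = B(oo), which the identity over the real line leaves free. *)
Definition zygmund_circle (V : C -> C) : Prop :=
  continuous_on S1 V /\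
  (forall z : C, S1 z -> exists r : R, V z = (RtoC r * (Ci * z))%C) /\
  exists W : R -> R, zygmund_line W /\
    forall x : R,
      V (cayley (RtoC x)) = (C_derive cayley (RtoC x) * RtoC (W x))%C.

Definition ccw4 (a b c d : C) : Prop :=
  exists ta tb tc td : R,
    ta < tb /\ tb < tc /\ tc < td /\ td < ta + 2 * PI /\
    a = expi ta /\ b = expi tb /\ c = expi tc /\ d = expi td.

Definition shear_expr (V : C -> C) (a b c d : C) : C :=
  ((V c - V b) / (c - b) + (V d - V a) / (d - a)
   - (V b - V a) / (b - a) - (V d - V c) / (d - c))%C.

(* [shear_expr V] is invariant under exchanging (a, b) with (c, d), so taking
   (b, d) = (src e, tgt e) loses nothing. *)
Definition is_inf_shear (V : C -> C) (sdot : edge -> R) : Prop :=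
  forall (e : edge) (a b c d : C),
    b = src e -> d = tgt e ->
    farey_triangle a b d -> farey_triangle c b d -> ccw4 a b c d ->
    RtoC (sdot e) = shear_expr V a b c d.

Definition zpartial_sum (u : Z -> C) (N : nat) : C :=
  sum_n (fun k : nat => u (Z.of_nat k - Z.of_nat N)%Z) (2 * N).

Definition is_zsum (u : Z -> C) (l : C) : Prop :=
  filterlim (zpartial_sum u) eventually (locally l).

Definition zsum (u : Z -> C) : C :=
  iota (T := C_R_CompleteNormedModule) (is_zsum u).

Definition elementary_field (t0 t1 : R) (z : C) : C :=
  if excluded_middle_informative
       (exists phi : R, z = expi phi /\ t0 < phi < t1)
  then ((z - expi t0) * (z - expi t1) / (expi t0 - expi t1))%C
  else RtoC 0.

Definition fan_field_term (sdot : edge -> R) (z : C) (e : edge) : C :=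
  (RtoC (/ 2 * sdot e) * elementary_field (phi0 e) (phi1 e) z)%C.

Definition fan_field (sdot : edge -> R) (fan : Z -> edge) (z : C) : C :=
  zsum (fun j => fan_field_term sdot z (fan j)).

Definition fourier_integrand (F : C -> C) (n : Z) (phi : R) : C :=
  (F (expi phi) * expi (- IZR n * phi))%C.

Definition fourier_coef (F : C -> C) (n : Z) : C :=
  (RtoC (/ (2 * PI)) *
   RInt (V := C_R_CompleteNormedModule) (fourier_integrand F n) 0 (2 * PI))%C.

Definition exp_quot (m : Z) (t0 t1 : R) : C :=
  if Z.eq_dec m 0 then RtoC (t1 - t0)
  else ((expi (IZR m * t1) - expi (IZR m * t0)) / (Ci * RtoC (IZR m)))%C.

Definition fan_coef_term (sdot : edge -> R) (n : Z) (e : edge) : C :=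
  (RtoC (sdot e) / (RtoC (4 * PI) * (src e - tgt e)) *
   (exp_quot (2 - n) (phi0 e) (phi1 e)
    - (src e + tgt e) * exp_quot (1 - n) (phi0 e) (phi1 e)
    + expi (phi0 e + phi1 e) * exp_quot (- n) (phi0 e) (phi1 e)))%C.

Definition list_in {T : Type} (P : T -> Prop) (l : list T) : Prop :=
  NoDup l /\ forall x, In x l -> P x.

Definition Csum_list {T : Type} (f : T -> C) (l : list T) : C :=
  fold_right Cplus (RtoC 0) (map f l).

(* [f] is absolutely summable over the set [P], with sum [l]: the sums over the
   finite subsets of [P] are absolutely bounded and converge to [l]. *)
Definition is_abs_sum {T : Type} (P : T -> Prop) (f : T -> C) (l : C) : Prop :=
  (exists M : R, forall s : list T, list_in P s ->
     fold_right Rplus 0 (map (fun x => Cmod (f x)) s) <= M) /\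
  (forall eps : R, 0 < eps ->
     exists s0 : list T, list_in P s0 /\
       forall s : list T, list_in P s -> incl s0 s ->
         Cmod (Csum_list f s - l) < eps).

(* Main.v *)
Require Import Defs.
From Stdlib Require Import Reals ZArith List Lra Lia Psatz.
From Stdlib Require Import ClassicalEpsilon ProofIrrelevance Permutation.
From Coquelicot Require Import Coquelicot.
Import ListNotations.
Open Scope R_scope.

(* Let Q_T be the quadratic polynomial agreeing with V at the vertices of a
   triangle T of the tesselation.  Across an edge e = (b, d), Q_T jumps by
   s(e) (z - b)(z - d) / (b - d), and Q_T = 0 for the base triangle (1, i, -1),
   so summing s(e) V_e over the edges separating z from the base triangle
   telescopes to Q_T(z).  A Zygmund field is Hoelder of exponent 3/4, which
   gives |V - Q_T| = O(k^(-1/2)) on the arcs of level k: the sums over levels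
   below k converge uniformly to V.  Restricting to the edges ending at p keeps
   a contiguous run of each path of the tree, so the same telescoping gives
   uniform convergence of the series defining V_p.  Fourier coefficients may
   therefore be taken termwise.  Finally, if the endpoints of e have
   denominators q, q', then |s(e)| = O((q + q')^(1/2)) and the Fourier
   coefficient of s(e) V_e is O((q q')^(-3/2)); as (q, q') determines e up to
   three choices, the double series over all edges converges absolutely and may
   be regrouped by vertices, each edge being counted half at each endpoint. *)

(** The argument works for any Hoelder exponent alpha above 1/2: on an edge with denominators q, q'
    it bounds the interpolation error by a multiple of (q q')^(1 - 2 alpha) and the Fourier
    coefficient by a multiple of (q q')^(-2 alpha). The first tends to 0 and the second is summable
    over pairs as soon as alpha > 1/2. The value 3/4 is taken because, with |t - u| <= r^4, all
    powers that occur are integral powers of r or square roots.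

    The obstacle is the order of summation. Uniform convergence is obtained by levels of the tree,
    whereas V_p is defined by symmetric sums along the fan, and the statement enumerates the fan
    independently of the levels. At a fixed point of the circle only finitely many edges of a fan
    contribute, so both orders define the same function V_p; for the Fourier coefficients, absolute
    summability makes both orders give the same number. Hence no estimate in fan order occurs. *)

(** * Angles, chords and the Cayley parameter on the unit circle *)

Lemma C_eq (z w : C) : fst z = fst w -> snd z = snd w -> z = w.
Proof. destruct z, w; simpl; intros; subst; reflexivity. Qed.

Lemma expi_plus (a b : R) : expi (a + b) = (expi a * expi b)%C.
Proof.
  apply C_eq; simpl; [rewrite cos_plus | rewrite sin_plus]; ring.
Qed.

Lemma expi_0 : expi 0 = RtoC 1.
Proof. apply C_eq; simpl; [apply cos_0 | apply sin_0]. Qed.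

Lemma expi_PI : expi PI = RtoC (-1).
Proof. apply C_eq; simpl; [apply cos_PI | apply sin_PI]. Qed.

Lemma expi_PI2 : expi (PI / 2) = Ci.
Proof. apply C_eq; simpl; [apply cos_PI2 | apply sin_PI2]. Qed.

Lemma expi_2PI_shift (a : R) : expi (a + 2 * PI) = expi a.
Proof. apply C_eq; simpl; [rewrite cos_plus | rewrite sin_plus]; rewrite cos_2PI, sin_2PI; ring. Qed.

Lemma expi_minus_2PI (a : R) : expi (a - 2 * PI) = expi a.
Proof. rewrite <- (expi_2PI_shift (a - 2 * PI)). f_equal. ring. Qed.

Lemma Cmod_expi (a : R) : Cmod (expi a) = 1.
Proof.
  unfold Cmod, expi; simpl fst; simpl snd.
  rewrite <- sqrt_1. f_equal. generalize (sin2_cos2 a). unfold Rsqr. intro; nra.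
Qed.

Lemma S1_expi (a : R) : S1 (expi a).
Proof. apply Cmod_expi. Qed.

Lemma S1_polar (z : C) : S1 z -> exists t, 0 <= t <= 2 * PI /\ z = expi t.
Proof.
  unfold S1. destruct z as [x y]. intro H.
  assert (H2 : x ^ 2 + y ^ 2 = 1).
  { unfold Cmod in H; simpl fst in H; simpl snd in H.
    rewrite <- (sqrt_sqrt (x ^ 2 + y ^ 2)) by nra. rewrite H. ring. }
  assert (Hx : -1 <= x <= 1) by nra.
  generalize (acos_bound x) PI_RGT_0. intros Hb Hp.
  assert (Hs : sin (acos x) = sqrt (y ^ 2)).
  { rewrite sin_acos by assumption. f_equal. unfold Rsqr. lra. }
  destruct (Rle_dec 0 y) as [Hy | Hy].
  - exists (acos x). split; [lra |].
    apply C_eq; simpl; [symmetry; apply cos_acos; assumption |].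
    rewrite Hs. rewrite sqrt_pow2; auto.
  - exists (2 * PI - acos x). split; [lra |].
    apply C_eq; simpl.
    + rewrite cos_minus, cos_2PI, sin_2PI, cos_acos by assumption. ring.
    + rewrite sin_minus, cos_2PI, sin_2PI, Hs.
      replace (y ^ 2) with ((- y) ^ 2) by ring. rewrite sqrt_pow2 by lra. ring.
Qed.

Lemma sin_abs_le (t : R) : Rabs (sin t) <= Rabs t.
Proof.
  destruct (Rtotal_order t 0) as [H | [H | H]].
  - rewrite (Rabs_left t) by assumption.
    apply Rabs_le. generalize (sin_lt_x (- t)) (SIN_bound t).
    intros H1 _. specialize (H1 ltac:(lra)). rewrite sin_neg in H1.
    split; [lra |].
    destruct (Rle_dec (- t) 1) as [H2 | H2].
    + assert (0 <= sin (- t)).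
      { apply sin_ge_0; [lra |]. generalize PI2_3_2. lra. }
      rewrite sin_neg in *. lra.
    + generalize (SIN_bound t). lra.
  - subst. rewrite sin_0. lra.
  - rewrite (Rabs_right t) by lra.
    apply Rabs_le. generalize (sin_lt_x t H). intro H1.
    split; [| lra].
    destruct (Rle_dec t 1) as [H2 | H2].
    + assert (0 <= sin t) by (apply sin_ge_0; [lra | generalize PI2_3_2; lra]). lra.
    + generalize (SIN_bound t). lra.
Qed.

Lemma Cmod_sq (z : C) : (Cmod z)² = (fst z)² + (snd z)².
Proof.
  unfold Cmod. rewrite Rsqr_sqrt; [unfold Rsqr; ring |].
  generalize (pow2_ge_0 (fst z)) (pow2_ge_0 (snd z)). lra.
Qed.

Lemma Cmod_le_of_sq (z : C) (m : R) :
  0 <= m -> (fst z)² + (snd z)² <= m² -> Cmod z <= m.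
Proof.
  intros Hm H. apply Rsqr_incr_0_var; [rewrite Cmod_sq; exact H | exact Hm].
Qed.

Lemma Cmod_expi_minus (a b : R) : Cmod (expi a - expi b) <= Rabs (a - b).
Proof.
  apply Cmod_le_of_sq; [apply Rabs_pos |].
  rewrite <- Rsqr_abs. simpl.
  assert (H : (cos a + - cos b)² + (sin a + - sin b)² = (2 * sin ((a - b) / 2))²).
  { set (u := (a + b) / 2). set (v := (a - b) / 2).
    assert (Ha : a = u + v) by (unfold u, v; field).
    assert (Hb : b = u - v) by (unfold u, v; field).
    rewrite Ha, Hb.
    rewrite cos_plus, cos_minus, sin_plus, sin_minus.
    transitivity (4 * (sin v)² * ((sin u)² + (cos u)²)); [unfold Rsqr; ring |].
    rewrite sin2_cos2. unfold Rsqr; ring. }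
  rewrite H. apply Rsqr_le_abs_1.
  rewrite Rabs_mult, (Rabs_right 2) by lra.
  generalize (sin_abs_le ((a - b) / 2)).
  assert (E : Rabs (a - b) = 2 * Rabs ((a - b) / 2)).
  { rewrite <- (Rabs_right 2) at 1 by lra. rewrite <- Rabs_mult. f_equal. field. }
  lra.
Qed.

Lemma expi_eq_close (a b : R) : expi a = expi b -> a <= b < a + 2 * PI -> a = b.
Proof.
  intros H Hab.
  assert (H1 : cos (b - a) = 1).
  { rewrite cos_minus. injection H as Hc Hs. rewrite <- Hc, <- Hs.
    generalize (sin2_cos2 a). unfold Rsqr. lra. }
  destruct (Req_dec a b) as [| Hne]; [assumption | exfalso].
  assert (H2 : cos (b - a) = 1 - 2 * (sin ((b - a) / 2))²).
  { replace (b - a) with (2 * ((b - a) / 2)) at 1 by field. rewrite cos_2a_sin. unfold Rsqr; ring. }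
  assert (0 < sin ((b - a) / 2)) by (apply sin_gt_0; lra).
  unfold Rsqr in H2. nra.
Qed.

Lemma cos_2atan (x : R) : cos (2 * atan x) = (1 - x ^ 2) / (1 + x ^ 2).
Proof.
  rewrite cos_2a_cos, cos_atan.
  assert (H : 0 < 1 + x²) by (unfold Rsqr; nra).
  assert (Hs : sqrt (1 + x²) * sqrt (1 + x²) = 1 + x ^ 2).
  { rewrite sqrt_sqrt by lra. unfold Rsqr; ring. }
  assert (sqrt (1 + x²) <> 0) by (apply Rgt_not_eq, sqrt_lt_R0, H).
  assert (1 + x ^ 2 <> 0) by nra.
  replace (1 - x ^ 2) with (2 - (1 + x ^ 2)) by ring. rewrite <- Hs. field. assumption.
Qed.

Lemma sin_2atan (x : R) : sin (2 * atan x) = 2 * x / (1 + x ^ 2).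
Proof.
  rewrite sin_2a, cos_atan, sin_atan.
  assert (H : 0 < 1 + x²) by (unfold Rsqr; nra).
  assert (Hs : sqrt (1 + x²) * sqrt (1 + x²) = 1 + x ^ 2).
  { rewrite sqrt_sqrt by lra. unfold Rsqr; ring. }
  assert (sqrt (1 + x²) <> 0) by (apply Rgt_not_eq, sqrt_lt_R0, H).
  rewrite <- Hs. field. assumption.
Qed.

Lemma cayley_real (x : R) :
  cayley (RtoC x) = ((1 - x ^ 2) / (1 + x ^ 2), 2 * x / (1 + x ^ 2)).
Proof.
  unfold cayley. apply C_eq; simpl; field; nra.
Qed.

Lemma expi_2atan (x : R) : expi (2 * atan x) = cayley (RtoC x).
Proof. rewrite cayley_real. unfold expi. rewrite cos_2atan, sin_2atan. reflexivity. Qed.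

Lemma atan_lipschitz (x y : R) : Rabs (atan x - atan y) <= Rabs (x - y).
Proof.
  destruct (MVT_gen atan y x (fun z => / (1 + z²))) as [c [_ Hc]].
  - intros z _. apply is_derive_atan.
  - intros z _. apply derivable_continuous_pt, derivable_pt_atan.
  - rewrite Hc, Rabs_mult.
    rewrite <- (Rmult_1_l (Rabs (x - y))) at 2.
    apply Rmult_le_compat_r; [apply Rabs_pos |].
    generalize (Rle_0_sqr c); intro.
    rewrite Rabs_right by (apply Rle_ge, Rlt_le, Rinv_0_lt_compat; lra).
    rewrite <- Rinv_1. apply Rinv_le_contravar; lra.
Qed.

(** The squared chord is 4 (x - y)^2 / ((1 + x^2) (1 + y^2)), and on [-1, 1] both factors of the
    denominator are at most 2. *)
Lemma Cdist_cayley_ge (x y : R) :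
  -1 <= x <= 1 -> -1 <= y <= 1 -> Rabs (x - y) <= Cmod (cayley x - cayley y).
Proof.
  intros Hx Hy. apply Rsqr_incr_0_var; [| apply Cmod_ge_0].
  rewrite Cmod_sq, <- Rsqr_abs, !cayley_real. simpl fst; simpl snd.
  assert (E : ((1 - x ^ 2) / (1 + x ^ 2) + - ((1 - y ^ 2) / (1 + y ^ 2)))² +
              (2 * x / (1 + x ^ 2) + - (2 * y / (1 + y ^ 2)))² =
              (x - y)² * (4 / ((1 + x ^ 2) * (1 + y ^ 2)))).
  { unfold Rsqr. field. nra. }
  eapply Rle_trans; [| right; symmetry; exact E].
  rewrite <- (Rmult_1_r ((x - y)²)) at 1.
  apply Rmult_le_compat_l; [apply Rle_0_sqr |].
  assert (0 < 1 + x ^ 2 <= 2) by nra.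
  assert (0 < 1 + y ^ 2 <= 2) by nra.
  apply Rle_div_r; nra.
Qed.

(** * Sectors of the circle *)

(* A sector is one of the arcs cut out by 1, i, -1.  The chart [sec_angle r] of
   a sector by [0,1] is a Moebius map in Cayley coordinates, induced by the
   integral unimodular map [sec_vec r], so that
   the edges over each sector are exactly the Farey intervals of [0,1]. *)
Inductive sector : Type := sector1 | sector2 | sector3.

(** Each sector is the rotation by [sec_base] of an arc whose Cayley parameter runs affinely over
    [0, 1], [-1, 0] or [-1, 1]. Infinity is thereby avoided, and the chord estimate on [-1, 1]
    applies to all three sectors. *)
Definition sec_base (r : sector) : R :=
  match r with sector1 => 0 | sector2 => PI | sector3 => 3 * (PI / 2) end.

Definition sec_off (r : sector) : R :=
  match r with sector1 => 0 | sector2 => -1 | sector3 => -1 end.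

Definition sec_mul (r : sector) : R :=
  match r with sector1 => 1 | sector2 => 1 | sector3 => 2 end.

Definition sec_angle (r : sector) (s : R) : R :=
  sec_base r + 2 * atan (sec_off r + sec_mul r * s).

(** The powers of an element of order three of PSL(2,Z) that permutes 0, 1, oo cyclically; acting on
    fractions p / q they carry [0, 1] to [0, 1], [1, oo] and [-oo, 0]. *)
Definition sec_vec (r : sector) (u : Z * Z) : Z * Z :=
  let (p, q) := u in
  match r with
  | sector1 => (p, q)
  | sector2 => (q, q - p)%Z
  | sector3 => (q - p, - p)%Z
  end.

Lemma sec_mul_bound (r : sector) : 1 <= sec_mul r <= 2.
Proof. destruct r; simpl; lra. Qed.

Lemma sec_angle_lt (r : sector) (s t : R) : s < t -> sec_angle r s < sec_angle r t.
Proof.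
  intro H. unfold sec_angle. apply Rplus_lt_compat_l, Rmult_lt_compat_l; [lra |].
  apply atan_increasing. generalize (sec_mul_bound r). nra.
Qed.

Lemma sec_angle_le (r : sector) (s t : R) : s <= t -> sec_angle r s <= sec_angle r t.
Proof.
  intros [H | H]; [left; apply sec_angle_lt, H | subst; right; reflexivity].
Qed.

Lemma sec_angle_lt_inv (r : sector) (s t : R) : sec_angle r s < sec_angle r t -> s < t.
Proof.
  intro H. destruct (Rlt_le_dec s t) as [| Hle]; [assumption |].
  generalize (sec_angle_le r t s Hle). lra.
Qed.

Lemma sec_angle_le_inv (r : sector) (s t : R) : sec_angle r s <= sec_angle r t -> s <= t.
Proof.
  intro H. destruct (Rle_lt_dec s t) as [| Hle]; [assumption |].
  generalize (sec_angle_lt r t s Hle). lra.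
Qed.

Lemma atan_m1 : atan (-1) = - (PI / 4).
Proof. replace (-1) with (- (1)) by ring. rewrite atan_opp, atan_1. reflexivity. Qed.

Lemma sec_angle_ends (r : sector) :
  sec_angle r 0 = match r with sector1 => 0 | sector2 => PI / 2 | sector3 => PI end /\
  sec_angle r 1 = match r with sector1 => PI / 2 | sector2 => PI | sector3 => 2 * PI end.
Proof.
  unfold sec_angle; destruct r; simpl; split.
  - replace (0 + 1 * 0) with 0 by ring. rewrite atan_0. ring.
  - replace (0 + 1 * 1) with 1 by ring. rewrite atan_1. field.
  - replace (-1 + 1 * 0) with (-1) by ring. rewrite atan_m1. field.
  - replace (-1 + 1 * 1) with 0 by ring. rewrite atan_0. ring.
  - replace (-1 + 2 * 0) with (-1) by ring. rewrite atan_m1. field.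
  - replace (-1 + 2 * 1) with 1 by ring. rewrite atan_1. field.
Qed.

Lemma sec_angle_lipschitz (r : sector) (s t : R) :
  Rabs (sec_angle r s - sec_angle r t) <= 4 * Rabs (s - t).
Proof.
  unfold sec_angle.
  replace (_ - _) with (2 * (atan (sec_off r + sec_mul r * s) - atan (sec_off r + sec_mul r * t)))
    by ring.
  rewrite Rabs_mult, (Rabs_right 2) by lra.
  generalize (atan_lipschitz (sec_off r + sec_mul r * s) (sec_off r + sec_mul r * t)).
  replace (sec_off r + sec_mul r * s - (sec_off r + sec_mul r * t))
    with (sec_mul r * (s - t)) by ring.
  rewrite Rabs_mult, (Rabs_right (sec_mul r)) by (generalize (sec_mul_bound r); lra).
  generalize (sec_mul_bound r) (Rabs_pos (s - t)). nra.
Qed.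

Lemma sec_chord_ge (r : sector) (s t : R) :
  0 <= s <= 1 -> 0 <= t <= 1 ->
  Rabs (s - t) <= Cmod (expi (sec_angle r s) - expi (sec_angle r t)).
Proof.
  intros Hs Ht. unfold sec_angle. rewrite !expi_plus, !expi_2atan.
  set (x := sec_off r + sec_mul r * s). set (y := sec_off r + sec_mul r * t).
  replace (_ - _)%C with (expi (sec_base r) * (cayley x - cayley y))%C by ring.
  rewrite Cmod_mult, Cmod_expi, Rmult_1_l.
  eapply Rle_trans; [| apply Cdist_cayley_ge].
  - replace (x - y) with (sec_mul r * (s - t)) by (unfold x, y; ring).
    rewrite Rabs_mult, (Rabs_right (sec_mul r)) by (generalize (sec_mul_bound r); lra).
    generalize (sec_mul_bound r) (Rabs_pos (s - t)). nra.
  - unfold x; destruct r; simpl; lra.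
  - unfold y; destruct r; simpl; lra.
Qed.

Lemma sec_angle_surj (r : sector) (t : R) :
  sec_angle r 0 <= t <= sec_angle r 1 -> exists s, 0 <= s <= 1 /\ sec_angle r s = t.
Proof.
  intro H. generalize PI_RGT_0; intro Hp.
  set (s := (tan ((t - sec_base r) / 2) - sec_off r) / sec_mul r).
  assert (E : sec_angle r s = t).
  { unfold sec_angle, s.
    replace (sec_off r + sec_mul r * ((tan ((t - sec_base r) / 2) - sec_off r) / sec_mul r))
      with (tan ((t - sec_base r) / 2)) by (field; generalize (sec_mul_bound r); lra).
    rewrite atan_tan; [field |].
    destruct (sec_angle_ends r) as [E0 E1]. rewrite E0, E1 in H.
    destruct r; simpl; lra. }
  exists s. split; [| exact E].
  split; apply (sec_angle_le_inv r); rewrite E; apply H.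
Qed.

(* The point [(b + i a)^2 / |b + i a|^2], i.e. the image of [a / b] for any
   homogeneous coordinates, including [b = 0]. *)
Definition proj_pt (a b : R) : C :=
  ((b ^ 2 - a ^ 2) / (a ^ 2 + b ^ 2), 2 * a * b / (a ^ 2 + b ^ 2)).

Lemma norm_pos (a b : R) : (a, b) <> (0, 0) -> 0 < a ^ 2 + b ^ 2.
Proof.
  intro H. destruct (Req_dec a 0) as [-> | Ha]; [destruct (Req_dec b 0) as [-> | Hb] |].
  - contradiction.
  - generalize (pow2_gt_0 b Hb). lra.
  - generalize (pow2_gt_0 a Ha) (pow2_ge_0 b). lra.
Qed.

Lemma proj_pt_scale (k a b : R) : k <> 0 -> 0 < a ^ 2 + b ^ 2 -> proj_pt (k * a) (k * b) = proj_pt a b.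
Proof.
  intros Hk H. unfold proj_pt.
  assert ((k * a) ^ 2 + (k * b) ^ 2 <> 0).
  { replace (_ + _) with (k ^ 2 * (a ^ 2 + b ^ 2)) by ring.
    apply Rmult_integral_contrapositive_currified; [apply pow_nonzero, Hk | lra]. }
  f_equal; field; split; lra.
Qed.

(** With w = b + i a, equality of w^2 / |w|^2 and w'^2 / |w'|^2 makes the square of conj(w) w'
    positive, so this product is real. [K] is the vanishing of the imaginary part of the square; [D]
    and [D2] exclude a purely imaginary product. *)
Lemma proj_pt_inj (a b a' b' : R) :
  0 < a ^ 2 + b ^ 2 -> 0 < a' ^ 2 + b' ^ 2 ->
  proj_pt a b = proj_pt a' b' -> a * b' = a' * b.
Proof.
  unfold proj_pt. intros H H' E.
  pose proof (f_equal fst E) as E1. pose proof (f_equal snd E) as E2. cbv [fst snd] in E1, E2.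
  set (n := a ^ 2 + b ^ 2) in *. set (n' := a' ^ 2 + b' ^ 2) in *.
  assert (F1 : (b ^ 2 - a ^ 2) * n' = (b' ^ 2 - a' ^ 2) * n).
  { apply (Rmult_eq_reg_r (/ n * / n')).
    - transitivity ((b ^ 2 - a ^ 2) / n); [field; lra |].
      rewrite E1. field. lra.
    - apply Rmult_integral_contrapositive_currified; apply Rinv_neq_0_compat; lra. }
  assert (F2 : (2 * a * b) * n' = (2 * a' * b') * n).
  { apply (Rmult_eq_reg_r (/ n * / n')).
    - transitivity (2 * a * b / n); [field; lra |].
      rewrite E2. field. lra.
    - apply Rmult_integral_contrapositive_currified; apply Rinv_neq_0_compat; lra. }
  assert (K : n * n * ((b * a' - a * b') * (b * b' + a * a')) = 0).
  { transitivity (((b ^ 2 - a ^ 2) * n) * (a' * b' * n) - a * b * n * ((b' ^ 2 - a' ^ 2) * n)); [ring |].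
    rewrite <- F1.
    replace (a' * b' * n) with (a * b * n') by lra. ring. }
  assert (D : n * n' = (b * b' + a * a') ^ 2 + (b * a' - a * b') ^ 2) by (unfold n, n'; ring).
  assert (D2 : n * n * (n * n') = n * n * ((b * b' + a * a') ^ 2 - (b * a' - a * b') ^ 2)).
  { transitivity (n * n * n * n' * ((n * n) / (n * n))); [field; lra |].
    transitivity (n * (b ^ 2 - a ^ 2) * ((b' ^ 2 - a' ^ 2) * n) + (2 * a * b) * n * ((2 * a' * b') * n)).
    - rewrite <- F1, <- F2.
      transitivity (n * n' * ((b ^ 2 - a ^ 2) ^ 2 + (2 * a * b) ^ 2)); [| ring].
      replace ((b ^ 2 - a ^ 2) ^ 2 + (2 * a * b) ^ 2) with (n * n) by (unfold n; ring).
      field; lra.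
    - ring. }
  assert (P : 0 < n * n) by nra.
  apply Rmult_eq_reg_l in D2; [| lra].
  apply Rmult_integral in K. destruct K as [K | K]; [lra |].
  apply Rmult_integral in K. destruct K as [K | K]; [lra |].
  nra.
Qed.

Lemma cusp_proj_pt (a b : Z) :
  (a, b) <> (0, 0)%Z -> cayley_bd (cusp a b) = proj_pt (IZR a) (IZR b).
Proof.
  intro H. unfold cusp. destruct (Z.eq_dec b 0) as [-> | Hb].
  - assert (IZR a <> 0).
    { intro E. apply eq_IZR in E. subst. contradiction. }
    unfold cayley_bd, proj_pt. apply C_eq; simpl; field; assumption.
  - assert (HB : IZR b <> 0) by (intro E; apply eq_IZR in E; contradiction).
    simpl. rewrite cayley_real. unfold proj_pt.
    assert (0 < IZR a ^ 2 + IZR b ^ 2) by (apply norm_pos; intro E; injection E; intros; contradiction).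
    f_equal; field; repeat split; try nra.
Qed.

Definition sec_proj (r : sector) (p q : R) : C :=
  match r with
  | sector1 => proj_pt p q
  | sector2 => proj_pt q (q - p)
  | sector3 => proj_pt (q - p) (- p)
  end.

Lemma expi_sec_angle (r : sector) (s : R) : expi (sec_angle r s) = sec_proj r s 1.
Proof.
  unfold sec_angle. rewrite expi_plus, expi_2atan, cayley_real.
  destruct r; simpl sec_base; simpl sec_off; simpl sec_mul; unfold sec_proj, proj_pt.
  - rewrite expi_0. apply C_eq; simpl; field; nra.
  - rewrite expi_PI. apply C_eq; simpl; field; nra.
  - replace (3 * (PI / 2)) with (PI + PI / 2) by field.
    rewrite expi_plus, expi_PI, expi_PI2. apply C_eq; simpl; field; nra.
Qed.

Lemma sec_proj_vec (r : sector) (p q : Z) :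
  (p, q) <> (0, 0)%Z ->
  sec_proj r (IZR p) (IZR q) = cayley_bd (cusp (fst (sec_vec r (p, q))) (snd (sec_vec r (p, q)))).
Proof.
  intro H. rewrite cusp_proj_pt.
  - destruct r; simpl; rewrite ?minus_IZR, ?opp_IZR; reflexivity.
  - destruct r; simpl; intro E; apply H; injection E as E1 E2; f_equal; lia.
Qed.

Lemma sec_proj_scale (r : sector) (s q : R) : q <> 0 -> sec_proj r (s * q) q = sec_proj r s 1.
Proof.
  intro Hq.
  destruct r; simpl.
  - rewrite <- (proj_pt_scale q s 1) by nra. f_equal; ring.
  - rewrite <- (proj_pt_scale q 1 (1 - s)) by nra. f_equal; ring.
  - rewrite <- (proj_pt_scale q (1 - s) (- s)) by nra. f_equal; ring.
Qed.

Lemma sector_cusp (r : sector) (p q : Z) :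
  (0 < q)%Z ->
  expi (sec_angle r (IZR p / IZR q)) =
  cayley_bd (cusp (fst (sec_vec r (p, q))) (snd (sec_vec r (p, q)))).
Proof.
  intro Hq. assert (0 < IZR q) by (apply IZR_lt, Hq).
  rewrite <- sec_proj_vec by (intro E; injection E; lia).
  rewrite expi_sec_angle, <- (sec_proj_scale r _ (IZR q)) by lra.
  f_equal. field. lra.
Qed.

(** The integral matrix of the sector has an integral inverse, which yields (p, q), and injectivity
    of the projective parametrisation forces s = p / q. The two signs come from normalising q to be
    positive. *)
Lemma sector_cusp_inv (r : sector) (s : R) (a b : Z) :
  (a, b) <> (0, 0)%Z -> expi (sec_angle r s) = cayley_bd (cusp a b) ->
  exists p q : Z, (0 < q)%Z /\ s = IZR p / IZR q /\
    (sec_vec r (p, q) = (a, b) \/ sec_vec r (p, q) = (- a, - b)%Z).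
Proof.
  intros Hab E.
  assert (G : exists p q : Z, (p, q) <> (0, 0)%Z /\ sec_vec r (p, q) = (a, b)).
  { assert (Hab' : ~ (a = 0 /\ b = 0)%Z) by (intros [-> ->]; contradiction).
    destruct r;
      [exists a, b | exists (a - b)%Z, a | exists (- b)%Z, (a - b)%Z];
      (split; [intro F; injection F; lia | simpl; f_equal; lia]). }
  destruct G as [p [q [Hpq Ev]]].
  assert (Hs : s * IZR q = IZR p).
  { replace a with (fst (sec_vec r (p, q))) in E by (rewrite Ev; reflexivity).
    replace b with (snd (sec_vec r (p, q))) in E by (rewrite Ev; reflexivity).
    rewrite <- sec_proj_vec, expi_sec_angle in E by assumption.
    assert (HN : 0 < IZR p ^ 2 + IZR q ^ 2).
    { apply norm_pos. intro F; injection F as F1 F2. apply eq_IZR in F1, F2. subst. contradiction. }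
    destruct r; simpl in E; apply proj_pt_inj in E; try nra.
    - destruct (Req_dec (IZR q) (IZR p)); nra.
    - destruct (Req_dec (IZR q) (IZR p)); [| nra].
      assert (IZR p <> 0) by nra. generalize (pow2_gt_0 _ H0). nra. }
  assert (Hq : q <> 0%Z).
  { intros ->. apply Hpq. rewrite Rmult_0_r in Hs. apply eq_sym in Hs. apply eq_IZR in Hs. subst; reflexivity. }
  assert (HqR : IZR q <> 0) by (intro F; apply eq_IZR in F; contradiction).
  destruct (Z_lt_dec 0 q) as [Hp | Hn].
  - exists p, q. repeat split; [assumption | rewrite <- Hs; field; assumption | left; assumption].
  - exists (- p)%Z, (- q)%Z. repeat split; [lia | rewrite !opp_IZR, <- Hs; field; assumption | right].
    destruct r; simpl in *; injection Ev as E1 E2; f_equal; lia.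
Qed.

(** Signed so as to be positive when [val u < val v] and both denominators are positive. *)
Definition vdet (u v : Z * Z) : Z := (fst v * snd u - fst u * snd v)%Z.

Lemma sec_vec_det (r : sector) (u v : Z * Z) :
  (fst (sec_vec r u) * snd (sec_vec r v) - snd (sec_vec r u) * fst (sec_vec r v) = - vdet u v)%Z.
Proof. destruct u, v; unfold vdet; destruct r; simpl; ring. Qed.

Lemma gcd_1_of_det (a b c d : Z) : Z.abs (a * d - b * c) = 1%Z -> Z.gcd a b = 1%Z.
Proof.
  intro H.
  assert (D : (Z.gcd a b | 1)%Z).
  { rewrite <- H. apply Z.divide_abs_r. apply Z.divide_sub_r.
    - apply Z.divide_mul_l, Z.gcd_divide_l.
    - apply Z.divide_mul_l, Z.gcd_divide_r. }
  apply Z.divide_1_r_nonneg in D; [exact D | apply Z.gcd_nonneg].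
Qed.

Definition val (u : Z * Z) : R := IZR (fst u) / IZR (snd u).

Definition sec_pt (r : sector) (u : Z * Z) : C := expi (sec_angle r (val u)).

Lemma farey_adj_of_det (r : sector) (u v : Z * Z) :
  (0 < snd u)%Z -> (0 < snd v)%Z -> Z.abs (vdet u v) = 1%Z ->
  farey_adj (sec_pt r u) (sec_pt r v).
Proof.
  destruct u as [p q], v as [p' q']. intros Hu Hv H.
  generalize (sec_vec_det r (p, q) (p', q')); intro D.
  exists (fst (sec_vec r (p, q))), (snd (sec_vec r (p, q))),
         (fst (sec_vec r (p', q'))), (snd (sec_vec r (p', q'))).
  assert (D' : Z.abs (fst (sec_vec r (p, q)) * snd (sec_vec r (p', q')) -
                      snd (sec_vec r (p, q)) * fst (sec_vec r (p', q'))) = 1%Z).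
  { rewrite D, Z.abs_opp. exact H. }
  repeat split.
  - eapply gcd_1_of_det, D'.
  - apply (gcd_1_of_det _ _ (fst (sec_vec r (p, q))) (snd (sec_vec r (p, q)))).
    rewrite <- Z.abs_opp, <- D'. f_equal. ring.
  - exact D'.
  - apply sector_cusp, Hu.
  - apply sector_cusp, Hv.
Qed.

Lemma farey_adj_sym (p q : C) : farey_adj p q -> farey_adj q p.
Proof.
  intros (a & b & c & d & H1 & H2 & H3 & H4 & H5).
  exists c, d, a, b. repeat split; try assumption.
  rewrite <- Z.abs_opp, <- H3. f_equal. ring.
Qed.

(** * The Farey tree *)

Definition vadd (u v : Z * Z) : Z * Z := (fst u + fst v, snd u + snd v)%Z.

(* The interval of the Stern-Brocot tree on [0,1] reached by a path, the head of
   the list being the last step. *)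
Fixpoint ends (w : list bool) : (Z * Z) * (Z * Z) :=
  match w with
  | [] => ((0, 1), (1, 1))%Z
  | b :: w =>
      let (u, v) := ends w in
      if b then (u, vadd u v) else (vadd u v, v)
  end.

Definition lv (w : list bool) : Z * Z := fst (ends w).
Definition rv (w : list bool) : Z * Z := snd (ends w).
Definition mv (w : list bool) : Z * Z := vadd (lv w) (rv w).

Lemma lv_true w : lv (true :: w) = lv w.
Proof. unfold lv; simpl; destruct (ends w); reflexivity. Qed.
Lemma rv_true w : rv (true :: w) = mv w.
Proof. unfold mv, lv, rv; simpl; destruct (ends w); reflexivity. Qed.
Lemma lv_false w : lv (false :: w) = mv w.
Proof. unfold mv, lv, rv; simpl; destruct (ends w); reflexivity. Qed.
Lemma rv_false w : rv (false :: w) = rv w.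
Proof. unfold rv; simpl; destruct (ends w); reflexivity. Qed.

Lemma ends_spec (w : list bool) :
  (0 <= fst (lv w) /\ 0 < snd (lv w) /\ 0 < snd (rv w) /\ fst (rv w) <= snd (rv w) /\
   vdet (lv w) (rv w) = 1 /\ fst (lv w) <= snd (lv w) /\ 0 <= fst (rv w))%Z.
Proof.
  unfold vdet.
  induction w as [| [|] w IH].
  - simpl. lia.
  - rewrite lv_true, rv_true. unfold mv, vadd; simpl fst; simpl snd. lia.
  - rewrite lv_false, rv_false. unfold mv, vadd; simpl fst; simpl snd. lia.
Qed.

Lemma val_sub (u v : Z * Z) :
  (0 < snd u)%Z -> (0 < snd v)%Z ->
  val v - val u = IZR (vdet u v) / (IZR (snd u) * IZR (snd v)).
Proof.
  intros Hu Hv. apply IZR_lt in Hu, Hv. unfold val, vdet.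
  rewrite minus_IZR, !mult_IZR. field. lra.
Qed.

Lemma vdet_mv (w : list bool) : vdet (lv w) (mv w) = 1%Z /\ vdet (mv w) (rv w) = 1%Z.
Proof.
  destruct (ends_spec w) as (_ & _ & _ & _ & H & _). unfold mv, vadd, vdet in *; simpl.
  split; rewrite <- H; ring.
Qed.

Definition ql (w : list bool) : R := IZR (snd (lv w)).
Definition qr (w : list bool) : R := IZR (snd (rv w)).

Lemma q_ge_1 (w : list bool) : 1 <= ql w /\ 1 <= qr w.
Proof.
  destruct (ends_spec w) as (_ & H1 & H2 & _).
  unfold ql, qr. split; apply IZR_le; lia.
Qed.

Lemma qm (w : list bool) : IZR (snd (mv w)) = ql w + qr w.
Proof. unfold mv, vadd, ql, qr. simpl. apply plus_IZR. Qed.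

Definition sl (w : list bool) : R := val (lv w).
Definition sr (w : list bool) : R := val (rv w).
Definition sm (w : list bool) : R := val (mv w).

Lemma s_spec (w : list bool) :
  0 <= sl w /\ sr w <= 1 /\ sr w - sl w = / (ql w * qr w) /\
  sm w - sl w = / (ql w * (ql w + qr w)) /\ sr w - sm w = / ((ql w + qr w) * qr w).
Proof.
  destruct (ends_spec w) as (H1 & H2 & H3 & H4 & H5 & H6).
  destruct (vdet_mv w) as [D1 D2].
  assert (M : (0 < snd (mv w))%Z) by (unfold mv, vadd; simpl; lia).
  repeat split.
  - unfold sl, val. apply Rdiv_le_0_compat; [apply IZR_le; lia | apply IZR_lt; lia].
  - unfold sr, val. apply -> Rdiv_le_1; [apply IZR_le; lia | apply IZR_lt; lia].
  - unfold sr, sl. rewrite val_sub, H5 by assumption. unfold Rdiv. apply Rmult_1_l.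
  - unfold sm, sl. rewrite val_sub, D1, qm by assumption. unfold Rdiv. apply Rmult_1_l.
  - unfold sr, sm. rewrite val_sub, D2, qm by assumption. unfold Rdiv. apply Rmult_1_l.
Qed.

Lemma s_lt (w : list bool) : sl w < sm w < sr w.
Proof.
  destruct (s_spec w) as (_ & _ & _ & H1 & H2). destruct (q_ge_1 w).
  assert (0 < / (ql w * (ql w + qr w))) by (apply Rinv_0_lt_compat; nra).
  assert (0 < / ((ql w + qr w) * qr w)) by (apply Rinv_0_lt_compat; nra).
  lra.
Qed.

Lemma s_range (w : list bool) : 0 <= sl w <= 1 /\ 0 <= sm w <= 1 /\ 0 <= sr w <= 1.
Proof. generalize (s_lt w) (s_spec w). lra. Qed.

Lemma q_prod_ge (w : list bool) : ql w + qr w - 1 <= ql w * qr w.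
Proof. generalize (q_ge_1 w). nra. Qed.

Lemma q_level (w : list bool) : INR (length w) + 2 <= ql w + qr w.
Proof.
  induction w as [| b w IH]; [unfold ql, qr; simpl; lra |].
  destruct (q_ge_1 w). simpl length. rewrite S_INR.
  destruct b.
  - unfold ql at 1, qr at 1. rewrite lv_true, rv_true, qm. fold (ql w). lra.
  - unfold ql at 1, qr at 1. rewrite lv_false, rv_false, qm. fold (qr w). lra.
Qed.

Lemma ql_true w : ql (true :: w) = ql w.
Proof. unfold ql. rewrite lv_true. reflexivity. Qed.
Lemma qr_true w : qr (true :: w) = ql w + qr w.
Proof. unfold qr at 1. rewrite rv_true. apply qm. Qed.
Lemma ql_false w : ql (false :: w) = ql w + qr w.
Proof. unfold ql at 1. rewrite lv_false. apply qm. Qed.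
Lemma qr_false w : qr (false :: w) = qr w.
Proof. unfold qr. rewrite rv_false. reflexivity. Qed.

(** The Euclidean algorithm run on the denominators: the larger one was created by the last step,
    subtracting the smaller one undoes that step, and at the root both are 1. *)
Lemma q_inj (w w' : list bool) : ql w = ql w' -> qr w = qr w' -> w = w'.
Proof.
  revert w'. induction w as [| b w IH]; intros [| b' w'].
  - reflexivity.
  - intros H1 H2. exfalso. generalize (q_ge_1 w'). destruct b'.
    + rewrite qr_true in H2. change (qr []) with 1 in H2. lra.
    + rewrite ql_false in H1. change (ql []) with 1 in H1. lra.
  - intros H1 H2. exfalso. generalize (q_ge_1 w). destruct b.
    + rewrite qr_true in H2. change (qr []) with 1 in H2. lra.
    + rewrite ql_false in H1. change (ql []) with 1 in H1. lra.
  - destruct (q_ge_1 w), (q_ge_1 w').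
    destruct b, b'; rewrite ?ql_true, ?qr_true, ?ql_false, ?qr_false; intros H3 H4;
      try (exfalso; lra); f_equal; apply IH; lra.
Qed.

(** The same subtractive algorithm applied to any unimodular interval in [0, 1]: removing the
    endpoint of smaller denominator from the other one keeps the determinant and the bounds. Equal
    denominators satisfy q (p' - p) = 1, which leaves only the root. The number n serves the
    induction on q + q'. *)
Lemma ends_surj (n : nat) (p q p' q' : Z) :
  (Z.to_nat (q + q') <= n)%nat ->
  (0 < q -> 0 < q' -> 0 <= p -> p' <= q' -> p' * q - p * q' = 1 ->
   exists w, ends w = ((p, q), (p', q')))%Z.
Proof.
  revert p q p' q'. induction n as [| n IH]; intros p q p' q' Hn Hq Hq' Hp Hp' D; [lia |].
  destruct (Ztrichotomy q q') as [L | [L | L]].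
  - assert (p <= p')%Z by nia.
    assert (q - p <= q' - p')%Z by nia.
    destruct (IH p q (p' - p)%Z (q' - q)%Z) as [w Hw]; try lia.
    exists (true :: w). simpl. rewrite Hw. unfold vadd; simpl. repeat f_equal; lia.
  - subst q'. assert (K : (q * (p' - p) = 1)%Z) by lia.
    apply Z.eq_mul_1_nonneg in K; [| lia]. assert (q = 1)%Z by lia. subst q. exists []. simpl. repeat f_equal; lia.
  - assert (p' <= p)%Z by nia.
    assert (q' - p' <= q - p)%Z by nia.
    destruct (IH (p - p')%Z (q - q')%Z p' q') as [w Hw]; try lia.
    exists (false :: w). simpl. rewrite Hw. unfold vadd; simpl. repeat f_equal; lia.
Qed.

(** * Edges of the tesselation as nodes of three Farey trees *)

Definition ang_l (r : sector) (w : list bool) : R := sec_angle r (sl w).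
Definition ang_r (r : sector) (w : list bool) : R := sec_angle r (sr w).
Definition ang_m (r : sector) (w : list bool) : R := sec_angle r (sm w).

Lemma ang_l_true r w : ang_l r (true :: w) = ang_l r w.
Proof. unfold ang_l, sl. rewrite lv_true. reflexivity. Qed.
Lemma ang_r_true r w : ang_r r (true :: w) = ang_m r w.
Proof. unfold ang_r, sr, ang_m, sm. rewrite rv_true. reflexivity. Qed.
Lemma ang_l_false r w : ang_l r (false :: w) = ang_m r w.
Proof. unfold ang_l, sl, ang_m, sm. rewrite lv_false. reflexivity. Qed.
Lemma ang_r_false r w : ang_r r (false :: w) = ang_r r w.
Proof. unfold ang_r, sr. rewrite rv_false. reflexivity. Qed.

Lemma ang_lt r w : ang_l r w < ang_m r w < ang_r r w.
Proof. generalize (s_lt w); intros []. split; apply sec_angle_lt; assumption. Qed.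

Lemma ang_range r w : sec_angle r 0 <= ang_l r w /\ ang_r r w <= sec_angle r 1.
Proof. generalize (s_spec w); intros (? & ? & _). split; apply sec_angle_le; assumption. Qed.

Lemma ang_range_2PI r w : 0 <= ang_l r w /\ ang_r r w <= 2 * PI.
Proof.
  generalize (ang_range r w) PI_RGT_0. destruct (sec_angle_ends r) as [-> ->]. destruct r; lra.
Qed.

Lemma ang_length r w : ang_r r w - ang_l r w <= PI.
Proof.
  generalize (ang_range r w) PI_RGT_0. destruct (sec_angle_ends r) as [-> ->]. destruct r; lra.
Qed.

Lemma mk_adj r w : farey_adj (expi (ang_l r w)) (expi (ang_r r w)).
Proof.
  destruct (ends_spec w) as (_ & H2 & H3 & _ & H5 & _).
  apply (farey_adj_of_det r (lv w) (rv w)); [assumption | assumption |]. rewrite H5. reflexivity.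
Qed.

Lemma adj_lm r w : farey_adj (expi (ang_l r w)) (expi (ang_m r w)).
Proof. rewrite <- ang_l_true, <- ang_r_true. apply mk_adj. Qed.

Lemma adj_mr r w : farey_adj (expi (ang_m r w)) (expi (ang_r r w)).
Proof. rewrite <- ang_l_false, <- ang_r_false. apply mk_adj. Qed.

Lemma mk_range r w : 0 <= ang_l r w /\ ang_l r w < ang_r r w /\ ang_r r w <= 2 * PI.
Proof. generalize (ang_range_2PI r w) (ang_lt r w). lra. Qed.

Lemma expi_inj (a b : R) : 0 <= a < 2 * PI -> 0 <= b < 2 * PI -> expi a = expi b -> a = b.
Proof.
  intros Ha Hb E. destruct (Rle_dec a b).
  - apply expi_eq_close; [assumption | lra].
  - symmetry. apply expi_eq_close; [symmetry; assumption | lra].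
Qed.

Lemma mk_arc r w (phi : R) : ang_l r w < phi < ang_r r w ->
  expi phi <> RtoC 1 /\ expi phi <> Ci /\ expi phi <> RtoC (-1).
Proof.
  intro H. generalize (ang_range r w) PI_RGT_0.
  destruct (sec_angle_ends r) as [-> ->]. intros Hr Hp.
  rewrite <- expi_0, <- expi_PI2, <- expi_PI.
  repeat split; intro E; apply expi_inj in E; destruct r; lra.
Qed.

Definition mk_edge (r : sector) (w : list bool) : edge :=
  Edge (ang_l r w) (ang_r r w) (mk_adj r w) (mk_range r w) (mk_arc r w).

Lemma edge_ext (e f : edge) : phi0 e = phi0 f -> phi1 e = phi1 f -> e = f.
Proof.
  destruct e as [a b A B D], f as [a' b' A' B' D']; simpl. intros -> ->.
  f_equal; apply proof_irrelevance.
Qed.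

(** It suffices to keep PI / 2 and PI out of the open arc: the angles 0 and 2 PI of the point 1 are
    the extreme values allowed for an edge. *)
Lemma edge_sector (e : edge) :
  exists r, sec_angle r 0 <= phi0 e /\ phi1 e <= sec_angle r 1.
Proof.
  destruct e as [a b A B D]; simpl. generalize PI_RGT_0; intro Hp.
  assert (N1 : ~ (a < PI / 2 < b)).
  { intro H. destruct (D (PI / 2) H) as (_ & K & _). apply K, expi_PI2. }
  assert (N2 : ~ (a < PI < b)).
  { intro H. destruct (D PI H) as (_ & _ & K). apply K, expi_PI. }
  destruct (Rlt_dec a (PI / 2)); [exists sector1 | destruct (Rlt_dec a PI); [exists sector2 | exists sector3]];
    (match goal with |- sec_angle ?r _ <= _ /\ _ => destruct (sec_angle_ends r) as [-> ->] end); lra.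
Qed.

(** The chart of the sector pulls both endpoints back to fractions in [0, 1]. Unimodularity
    preserves the determinant up to sign, the order of the angles fixes the sign, and the Euclidean
    algorithm locates the resulting interval in the tree. *)
Lemma edge_code (e : edge) : exists r w, e = mk_edge r w.
Proof.
  destruct (edge_sector e) as [r [H0 H1]]. exists r.
  destruct (edge_range e) as (_ & Hlt & _).
  destruct (sec_angle_surj r (phi0 e)) as [s [Hs Es]]; [lra |].
  destruct (sec_angle_surj r (phi1 e)) as [s' [Hs' Es']]; [lra |].
  destruct (edge_adj e) as (a & b & c & d & G1 & G2 & D & P & Q).
  rewrite <- Es in P. rewrite <- Es' in Q.
  assert (Nab : (a, b) <> (0, 0)%Z) by (intro F; injection F; intros; subst; discriminate).
  assert (Ncd : (c, d) <> (0, 0)%Z) by (intro F; injection F; intros; subst; discriminate).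
  destruct (sector_cusp_inv r s a b Nab P) as (p & q & Hq & Ep & Vp).
  destruct (sector_cusp_inv r s' c d Ncd Q) as (p' & q' & Hq' & Ep' & Vp').
  assert (Hss : s < s') by (apply (sec_angle_lt_inv r); lra).
  assert (HqR : 0 < IZR q) by (apply IZR_lt, Hq).
  assert (HqR' : 0 < IZR q') by (apply IZR_lt, Hq').
  assert (DD : Z.abs (vdet (p, q) (p', q')) = 1%Z).
  { rewrite <- Z.abs_opp, <- (sec_vec_det r).
    destruct Vp as [-> | ->], Vp' as [-> | ->]; cbn [fst snd]; rewrite <- D.
    - f_equal; ring.
    - rewrite <- Z.abs_opp. f_equal; ring.
    - rewrite <- Z.abs_opp. f_equal; ring.
    - f_equal; ring. }
  assert (DP : (0 < vdet (p, q) (p', q'))%Z).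
  { apply lt_IZR. generalize (val_sub (p, q) (p', q') Hq Hq'). unfold val; cbn [fst snd].
    rewrite <- Ep, <- Ep'. intro E.
    replace (IZR (vdet (p, q) (p', q'))) with ((s' - s) * (IZR q * IZR q')) by (rewrite E; field; lra).
    apply Rmult_lt_0_compat; [lra | apply Rmult_lt_0_compat; assumption]. }
  assert (D1 : vdet (p, q) (p', q') = 1%Z) by lia.
  assert (Pp : (0 <= p)%Z).
  { apply le_IZR. replace (IZR p) with (s * IZR q) by (rewrite Ep; field; lra). nra. }
  assert (Pp' : (p' <= q')%Z).
  { apply le_IZR. replace (IZR p') with (s' * IZR q') by (rewrite Ep'; field; lra). nra. }
  destruct (ends_surj (Z.to_nat (q + q')) p q p' q') as [w Hw]; try assumption; [lia |].
  exists w. apply edge_ext; simpl.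
  - rewrite <- Es. unfold ang_l, sl, lv. rewrite Hw. simpl. unfold val; simpl. rewrite Ep. reflexivity.
  - rewrite <- Es'. unfold ang_r, sr, rv. rewrite Hw. simpl. unfold val; simpl. rewrite Ep'. reflexivity.
Qed.

(** Determinant one puts the endpoints in lowest terms, so denominators of equal fractions divide
    each other ([X]), and the denominators determine the path. *)
Lemma val_q_inj w w' : sl w = sl w' -> sr w = sr w' -> w = w'.
Proof.
  intros H1 H2.
  assert (Hl : (fst (lv w) * snd (lv w') = fst (lv w') * snd (lv w))%Z).
  { apply eq_IZR. rewrite !mult_IZR. unfold sl, val in H1.
    generalize (q_ge_1 w) (q_ge_1 w'). unfold ql. intros.
    apply (Rmult_eq_reg_r (/ IZR (snd (lv w')) * / IZR (snd (lv w)))).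
    - transitivity (IZR (fst (lv w)) / IZR (snd (lv w))); [field; lra | rewrite H1; field; lra].
    - apply Rmult_integral_contrapositive_currified; apply Rinv_neq_0_compat; lra. }
  assert (Hr : (fst (rv w) * snd (rv w') = fst (rv w') * snd (rv w))%Z).
  { apply eq_IZR. rewrite !mult_IZR. unfold sr, val in H2.
    generalize (q_ge_1 w) (q_ge_1 w'). unfold qr. intros.
    apply (Rmult_eq_reg_r (/ IZR (snd (rv w')) * / IZR (snd (rv w)))).
    - transitivity (IZR (fst (rv w)) / IZR (snd (rv w))); [field; lra | rewrite H2; field; lra].
    - apply Rmult_integral_contrapositive_currified; apply Rinv_neq_0_compat; lra. }
  destruct (ends_spec w) as (_ & A1 & A2 & _ & A3 & _).
  destruct (ends_spec w') as (_ & B1 & B2 & _ & B3 & _).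
  unfold vdet in A3, B3.
  assert (forall p q p' q' u v : Z, (0 < q -> 0 < q' -> p * q' = p' * q ->
    u * q - p * v = 1 \/ p * v - u * q = 1 -> (q | q'))%Z) as X.
  { intros p q p' q' u v ? ? E [F | F].
    - exists (u * q' - p' * v)%Z. transitivity (q' * (u * q - p * v))%Z; [rewrite F; ring |].
      transitivity (u * q * q' - v * (p * q'))%Z; [ring | rewrite E; ring].
    - exists (p' * v - u * q')%Z. transitivity (q' * (p * v - u * q))%Z; [rewrite F; ring |].
      transitivity (v * (p * q') - u * q * q')%Z; [ring | rewrite E; ring]. }
  apply q_inj; unfold ql, qr; f_equal; apply Z.divide_antisym_nonneg; try lia.
  - eapply X; [| | exact Hl | left; exact A3]; assumption.
  - eapply X; [| | symmetry; exact Hl | left; exact B3]; assumption.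
  - eapply X; [| | exact Hr | right; exact A3]; assumption.
  - eapply X; [| | symmetry; exact Hr | right; exact B3]; assumption.
Qed.

Lemma ang_sector r w r' w' : ang_l r w = ang_l r' w' -> ang_r r w = ang_r r' w' -> r = r'.
Proof.
  intros H1 H2. generalize (ang_range r w) (ang_range r' w') (ang_lt r w) PI_RGT_0.
  destruct (sec_angle_ends r) as [-> ->], (sec_angle_ends r') as [-> ->].
  destruct r, r'; intros; try reflexivity; exfalso; lra.
Qed.

Lemma mk_edge_inj r w r' w' : mk_edge r w = mk_edge r' w' -> r = r' /\ w = w'.
Proof.
  intro E.
  assert (E1 : ang_l r w = ang_l r' w') by apply (f_equal phi0 E).
  assert (E2 : ang_r r w = ang_r r' w') by apply (f_equal phi1 E).
  assert (r = r') by (eapply ang_sector; eassumption). subst r'.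
  split; [reflexivity |].
  apply val_q_inj; apply Rle_antisym; apply (sec_angle_le_inv r);
    unfold ang_l, ang_r in E1, E2; lra.
Qed.

(* The angle of the vertex opposite to the edge in the triangle on the side of
   the base triangle. *)
Definition inner (r : sector) (w : list bool) : R :=
  match w with
  | [] => match r with sector1 => - PI | sector2 => 0 | sector3 => PI / 2 end
  | true :: w' => ang_r r w' - 2 * PI
  | false :: w' => ang_l r w'
  end.

(** The representatives modulo 2 PI in [inner] are chosen to precede the arc, so that the opposite
    vertex, the left end, the mediant and the right end are listed counterclockwise within one turn,
    as [ccw4] asks. *)
Lemma inner_ccw r w : inner r w < ang_l r w /\ ang_r r w < inner r w + 2 * PI.
Proof.
  destruct w as [| [|] w]; unfold inner.
  - unfold ang_l, ang_r, sl, sr, lv, rv, val; simpl.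
    replace (0 / 1) with 0 by field. replace (1 / 1) with 1 by field.
    destruct (sec_angle_ends r) as [-> ->]. generalize PI_RGT_0. destruct r; lra.
  - rewrite ang_l_true, ang_r_true. generalize (ang_lt r w) (ang_length r w) (ang_range_2PI r w) PI_RGT_0. lra.
  - rewrite ang_l_false, ang_r_false. generalize (ang_lt r w) (ang_length r w) PI_RGT_0. lra.
Qed.

Lemma base_adj :
  farey_adj (RtoC 1) Ci /\ farey_adj Ci (RtoC (-1)) /\ farey_adj (RtoC (-1)) (RtoC 1).
Proof.
  generalize (mk_adj sector1 []) (mk_adj sector2 []) (mk_adj sector3 []).
  unfold ang_l, ang_r, sl, sr, lv, rv, val; simpl.
  replace (0 / 1) with 0 by field. replace (1 / 1) with 1 by field.
  destruct (sec_angle_ends sector1) as [-> ->], (sec_angle_ends sector2) as [-> ->],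
    (sec_angle_ends sector3) as [-> ->].
  replace (2 * PI) with (0 + 2 * PI) by ring.
  rewrite expi_2PI_shift, expi_0, expi_PI, expi_PI2.
  intros; repeat split; assumption.
Qed.

Lemma inner_triangle r w :
  farey_triangle (expi (inner r w)) (expi (ang_l r w)) (expi (ang_r r w)).
Proof.
  unfold farey_triangle. destruct w as [| [|] w].
  - destruct base_adj as (B1 & B2 & B3).
    unfold ang_l, ang_r, sl, sr, lv, rv, val; simpl.
    replace (0 / 1) with 0 by field. replace (1 / 1) with 1 by field.
    destruct (sec_angle_ends r) as [-> ->].
    assert (E2 : expi (2 * PI) = RtoC 1).
    { rewrite <- expi_0, <- (expi_2PI_shift 0). f_equal. ring. }
    assert (Em : expi (- PI) = RtoC (-1)).
    { rewrite <- expi_PI, <- (expi_2PI_shift (- PI)). f_equal. ring. }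
    destruct r; rewrite ?expi_0, ?expi_PI, ?expi_PI2, ?E2, ?Em; repeat split;
      first [assumption | apply farey_adj_sym; assumption].
  - simpl inner. rewrite ang_l_true, ang_r_true, expi_minus_2PI. repeat split.
    + apply farey_adj_sym, mk_adj.
    + apply adj_lm.
    + apply farey_adj_sym, adj_mr.
  - simpl inner. rewrite ang_l_false, ang_r_false. repeat split.
    + apply adj_lm.
    + apply adj_mr.
    + apply mk_adj.
Qed.

Lemma outer_triangle r w :
  farey_triangle (expi (ang_m r w)) (expi (ang_l r w)) (expi (ang_r r w)).
Proof.
  repeat split.
  - apply farey_adj_sym, adj_lm.
  - apply mk_adj.
  - apply adj_mr.
Qed.

Lemma shear_at_node (V : C -> C) (sdot : edge -> R) r w :
  is_inf_shear V sdot ->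
  RtoC (sdot (mk_edge r w)) =
  shear_expr V (expi (inner r w)) (expi (ang_l r w)) (expi (ang_m r w)) (expi (ang_r r w)).
Proof.
  intro H. apply H.
  - reflexivity.
  - reflexivity.
  - apply inner_triangle.
  - apply outer_triangle.
  - exists (inner r w), (ang_l r w), (ang_m r w), (ang_r r w).
    generalize (inner_ccw r w) (ang_lt r w). repeat split; lra.
Qed.

(** * Zygmund fields are Hoelder continuous *)

Lemma zygmund_const_nonneg (f : R -> R) (M : R) : zygmund_bound M f -> 0 <= M.
Proof.
  intro Z. generalize (Z 0 1 ltac:(lra) ltac:(lra)) (Rabs_pos (f (0 + 1) + f (0 - 1) - 2 * f 0)). lra.
Qed.

(** This is the second difference centred at x + t / 2 with step t / 2, read as a comparison of half
    the increment with the increment over half the step. *)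
Lemma zygmund_half (f : R -> R) (M x t : R) :
  zygmund_bound M f -> -3/2 <= x <= 3/2 -> 0 <= t <= 1/2 ->
  Rabs (f (x + t / 2) - f x) <= Rabs (f (x + t) - f x) / 2 + M * t / 4.
Proof.
  intros Z Hx Ht.
  generalize (Z (x + t / 2) (t / 2) ltac:(lra) ltac:(lra)).
  replace (x + t / 2 + t / 2) with (x + t) by field.
  replace (x + t / 2 - t / 2) with x by field.
  intro H. unfold Rabs in *. repeat destruct Rcase_abs; lra.
Qed.

(* Halving the step four times divides it by 16 and the increment, up to O(t),
   also; with t = r^4 this is r -> r / 2 against r^3 -> r^3 / 8. *)
Lemma zygmund_holder_right (f : R -> R) (M B : R) :
  zygmund_bound M f -> (forall x, -2 <= x <= 2 -> Rabs (f x) <= B) ->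
  forall x r, -3/2 <= x <= 3/2 -> 0 <= r -> r ^ 4 <= 1/2 ->
  Rabs (f (x + r ^ 4) - f x) <= (128 * B + 4 * M) * r ^ 3.
Proof.
  intros Z HB x r Hx Hr Hr4.
  assert (HM : 0 <= M) by (eapply zygmund_const_nonneg, Z).
  assert (HB0 : 0 <= B).
  { generalize (HB 0 ltac:(lra)) (Rabs_pos (f 0)). lra. }
  (* For r >= 1/4 the trivial bound 2 B is enough, because r^3 >= 1/64; this is where 128 comes
     from. *)
  assert (Base : forall r, 1/4 <= r -> r ^ 4 <= 1/2 ->
    Rabs (f (x + r ^ 4) - f x) <= (128 * B + 4 * M) * r ^ 3).
  { intros s Hs Hs4.
    assert (0 <= s ^ 4) by (apply pow_le; lra).
    assert (1/64 <= s ^ 3).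
    { replace (1/64) with ((1/4) ^ 3) by field. apply pow_incr. lra. }
    generalize (HB (x + s ^ 4) ltac:(lra)) (HB x ltac:(lra)). intros A1 A2.
    assert (Rabs (f (x + s ^ 4) - f x) <= 2 * B).
    { unfold Rabs in *. repeat destruct Rcase_abs; lra. }
    nra. }
  destruct Hr as [Hr | <-].
  2: { replace (x + 0 ^ 4) with x by ring. replace (f x - f x) with 0 by ring.
       rewrite Rabs_R0. simpl. lra. }
  assert (K : exists k : nat, 1/4 * (1/2) ^ k <= r).
  { destruct (pow_lt_1_zero (1/2) ltac:(rewrite Rabs_right; lra) r Hr) as [k Hk].
    exists k. specialize (Hk k (le_n k)).
    rewrite Rabs_right in Hk by (apply Rle_ge, pow_le; lra). 
    assert (0 <= (1/2)^k) by (apply pow_le; lra). lra. }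
  destruct K as [k Hk]. revert r Hr Hr4 Hk. induction k as [| k IH]; intros r Hr Hr4 Hk.
  - apply Base; simpl in Hk; lra.
  - destruct (Rle_dec (1/4) r) as [Hl | Hl]; [apply Base; assumption |].
    assert (P1 : r ^ 2 <= 1/16) by nra.
    assert (P2 : (2 * r) ^ 4 <= 1/2).
    { replace ((2 * r) ^ 4) with (16 * (r ^ 2 * r ^ 2)) by ring. nra. }
    specialize (IH (2 * r) ltac:(lra) P2 ltac:(simpl in Hk; lra)).
    set (t := r ^ 4) in *.
    assert (Et : (2 * r) ^ 4 = 16 * t) by (unfold t; ring).
    rewrite Et in *. assert (Ht : 0 <= t) by (unfold t; apply pow_le; lra).
    generalize (zygmund_half f M x (2 * t) Z Hx ltac:(lra)).
    generalize (zygmund_half f M x (4 * t) Z Hx ltac:(lra)).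
    generalize (zygmund_half f M x (8 * t) Z Hx ltac:(lra)).
    generalize (zygmund_half f M x (16 * t) Z Hx ltac:(lra)).
    replace (16 * t / 2) with (8 * t) by field. replace (8 * t / 2) with (4 * t) by field.
    replace (4 * t / 2) with (2 * t) by field. replace (2 * t / 2) with t by field.
    intros.
    (* Each of the four halvings contributes M t / 2 after the later divisions by 2. *)
    assert (Rabs (f (x + t) - f x) <= Rabs (f (x + 16 * t) - f x) / 16 + 2 * M * t) by lra.
    assert (0 <= r ^ 3) by (apply pow_le; lra).
    assert (t <= r ^ 3 / 4) by (unfold t; replace (r ^ 4) with (r * r ^ 3) by ring; nra).
    replace ((2 * r) ^ 3) with (8 * r ^ 3) in IH by ring.
    nra.
Qed.

Lemma root4_exists (t : R) : 0 <= t -> exists r, 0 <= r /\ r ^ 4 = t.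
Proof.
  intro Ht. exists (sqrt (sqrt t)). split; [apply sqrt_pos |].
  replace (sqrt (sqrt t) ^ 4) with ((sqrt (sqrt t) * sqrt (sqrt t)) * (sqrt (sqrt t) * sqrt (sqrt t))) by ring.
  rewrite sqrt_sqrt by apply sqrt_pos. apply sqrt_sqrt, Ht.
Qed.

Lemma pow4_le_inv (a b : R) : 0 <= b -> a ^ 4 <= b ^ 4 -> a <= b.
Proof.
  intros Hb H. destruct (Rle_dec a b) as [| Hn]; [assumption | exfalso].
  assert (b ^ 2 < a ^ 2) by nra. nra.
Qed.

Lemma zygmund_holder (f : R -> R) (M B : R) :
  zygmund_bound M f -> (forall x, -2 <= x <= 2 -> Rabs (f x) <= B) ->
  forall x y r, -3/2 <= x <= 3/2 -> -3/2 <= y <= 3/2 -> 0 <= r -> r ^ 4 <= 1/2 ->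
  Rabs (x - y) <= r ^ 4 -> Rabs (f x - f y) <= (128 * B + 4 * M) * r ^ 3.
Proof.
  intros Z HB.
  assert (G : forall x y r, -3/2 <= x <= 3/2 -> -3/2 <= y <= 3/2 -> 0 <= r -> r ^ 4 <= 1/2 ->
    y <= x -> Rabs (x - y) <= r ^ 4 -> Rabs (f x - f y) <= (128 * B + 4 * M) * r ^ 3).
  { intros x y r Hx Hy Hr Hr4 Hyx H. rewrite Rabs_right in H by lra.
    destruct (root4_exists (x - y)) as [s [Hs Es]]; [lra |].
    assert (Hsr : s <= r) by (apply pow4_le_inv; lra).
    replace x with (y + s ^ 4) by lra.
    eapply Rle_trans; [apply (zygmund_holder_right f M B); try assumption; lra |].
    apply Rmult_le_compat_l.
    - generalize (zygmund_const_nonneg f M Z) (HB 0 ltac:(lra)) (Rabs_pos (f 0)). lra.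
    - apply pow_incr. lra. }
  intros x y r Hx Hy Hr Hr4 H. destruct (Rle_dec y x).
  - apply G; assumption.
  - rewrite Rabs_minus_sym. rewrite Rabs_minus_sym in H. apply G; try assumption; lra.
Qed.

(** * Transfer of the Hoelder estimate from the line to the circle *)

Lemma cos_lipschitz (a b : R) : Rabs (cos a - cos b) <= Rabs (a - b).
Proof.
  eapply Rle_trans; [| apply Cmod_expi_minus].
  generalize (re_le_Cmod (expi a - expi b)%C). simpl. trivial.
Qed.

(** The component of the field in the angular coordinate: for x = tan(t/2) one has dt/dx = 2
    cos(t/2)^2, so the field at [expi t] is i [expi t] times this number. *)
Definition chart_fun (f : R -> R) (t : R) : R := 2 * cos (t / 2) ^ 2 * f (tan (t / 2)).

Lemma half_angle (t : R) : 2 * cos (t / 2) ^ 2 = 1 + cos t.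
Proof.
  replace t with (2 * (t / 2)) at 2 by field. rewrite cos_2a_cos. ring.
Qed.

(** Where cos t >= 0, cos(t/2)^2 is at least 1/2 and |tan(t/2)| at most 1. The restriction r^4 <=
    1/100 keeps the tangent of the second half angle within [-3/2, 3/2], where the estimate on the
    line is available. *)
Lemma chart_fun_holder (f : R -> R) (M B : R) :
  zygmund_bound M f -> (forall x, -2 <= x <= 2 -> Rabs (f x) <= B) ->
  exists K, 0 <= K /\ forall t u r, 0 <= r -> r ^ 4 <= 1/100 -> 0 <= cos t -> Rabs (t - u) <= r ^ 4 ->
    cos (u / 2) <> 0 /\
    Rabs (chart_fun f t) <= K /\ Rabs (chart_fun f t - chart_fun f u) <= K * r ^ 3.
Proof.
  intros Z HB.
  assert (HM : 0 <= M) by (eapply zygmund_const_nonneg, Z).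
  assert (HB0 : 0 <= B).
  { generalize (HB 0 ltac:(lra)) (Rabs_pos (f 0)). lra. }
  exists (2 * (8 * (128 * B + 4 * M)) + 2 * B). split; [lra |].
  intros t u r Hr Hr4 Ht Htu.
  generalize (half_angle t). unfold chart_fun.
  set (c := cos (t / 2)). set (c' := cos (u / 2)). intro Hc.
  assert (Hcc : Rabs (c - c') <= r ^ 4 / 2).
  { unfold c, c'. eapply Rle_trans; [apply cos_lipschitz |].
    replace (t / 2 - u / 2) with ((t - u) / 2) by field.
    unfold Rdiv. rewrite Rabs_mult, (Rabs_right (/ 2)) by lra. lra. }
  assert (Hc2 : 1/2 <= c ^ 2) by lra.
  assert (Hs : Rabs (tan (t / 2)) <= 1 /\ c <> 0).
  { assert (c <> 0) by nra. split; [| assumption]. unfold tan. fold c.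
    generalize (sin2_cos2 (t / 2)). unfold Rsqr. fold c. set (s := sin (t / 2)). intro E.
    rewrite <- Rabs_R1. apply Rsqr_le_abs_0. unfold Rsqr.
    replace (s / c * (s / c)) with (s * s / (c * c)) by (field; assumption).
    apply Rle_div_l; nra. }
  destruct Hs as [Hs Hc0].
  assert (Hca : 7/10 <= Rabs c).
  { destruct (Rle_dec (7/10) (Rabs c)) as [| Hn]; [assumption | exfalso].
    generalize (Rabs_pos c) (pow2_abs c). nra. }
  assert (Hca' : 65/100 <= Rabs c').
  { unfold Rabs in *. repeat destruct Rcase_abs; lra. }
  assert (Hc0' : c' <> 0).
  { intro E. rewrite E, Rabs_R0 in Hca'. lra. }
  assert (Hcle : Rabs c <= 1 /\ Rabs c' <= 1).
  { split; apply Rabs_le; unfold c, c'; apply COS_bound. }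
  (* The difference of tangents is sin((t - u)/2) / (c c') with |c c'| >= 0.455. Replacing r by 2 r
     absorbs this distortion and is the source of the factor 8 in the constant. *)
  assert (Hx : Rabs (tan (t / 2) - tan (u / 2)) <= (2 * r) ^ 4 / 8).
  { replace (tan (t / 2) - tan (u / 2)) with (sin ((t - u) / 2) / (c * c')).
    - unfold Rdiv. rewrite Rabs_mult, Rabs_inv, Rabs_mult.
      apply Rle_div_l; [apply Rmult_lt_0_compat; lra |].
      eapply Rle_trans; [apply sin_abs_le |].
      unfold Rdiv. rewrite Rabs_mult, (Rabs_right (/ 2)) by lra.
      assert (455/1000 <= Rabs c * Rabs c') by nra.
      assert (0 <= r ^ 4) by (apply pow_le; lra).
      replace ((2 * r) ^ 4) with (16 * r ^ 4) by ring. nra.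
    - unfold tan. fold c c'. replace ((t - u) / 2) with (t / 2 - u / 2) by field.
      rewrite sin_minus. fold c c'. field. split; assumption. }
  assert (Hr16 : (2 * r) ^ 4 <= 16/100) by (replace ((2 * r) ^ 4) with (16 * r ^ 4) by ring; lra).
  assert (R4 : 0 <= r ^ 4) by (apply pow_le; lra).
  set (x := tan (t / 2)) in *. set (y := tan (u / 2)) in *.
  assert (Hx1 : -1 <= x <= 1) by (apply Rabs_le_between; assumption).
  assert (Hy1 : -3/2 <= y <= 3/2).
  { unfold Rabs in Hx. destruct Rcase_abs; lra. }
  assert (HF : Rabs (f x - f y) <= (128 * B + 4 * M) * (8 * r ^ 3)).
  { replace (8 * r ^ 3) with ((2 * r) ^ 3) by ring.
    apply (zygmund_holder f M B); try assumption; lra. }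
  assert (Hfx : Rabs (f x) <= B) by (apply HB; lra).
  assert (Hfy : Rabs (f y) <= B) by (apply HB; lra).
  assert (Hc21 : 0 <= c ^ 2 <= 1) by (generalize (pow2_abs c) (Rabs_pos c); nra).
  split; [assumption |]. split.
  - rewrite Rabs_mult, (Rabs_right (2 * c ^ 2)) by lra.
    generalize (Rabs_pos (f x)). nra.
  - replace (2 * c ^ 2 * f x - 2 * c' ^ 2 * f y)
      with (2 * c ^ 2 * (f x - f y) + 2 * ((c - c') * (c + c')) * f y) by ring.
    eapply Rle_trans; [apply Rabs_triang |].
    rewrite !Rabs_mult, (Rabs_right 2) by lra.
    rewrite (Rabs_right (c ^ 2)) by lra.
    assert (Rabs (c + c') <= 2) by (generalize (Rabs_triang c c'); lra).
    assert (R3 : 0 <= r ^ 3) by (apply pow_le; lra).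
    assert (Hr1 : r <= 1) by (apply pow4_le_inv; lra).
    assert (r ^ 4 <= r ^ 3) by (replace (r ^ 4) with (r * r ^ 3) by ring; nra).
    assert (A : Rabs (c - c') * Rabs (c + c') <= r ^ 3).
    { generalize (Rabs_pos (c - c')) (Rabs_pos (c + c')). nra. }
    generalize (Rabs_pos (f x - f y)) (Rabs_pos (f y)) (Rabs_pos (c - c')) (Rabs_pos (c + c')).
    intros.
    assert (A2 : Rabs (c - c') * Rabs (c + c') * Rabs (f y) <= r ^ 3 * B).
    { apply Rmult_le_compat; try assumption. apply Rmult_le_pos; assumption. }
    assert (c ^ 2 * Rabs (f x - f y) <= 1 * Rabs (f x - f y)) by (apply Rmult_le_compat_r; lra).
    lra.
Qed.

(** [C_derive] is a limit of difference quotients along the horizontal line through the point. At a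
    real point this is the real axis, where both components of the quotient are explicit rational
    functions continuous at x. The real factor 2 / (1 + x^2) is the derivative of the angle 2 atan
    x. *)
Lemma C_derive_cayley (x : R) :
  C_derive cayley (RtoC x) = (Ci * cayley (RtoC x) * RtoC (2 / (1 + x ^ 2)))%C.
Proof.
  assert (N : forall y : R, 1 + y ^ 2 <> 0) by (intro; nra).
  unfold C_derive, C_lim. simpl (fst (RtoC x)). simpl (snd (RtoC x)).
  assert (Q : forall y : R, y <> x ->
    ((cayley (y, 0) - cayley (RtoC x)) / ((y, 0) - RtoC x))%C =
    (- 2 * (x + y) / ((1 + x ^ 2) * (1 + y ^ 2)), 2 * (1 - x * y) / ((1 + x ^ 2) * (1 + y ^ 2)))).
  { intros y Hy. change (y, 0) with (RtoC y). rewrite !cayley_real.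
    assert (y - x <> 0) by lra.
    apply C_eq; simpl; field; repeat split; auto; nra. }
  assert (L : forall g : R -> R, continuous g x -> forall h : R -> R,
     (forall y, y <> x -> g y = h y) -> real (Lim h x) = g x).
  { intros g Hg h E. rewrite (is_lim_unique h x (g x)); [reflexivity |].
    apply (is_lim_ext_loc g).
    - exists (mkposreal 1 Rlt_0_1). intros y _ Hy. apply E, Hy.
    - apply is_lim_continuity. apply continuity_pt_filterlim. exact Hg. }
  f_equal.
  rewrite cayley_real.
  apply C_eq; cbv beta iota delta [fst snd]; fold (@fst R R) (@snd R R).
  - rewrite (L (fun y => - 2 * (x + y) / ((1 + x ^ 2) * (1 + y ^ 2)))).
    + simpl. field. nra.
    + apply (ex_derive_continuous (K := R_AbsRing) (V := R_NormedModule)). auto_derive. nra.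
    + intros y Hy. rewrite <- cayley_real, (Q y Hy). reflexivity.
  - rewrite (L (fun y => 2 * (1 - x * y) / ((1 + x ^ 2) * (1 + y ^ 2)))).
    + simpl. field. nra.
    + apply (ex_derive_continuous (K := R_AbsRing) (V := R_NormedModule)). auto_derive. nra.
    + intros y Hy. rewrite <- cayley_real, (Q y Hy). reflexivity.
Qed.

Lemma expi_half (t : R) : cos (t / 2) <> 0 -> expi t = cayley (RtoC (tan (t / 2))).
Proof.
  intro H. rewrite cayley_real. generalize (sin2_cos2 (t / 2)). unfold Rsqr. intro E.
  assert (D : 1 + tan (t / 2) ^ 2 = / (cos (t / 2) ^ 2)).
  { unfold tan. apply (Rmult_eq_reg_r (cos (t / 2) ^ 2)); [| apply pow_nonzero, H].
    rewrite Rinv_l by (apply pow_nonzero, H). transitivity (sin (t / 2) * sin (t / 2) + cos (t / 2) * cos (t / 2)); [field; exact H | exact E]. }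
  rewrite D. unfold expi, tan.
  replace t with (2 * (t / 2)) at 1 2 by field.
  rewrite cos_2a, sin_2a. f_equal; field; exact H.
Qed.

Lemma V_chart (V : C -> C) (W : R -> R) :
  (forall x : R, V (cayley (RtoC x)) = (C_derive cayley (RtoC x) * RtoC (W x))%C) ->
  forall t, cos (t / 2) <> 0 -> V (expi t) = (Ci * expi t * RtoC (chart_fun W t))%C.
Proof.
  intros HV t Ht. rewrite (expi_half t Ht), HV, C_derive_cayley.
  replace (chart_fun W t) with (2 / (1 + tan (t / 2) ^ 2) * W (tan (t / 2))).
  - rewrite RtoC_mult. ring.
  - unfold chart_fun. f_equal. generalize (sin2_cos2 (t / 2)). unfold Rsqr. intro E.
    unfold tan. apply Rmult_eq_reg_r with (1 + (sin (t / 2) / cos (t / 2)) ^ 2); [| nra].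
    transitivity 2; [field; split; [exact Ht | nra] |].
    transitivity (2 * (sin (t / 2) * sin (t / 2) + cos (t / 2) * cos (t / 2))); [rewrite E; ring | field; exact Ht].
Qed.

(** The inversion x -> 1/x is the reflection t -> PI - t of the circle. The second Zygmund bound
    therefore controls the neighbourhood of -1 in the way the first one controls that of 1. *)
Lemma chart_fun_inverted (W : R -> R) (t : R) :
  cos (t / 2) <> 0 -> sin (t / 2) <> 0 -> chart_fun (inverted W) (PI - t) = chart_fun W t.
Proof.
  intros Hc Hs. unfold chart_fun, inverted.
  replace ((PI - t) / 2) with (PI / 2 - t / 2) by field.
  assert (E : tan (PI / 2 - t / 2) = / tan (t / 2)).
  { unfold tan. rewrite sin_shift, cos_shift. field. split; assumption. }
  rewrite E, cos_shift.
  destruct (Req_EM_T (/ tan (t / 2)) 0) as [F | _].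
  - exfalso. revert F. apply Rinv_neq_0_compat. unfold tan.
    apply Rmult_integral_contrapositive_currified; [assumption | apply Rinv_neq_0_compat; assumption].
  - replace (1 / / tan (t / 2)) with (tan (t / 2)).
    + unfold tan at 1. field. split; assumption.
    + unfold Rdiv. rewrite Rinv_inv. ring.
Qed.

Lemma continuous_expi (t : R) : continuous expi t.
Proof.
  apply (continuous_comp_2 cos sin (fun x y => (x, y) : C)).
  - apply continuity_pt_filterlim, continuity_cos.
  - apply continuity_pt_filterlim, continuity_sin.
  - apply (continuous_ext (fun z => z)); [intros [a b]; reflexivity | apply continuous_id].
Qed.

Lemma continuous_on_circle (V : C -> C) (t : R) :
  continuous_on S1 V -> continuous (fun t => V (expi t)) t.
Proof.
  intro HV. unfold continuous.
  apply (filterlim_comp _ _ _ expi V (locally t) (within S1 (locally (expi t)))).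
  - intros P HP. generalize (continuous_expi t _ HP). unfold filtermap.
    apply filter_imp. intros x Hx. apply Hx, S1_expi.
  - apply HV, S1_expi.
Qed.

Lemma V_bounded (V : C -> C) :
  continuous_on S1 V -> exists M, 0 <= M /\ forall t, Cmod (V (expi t)) <= M.
Proof.
  intro HV.
  destruct (bounded_continuity (V := C_R_NormedModule) (fun t => V (expi t)) 0 (2 * PI)) as [M HM].
  { intros x _. apply continuous_on_circle, HV. }
  assert (G : forall t, Cmod (V (expi t)) <= M).
  { intro t. destruct (S1_polar (expi t) (S1_expi t)) as [s [Hs ->]].
    rewrite Cmod_norm. left. apply HM, Hs. }
  exists M. split; [| exact G]. generalize (G 0) (Cmod_ge_0 (V (expi 0))). lra.
Qed.

Lemma W_bounded (V : C -> C) (W : R -> R) (M : R) :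
  (forall x : R, V (cayley (RtoC x)) = (C_derive cayley (RtoC x) * RtoC (W x))%C) ->
  (forall t, Cmod (V (expi t)) <= M) ->
  forall x, Rabs (W x) = Cmod (V (cayley (RtoC x))) * ((1 + x ^ 2) / 2) /\ Rabs (W x) <= M * (1 + x ^ 2).
Proof.
  intros HV HM x.
  assert (E : Rabs (W x) = Cmod (V (cayley (RtoC x))) * ((1 + x ^ 2) / 2)).
  { rewrite HV, C_derive_cayley, !Cmod_mult, !Cmod_R.
    replace (Cmod Ci) with 1 by (rewrite <- expi_PI2, Cmod_expi; reflexivity).
    rewrite <- expi_2atan, Cmod_expi.
    rewrite (Rabs_right (2 / (1 + x ^ 2))) by (apply Rle_ge, Rdiv_le_0_compat; nra).
    field. nra. }
  split; [exact E |]. rewrite E. generalize (HM (2 * atan x)). rewrite expi_2atan.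
  intro H. generalize (Cmod_ge_0 (V (cayley (RtoC x)))) (pow2_ge_0 x). nra.
Qed.

(** [inverted W 0] is by definition the limit L of W(y) / y^2 at infinity. For x >= 1 the quotient
    |W x| / x^2 is at most |V| at the Cayley image of x, which tends to -1 where V vanishes. If L
    were nonzero, some x would have |V| below |L| / 2 and the quotient within |L| / 2 of L. *)
Lemma inverted_0 (V : C -> C) (W : R -> R) :
  continuous_on S1 V -> V (RtoC (-1)) = RtoC 0 -> vector_field_line W ->
  (forall x : R, V (cayley (RtoC x)) = (C_derive cayley (RtoC x) * RtoC (W x))%C) ->
  inverted W 0 = 0.
Proof.
  intros HC H1 [_ [L [HL _]]] HV. unfold inverted. destruct (Req_EM_T 0 0) as [_ | N]; [| lra].
  rewrite (is_lim_unique _ _ _ HL). simpl.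
  destruct (V_bounded V HC) as [M [_ HM]].
  assert (Hc : continuous (fun t => V (expi t)) PI) by apply continuous_on_circle, HC.
  destruct (Req_dec L 0) as [| HL0]; [assumption | exfalso].
  assert (He : 0 < Rabs L / 2) by (generalize (Rabs_pos_lt L HL0); lra).
  assert (Hn : continuous (fun t => Cmod (V (expi t))) PI).
  { apply (continuous_ext (fun t => norm (V := C_R_NormedModule) (V (expi t)))).
    - intro t. symmetry. apply Cmod_norm.
    - apply (continuous_comp (fun t => V (expi t)) (norm (V := C_R_NormedModule))).
      + exact Hc.
      + apply (filterlim_norm (V := C_R_NormedModule)). }
  apply continuity_pt_filterlim in Hn.
  destruct (proj1 (continuity_pt_locally (fun t : R => Cmod (V (expi t))) PI) Hn (mkposreal _ He)) as [d Hd].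
  rewrite expi_PI, H1, Cmod_0 in Hd.
  apply is_lim_spec in HL. destruct (HL (mkposreal _ He)) as [A HA]. simpl in HA, Hd.
  (* The bound x >= 4 / d brings the angle 2 atan x within d of PI, since PI - 2 atan x = 2 atan
     (1/x) <= 2/x. *)
  set (x := Rmax (Rmax 1 (A + 1)) (4 / d)).
  assert (Hx1 : 1 <= x) by (eapply Rle_trans; [apply Rmax_l | apply Rmax_l]).
  assert (HxA : A < x).
  { apply Rlt_le_trans with (A + 1); [lra |]. eapply Rle_trans; [apply Rmax_r | apply Rmax_l]. }
  assert (Hxd : 4 / d <= x) by apply Rmax_r.
  specialize (HA x HxA).
  assert (Ht : Rabs (2 * atan x - PI) < d).
  { generalize (atan_inv x ltac:(lra)). intro E.
    replace (2 * atan x - PI) with (- (2 * (atan (/ x) - atan 0))) by (rewrite E, atan_0; field).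
    rewrite Rabs_Ropp, Rabs_mult, (Rabs_right 2) by lra.
    generalize (atan_lipschitz (/ x) 0). rewrite Rminus_0_r.
    assert (0 < / x) by (apply Rinv_0_lt_compat; lra).
    rewrite (Rabs_right (/ x)) by lra.
    assert (/ x <= d / 4).
    { replace (d / 4) with (/ (4 / d)) by (field; generalize (cond_pos d); lra).
      apply Rinv_le_contravar; [| exact Hxd]. apply Rdiv_lt_0_compat; [lra | apply cond_pos]. }
    generalize (cond_pos d). lra. }
  specialize (Hd _ Ht). rewrite expi_2atan, Rminus_0_r, Rabs_right in Hd by apply Rle_ge, Cmod_ge_0.
  destruct (W_bounded V W M HV HM x) as [E _].
  assert (Hb : Rabs (W x / (x * (x * 1))) <= Cmod (V (cayley (RtoC x)))).
  { assert (X : 0 < x * (x * 1)) by nra.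
    unfold Rdiv. rewrite Rabs_mult, Rabs_inv, (Rabs_right (x * (x * 1))) by lra.
    apply (Rmult_le_reg_r (x * (x * 1))); [exact X |].
    rewrite Rmult_assoc, Rinv_l, Rmult_1_r, E by lra.
    apply Rmult_le_compat_l; [apply Cmod_ge_0 | simpl; nra]. }
  unfold Rabs in *. repeat destruct Rcase_abs; lra.
Qed.

(** The points with cos t >= 0 are handled in the chart of W, the others in the chart of
    [inverted W]; in both cases only the first point has to lie in the half circle. When r^4 >
    1/100, boundedness suffices because 80 (3/10)^3 > 2. *)
Lemma expi_holder (V : C -> C) :
  zygmund_circle V -> V (RtoC (-1)) = RtoC 0 ->
  exists H, 0 <= H /\ forall t u r, 0 <= r -> Rabs (t - u) <= r ^ 4 ->
    Cmod (V (expi t) - V (expi u)) <= H * r ^ 3.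
Proof.
  intros [HC [_ [W [[HW [M [Z1 Z2]]] HV]]]] H1.
  destruct (V_bounded V HC) as [B [HB0 HB]].
  assert (I0 : inverted W 0 = 0) by (eapply inverted_0; eassumption).
  (* The factor 5 bounds 1 + x^2 on [-2, 2]. *)
  assert (B1 : forall x, -2 <= x <= 2 -> Rabs (W x) <= 5 * B).
  { intros x Hx. destruct (W_bounded V W B HV HB x) as [_ Hb].
    assert (x ^ 2 <= 4) by nra. nra. }
  assert (B2 : forall x, -2 <= x <= 2 -> Rabs (inverted W x) <= 5 * B).
  { intros x Hx. destruct (Req_dec x 0) as [-> | Hx0].
    - rewrite I0, Rabs_R0. lra.
    - unfold inverted. destruct (Req_EM_T x 0); [contradiction |].
      destruct (W_bounded V W B HV HB (1 / x)) as [_ Hb].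
      rewrite Rabs_mult, Rabs_right by (apply Rle_ge, pow2_ge_0).
      apply Rle_trans with (x ^ 2 * (B * (1 + (1 / x) ^ 2))).
      + apply Rmult_le_compat_l; [apply pow2_ge_0 | exact Hb].
      + replace (x ^ 2 * (B * (1 + (1 / x) ^ 2))) with (B * (x ^ 2 + 1)) by (field; assumption).
        assert (x ^ 2 <= 4) by nra. nra. }
  destruct (chart_fun_holder W M (5 * B) Z1 B1) as [K1 [HK1 G1]].
  destruct (chart_fun_holder (inverted W) M (5 * B) Z2 B2) as [K2 [HK2 G2]].
  assert (V1 : forall t, cos (t / 2) <> 0 -> V (expi t) = (Ci * expi t * RtoC (chart_fun W t))%C)
    by (apply V_chart, HV).
  (* This formula includes the point -1, where cos (t / 2) = 0 and both sides vanish because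
     [inverted W 0] is 0. *)
  assert (V2 : forall t, sin (t / 2) <> 0 ->
    V (expi t) = (Ci * expi t * RtoC (chart_fun (inverted W) (PI - t)))%C).
  { intros t Hs. destruct (Req_dec (cos (t / 2)) 0) as [Hc | Hc].
    - replace (expi t) with (RtoC (-1)) at 1.
      + rewrite H1. unfold chart_fun. replace ((PI - t) / 2) with (PI / 2 - t / 2) by field.
        unfold tan. rewrite sin_shift, Hc. replace (0 / cos (PI / 2 - t / 2)) with 0 by (unfold Rdiv; ring). rewrite I0, Rmult_0_r. ring.
      + apply C_eq; simpl; replace t with (2 * (t / 2)) by field.
        * rewrite cos_2a_cos, Hc. ring.
        * rewrite sin_2a, Hc. ring.
    - rewrite chart_fun_inverted by assumption. apply V1, Hc. }
  assert (Comb : forall K t u r (g g' : R), 0 <= r -> r ^ 4 <= 1/100 -> Rabs (t - u) <= r ^ 4 ->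
    0 <= K -> Rabs g <= K -> Rabs (g - g') <= K * r ^ 3 ->
    Cmod (Ci * expi t * RtoC g - Ci * expi u * RtoC g') <= 2 * K * r ^ 3).
  { intros K t u r g g' Hr Hr4 Htu HK Hg Hgg.
    replace (Ci * expi t * g - Ci * expi u * g')%C
      with (Ci * ((expi t - expi u) * g + expi u * RtoC (g - g')))%C by (rewrite RtoC_minus; ring).
    rewrite Cmod_mult. replace (Cmod Ci) with 1 by (rewrite <- expi_PI2, Cmod_expi; reflexivity).
    rewrite Rmult_1_l. eapply Rle_trans; [apply Cmod_triangle |].
    rewrite !Cmod_mult, Cmod_expi, !Cmod_R, Rmult_1_l.
    generalize (Cmod_expi_minus t u). intro.
    assert (Hr1 : r <= 1) by (apply pow4_le_inv; lra).
    assert (R3 : 0 <= r ^ 3) by (apply pow_le; lra).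
    assert (r ^ 4 <= r ^ 3) by (replace (r ^ 4) with (r * r ^ 3) by ring; nra).
    assert (Cmod (expi t - expi u) * Rabs g <= r ^ 3 * K).
    { apply Rmult_le_compat; [apply Cmod_ge_0 | apply Rabs_pos | lra | assumption]. }
    lra. }
  exists (2 * K1 + 2 * K2 + 80 * B). split; [lra |].
  intros t u r Hr Htu.
  assert (R3 : 0 <= r ^ 3) by (apply pow_le; lra).
  destruct (Rle_dec (r ^ 4) (1/100)) as [Hr4 | Hr4].
  - destruct (Rle_dec 0 (cos t)) as [Hc | Hc].
    + destruct (G1 t u r Hr Hr4 Hc Htu) as (Hu & Ha & Hb).
      assert (Ht : cos (t / 2) <> 0) by (generalize (half_angle t); nra).
      rewrite (V1 t Ht), (V1 u Hu).
      generalize (Comb K1 t u r _ _ Hr Hr4 Htu HK1 Ha Hb). nra.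
    + assert (Hc' : 0 <= cos (PI - t)) by (rewrite Rtrigo_facts.cos_pi_minus; lra).
      assert (Htu' : Rabs ((PI - t) - (PI - u)) <= r ^ 4).
      { replace ((PI - t) - (PI - u)) with (- (t - u)) by ring. rewrite Rabs_Ropp. exact Htu. }
      destruct (G2 (PI - t) (PI - u) r Hr Hr4 Hc' Htu') as (Hu & Ha & Hb).
      assert (Hu' : sin (u / 2) <> 0).
      { replace ((PI - u) / 2) with (PI / 2 - u / 2) in Hu by field. rewrite cos_shift in Hu. exact Hu. }
      assert (Ht : sin (t / 2) <> 0).
      { generalize (half_angle (PI - t)).
        replace ((PI - t) / 2) with (PI / 2 - t / 2) by field. rewrite cos_shift. nra. }
      rewrite (V2 t Ht), (V2 u Hu').
      generalize (Comb K2 t u r _ _ Hr Hr4 Htu HK2 Ha Hb). nra.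
  - assert (Hr3 : 3/10 <= r).
    { destruct (Rle_dec (3/10) r) as [| Hn]; [assumption | exfalso].
      assert (r ^ 2 <= 9/100) by nra. nra. }
    assert ((3/10) ^ 3 <= r ^ 3) by (apply pow_incr; lra).
    assert (Cmod (V (expi t) - V (expi u)) <= 2 * B).
    { unfold Cminus. eapply Rle_trans; [apply Cmod_triangle |]. rewrite Cmod_opp.
      generalize (HB t) (HB u). lra. }
    nra.
Qed.

(** * Quadratic interpolation on Farey triangles *)

(** Hoelder continuity of exponent 3/4 without real powers: r stands for any upper bound of the
    fourth root of the distance. *)
Definition holder34 (V : C -> C) (K : R) : Prop :=
  0 <= K /\ forall t u r, 0 <= r -> Rabs (t - u) <= r ^ 4 ->
    Cmod (V (expi t) - V (expi u)) <= K * r ^ 3.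

Definition slope (V : C -> C) (z w : C) : C := ((V w - V z) / (w - z))%C.

Definition div2 (V : C -> C) (a b d : C) : C := ((slope V a b - slope V b d) / (a - d))%C.

(* Newton form of the quadratic polynomial agreeing with V at a, b, d. *)
Definition interp (V : C -> C) (a b d z : C) : C :=
  (V b + slope V b d * (z - b) + div2 V a b d * ((z - b) * (z - d)))%C.

Definition edge_poly (b d z : C) : C := ((z - b) * (z - d) / (b - d))%C.

Lemma Cminus_neq_0 (a b : C) : a <> b -> (a - b)%C <> RtoC 0.
Proof. intros H E. apply H. replace a with (a - b + b)%C by ring. rewrite E. ring. Qed.

Lemma slope_sym (V : C -> C) (a b : C) : a <> b -> slope V a b = slope V b a.
Proof.
  intro H. unfold slope. field. split; apply Cminus_neq_0; congruence.
Qed.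

(** Symmetry of the second divided difference. It gives the choice of dividing by the chord from the
    opposite vertex to either end of the edge; the estimate needs the one that is the parent
    edge. *)
Lemma div2_alt (V : C -> C) (a b d : C) :
  a <> b -> a <> d -> b <> d -> div2 V a b d = ((slope V a d - slope V b d) / (a - b))%C.
Proof.
  intros H1 H2 H3. unfold div2, slope. field.
  repeat split; apply Cminus_neq_0; congruence.
Qed.

(** Both interpolants agree with V at b and d, so they differ by a multiple of (z - b)(z - d), and
    the value at c identifies the multiple as the shear. The order d, b, c is that of a left child,
    whose opposite vertex is the right end of its parent. *)
Lemma interp_shear_true (V : C -> C) (a b c d z : C) :
  a <> b -> a <> c -> a <> d -> b <> c -> b <> d -> c <> d ->
  interp V d b c z = (interp V a b d z + shear_expr V a b c d * edge_poly b d z)%C.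
Proof.
  intros. unfold interp, div2, slope, shear_expr, edge_poly.
  generalize (V a) (V b) (V c) (V d). intros.
  field. repeat split; apply Cminus_neq_0; congruence.
Qed.

Lemma interp_shear_false (V : C -> C) (a b c d z : C) :
  a <> b -> a <> c -> a <> d -> b <> c -> b <> d -> c <> d ->
  interp V b c d z = (interp V a b d z + shear_expr V a b c d * edge_poly b d z)%C.
Proof.
  intros. unfold interp, div2, slope, shear_expr, edge_poly.
  generalize (V a) (V b) (V c) (V d). intros.
  field. repeat split; apply Cminus_neq_0; congruence.
Qed.

Definition pl r w : C := expi (ang_l r w).
Definition pr r w : C := expi (ang_r r w).
Definition pm r w : C := expi (ang_m r w).
Definition pin r w : C := expi (inner r w).

Lemma expi_neq (a b : R) : a < b < a + 2 * PI -> expi a <> expi b.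
Proof. intros H E. apply expi_eq_close in E; lra. Qed.

Lemma node_distinct r w :
  pin r w <> pl r w /\ pin r w <> pm r w /\ pin r w <> pr r w /\
  pl r w <> pm r w /\ pl r w <> pr r w /\ pm r w <> pr r w.
Proof.
  generalize (inner_ccw r w) (ang_lt r w). intros.
  repeat split; apply expi_neq; lra.
Qed.

Definition quad (V : C -> C) r w (z : C) : C := interp V (pin r w) (pl r w) (pr r w) z.

Lemma quad_child (V : C -> C) (sdot : edge -> R) r w b z :
  is_inf_shear V sdot ->
  quad V r (b :: w) z =
  (quad V r w z + RtoC (sdot (mk_edge r w)) * edge_poly (pl r w) (pr r w) z)%C.
Proof.
  intro H. rewrite (shear_at_node V sdot r w H).
  destruct (node_distinct r w) as (D1 & D2 & D3 & D4 & D5 & D6).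
  destruct b; unfold quad, pin, pl, pr; simpl inner;
    rewrite ?ang_l_true, ?ang_r_true, ?ang_l_false, ?ang_r_false.
  - rewrite expi_minus_2PI. apply interp_shear_true; assumption.
  - apply interp_shear_false; assumption.
Qed.

(** For parameters at distance 1/m the chord is at least 1/m, and with rho = m^(1/4) the Hoelder
    bound at distance 4/m <= (2/rho)^4 is 8 K / rho^3. The quotient is at most 8 K rho, and m <= N^2
    turns rho into sqrt N. *)
Lemma slope_bound (V : C -> C) K r (s s' m N : R) :
  holder34 V K -> 0 <= s <= 1 -> 0 <= s' <= 1 -> 0 < m -> m <= N ^ 2 -> 0 <= N ->
  Rabs (s - s') = / m ->
  Cmod (slope V (expi (sec_angle r s)) (expi (sec_angle r s'))) <= 8 * K * sqrt N.
Proof.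
  intros [HK HV] Hs Hs' Hm HmN HN E.
  destruct (root4_exists m) as [rho [Hr Er]]; [lra |].
  assert (Hr0 : 0 < rho).
  { destruct Hr as [| <-]; [assumption |]. simpl in Er. lra. }
  assert (HrN : rho <= sqrt N).
  { apply pow4_le_inv; [apply sqrt_pos |].
    replace (sqrt N ^ 4) with ((sqrt N * sqrt N) ^ 2) by ring.
    rewrite sqrt_sqrt by exact HN. lra. }
  apply Rle_trans with (8 * K * rho).
  2: { apply Rmult_le_compat_l; [lra | exact HrN]. }
  assert (HD : Cmod (V (expi (sec_angle r s')) - V (expi (sec_angle r s))) <= K * (2 / rho) ^ 3).
  { apply HV; [apply Rlt_le, Rdiv_lt_0_compat; lra |].
    eapply Rle_trans; [apply sec_angle_lipschitz |].
    rewrite Rabs_minus_sym, E, <- Er.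
    replace ((2 / rho) ^ 4) with (16 * / rho ^ 4) by (field; lra).
    assert (0 < / rho ^ 4) by (apply Rinv_0_lt_compat, pow_lt, Hr0). lra. }
  assert (HC : / m <= Cmod (expi (sec_angle r s') - expi (sec_angle r s))).
  { rewrite <- E, Rabs_minus_sym. apply sec_chord_ge; assumption. }
  assert (Hm' : 0 < / m) by (apply Rinv_0_lt_compat, Hm).
  unfold slope. rewrite Cmod_div.
  2: { intro F. rewrite F, Cmod_0 in HC. lra. }
  apply Rle_div_l; [lra |].
  apply Rle_trans with (8 * K * rho * / m).
  - eapply Rle_trans; [exact HD |]. right. rewrite <- Er. field. lra.
  - apply Rmult_le_compat_l; [nra | exact HC].
Qed.

(** N is left free so that the slopes at a node can be bounded by the larger denominator sum of one
    of its children. *)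
Lemma node_slopes (V : C -> C) K r w N :
  holder34 V K -> ql w + qr w <= N ->
  Cmod (slope V (pl r w) (pm r w)) <= 8 * K * sqrt N /\
  Cmod (slope V (pm r w) (pr r w)) <= 8 * K * sqrt N /\
  Cmod (slope V (pl r w) (pr r w)) <= 8 * K * sqrt N.
Proof.
  intros HV HN. destruct (q_ge_1 w). destruct (s_range w) as (R1 & R2 & R3).
  destruct (s_spec w) as (_ & _ & E1 & E2 & E3). generalize (s_lt w); intro L.
  split; [| split].
  - apply slope_bound with (m := ql w * (ql w + qr w)); try assumption; try nra.
    rewrite Rabs_minus_sym, Rabs_right; lra.
  - apply slope_bound with (m := (ql w + qr w) * qr w); try assumption; try nra.
    rewrite Rabs_minus_sym, Rabs_right; lra.
  - apply slope_bound with (m := ql w * qr w); try assumption; try nra.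
    rewrite Rabs_minus_sym, Rabs_right; lra.
Qed.

Definition vanish3 (V : C -> C) : Prop :=
  V (RtoC 1) = RtoC 0 /\ V Ci = RtoC 0 /\ V (RtoC (-1)) = RtoC 0.

Lemma base_values (V : C -> C) r :
  vanish3 V -> V (pin r []) = RtoC 0 /\ V (pl r []) = RtoC 0 /\ V (pr r []) = RtoC 0.
Proof.
  intros (H1 & H2 & H3). unfold pin, pl, pr, inner, ang_l, ang_r, sl, sr, lv, rv, val; simpl.
  replace (0 / 1) with 0 by field. replace (1 / 1) with 1 by field.
  destruct (sec_angle_ends r) as [-> ->].
  assert (E2 : expi (2 * PI) = RtoC 1).
  { rewrite <- expi_0, <- (expi_2PI_shift 0). f_equal. ring. }
  assert (Em : expi (- PI) = RtoC (-1)).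
  { rewrite <- expi_PI, <- (expi_2PI_shift (- PI)). f_equal. ring. }
  destruct r; rewrite ?expi_0, ?expi_PI, ?expi_PI2, ?E2, ?Em; repeat split; assumption.
Qed.

Lemma base_slopes (V : C -> C) r :
  vanish3 V ->
  slope V (pin r []) (pl r []) = RtoC 0 /\ slope V (pl r []) (pr r []) = RtoC 0 /\
  slope V (pin r []) (pr r []) = RtoC 0.
Proof.
  intro H. destruct (base_values V r H) as (E1 & E2 & E3).
  destruct (node_distinct r []) as (D1 & _ & D3 & _ & D5 & _).
  unfold slope. rewrite E1, E2, E3.
  repeat split; field; apply Cminus_neq_0; congruence.
Qed.

Lemma quad_base (V : C -> C) r z : vanish3 V -> quad V r [] z = RtoC 0.
Proof.
  intro H. destruct (base_values V r H) as (E1 & E2 & E3).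
  destruct (base_slopes V r H) as (S1 & S2 & S3).
  unfold quad, interp, div2. rewrite E2, S1, S2. unfold Cdiv. ring.
Qed.

(** The triangle on the inner side of a node is the outer triangle of its parent, whose sides are
    already estimated. At the root the slopes vanish, because V is 0 at all three base vertices. *)
Lemma inner_slopes (V : C -> C) K r w :
  holder34 V K -> vanish3 V ->
  Cmod (slope V (pin r w) (pl r w)) <= 8 * K * sqrt (ql w + qr w) /\
  Cmod (slope V (pin r w) (pr r w)) <= 8 * K * sqrt (ql w + qr w).
Proof.
  intros HV H0. destruct w as [| [|] w].
  - destruct (base_slopes V r H0) as (-> & _ & ->). rewrite Cmod_0. destruct HV as [HK _].
    generalize (sqrt_pos (ql [] + qr [])). nra.
  - destruct (q_ge_1 w). destruct (node_distinct r w) as (_ & _ & _ & _ & D & D').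
    destruct (node_slopes V K r w (ql (true :: w) + qr (true :: w)) HV) as (A1 & A2 & A3).
    { rewrite ql_true, qr_true. lra. }
    unfold pin, pl, pr in *. simpl inner. rewrite ang_l_true, ang_r_true, expi_minus_2PI.
    rewrite slope_sym in A2, A3 by (apply D || apply D').
    split; assumption.
  - destruct (q_ge_1 w). destruct (node_distinct r w) as (_ & _ & _ & D & D' & _).
    destruct (node_slopes V K r w (ql (false :: w) + qr (false :: w)) HV) as (A1 & A2 & A3).
    { rewrite ql_false, qr_false. lra. }
    unfold pin, pl, pr in *. simpl inner. rewrite ang_l_false, ang_r_false.
    split; assumption.
Qed.

(** The shear is a signed sum of four slopes along sides of the two adjacent triangles, each at most
    8 K sqrt (q + q'). *)
Lemma shear_bound (V : C -> C) (sdot : edge -> R) K r w :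
  holder34 V K -> vanish3 V -> is_inf_shear V sdot ->
  Rabs (sdot (mk_edge r w)) <= 32 * K * sqrt (ql w + qr w).
Proof.
  intros HV H0 Hs. rewrite <- Cmod_R, (shear_at_node V sdot r w Hs).
  destruct (inner_slopes V K r w HV H0) as [A1 A2].
  destruct (node_slopes V K r w _ HV (Rle_refl _)) as (B1 & B2 & _).
  change (Cmod (slope V (pl r w) (pm r w) + slope V (pin r w) (pr r w)
    - slope V (pin r w) (pl r w) - slope V (pm r w) (pr r w)) <= 32 * K * sqrt (ql w + qr w)).
  unfold Cminus.
  eapply Rle_trans; [apply Cmod_triangle |].
  eapply Rle_trans; [apply Rplus_le_compat_r, Cmod_triangle |].
  eapply Rle_trans; [apply Rplus_le_compat_r, Rplus_le_compat_r, Cmod_triangle |].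
  rewrite !Cmod_opp. lra.
Qed.

Lemma edge_chord_ge r w : / (ql w * qr w) <= Cmod (pl r w - pr r w).
Proof.
  destruct (s_range w) as (R1 & R2 & R3). destruct (s_spec w) as (_ & _ & E1 & _).
  unfold pl, pr, ang_l, ang_r. eapply Rle_trans; [| apply sec_chord_ge; assumption].
  rewrite <- E1, Rabs_minus_sym. apply Rle_abs.
Qed.

Lemma edge_arc_le r w : ang_r r w - ang_l r w <= 4 * / (ql w * qr w).
Proof.
  destruct (s_spec w) as (_ & _ & E1 & _). generalize (s_lt w); intro L.
  eapply Rle_trans; [apply Rle_abs |]. unfold ang_l, ang_r.
  eapply Rle_trans; [apply sec_angle_lipschitz |].
  rewrite Rabs_right by lra. rewrite E1. lra.
Qed.

(** The divided difference is written with the chord of the parent edge as divisor. The parent has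
    the smaller product of denominators, so this chord is at least 1 / (q q') for the denominators
    of the child, whereas the other new side may be shorter. *)
Lemma div2_bound (V : C -> C) K r w :
  holder34 V K -> vanish3 V ->
  Cmod (div2 V (pin r w) (pl r w) (pr r w)) <= 16 * K * sqrt (ql w + qr w) * (ql w * qr w).
Proof.
  intros HV H0.
  destruct (inner_slopes V K r w HV H0) as [A1 A2].
  destruct (node_slopes V K r w _ HV (Rle_refl _)) as (_ & _ & B).
  assert (HK : 0 <= K) by apply HV.
  destruct (node_distinct r w) as (D1 & _ & D3 & _ & D5 & _).
  assert (G : forall x y z : C, Cmod x <= 8 * K * sqrt (ql w + qr w) ->
    Cmod y <= 8 * K * sqrt (ql w + qr w) -> / (ql w * qr w) <= Cmod z ->
    Cmod ((x - y) / z) <= 16 * K * sqrt (ql w + qr w) * (ql w * qr w)).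
  { intros x y z Hx Hy Hz.
    assert (Hq : 0 < ql w * qr w) by (generalize (q_ge_1 w); nra).
    assert (Hq' : 0 < / (ql w * qr w)) by (apply Rinv_0_lt_compat, Hq).
    rewrite Cmod_div by (intro F; rewrite F, Cmod_0 in Hz; lra).
    apply Rle_div_l; [lra |].
    apply Rle_trans with (16 * K * sqrt (ql w + qr w)).
    - unfold Cminus. eapply Rle_trans; [apply Cmod_triangle |]. rewrite Cmod_opp. lra.
    - assert (HX : 0 <= 16 * K * sqrt (ql w + qr w)) by (generalize (sqrt_pos (ql w + qr w)); nra).
      rewrite (Rmult_assoc (16 * K * sqrt (ql w + qr w)) (ql w * qr w)).
      rewrite <- (Rmult_1_r (16 * K * sqrt (ql w + qr w))) at 1.
      apply Rmult_le_compat_l; [exact HX |].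
      apply Rle_trans with (ql w * qr w * / (ql w * qr w)); [right; rewrite Rinv_r; lra |].
      apply Rmult_le_compat_l; lra. }
  destruct w as [| [|] w].
  - destruct (base_slopes V r H0) as (S1 & S2 & _). unfold div2. rewrite S1, S2.
    replace ((0 - 0) / (pin r [] - pr r []))%C with (RtoC 0) by (unfold Cdiv; ring).
    rewrite Cmod_0. generalize (sqrt_pos (ql [] + qr [])) (q_ge_1 []). intros.
    apply Rmult_le_pos; nra.
  - rewrite div2_alt by assumption. apply G; try assumption.
    replace (pin r (true :: w)) with (pr r w)
      by (unfold pin, pr; simpl inner; rewrite expi_minus_2PI; reflexivity).
    replace (pl r (true :: w)) with (pl r w) by (unfold pl; rewrite ang_l_true; reflexivity).
    eapply Rle_trans; [| rewrite <- Cmod_opp; replace (- (pr r w - pl r w))%C with (pl r w - pr r w)%C by ring; apply edge_chord_ge].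
    rewrite ql_true, qr_true. generalize (q_ge_1 w). intros.
    apply Rinv_le_contravar; nra.
  - apply G; try assumption.
    replace (pin r (false :: w)) with (pl r w) by reflexivity.
    replace (pr r (false :: w)) with (pr r w) by (unfold pr; rewrite ang_r_false; reflexivity).
    eapply Rle_trans; [| apply edge_chord_ge].
    rewrite ql_false, qr_false. generalize (q_ge_1 w). intros.
    apply Rinv_le_contravar; nra.
Qed.

Lemma sqrt_sum_le (w : list bool) : sqrt (ql w + qr w) <= 2 * sqrt (ql w * qr w).
Proof.
  generalize (q_ge_1 w) (q_prod_ge w). intros.
  replace 2 with (sqrt (2 * 2)) by (apply sqrt_square; lra).
  rewrite <- sqrt_mult by nra. apply sqrt_le_1; nra.
Qed.

(** With P = q q', every point of the arc is within 4 / P of both ends. In the Newton form the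
    increment of V, the linear term and the quadratic term contribute 8, 64 and 512 times K / sqrt
    P, and 600 rounds up the total 584. *)
Lemma quad_approx (V : C -> C) K r w phi :
  holder34 V K -> vanish3 V -> ang_l r w <= phi <= ang_r r w ->
  Cmod (V (expi phi) - quad V r w (expi phi)) <= 600 * K / sqrt (INR (length w) + 1).
Proof.
  intros HV H0 Hphi. assert (HK : 0 <= K) by apply HV.
  set (P := ql w * qr w).
  assert (HP1 : 1 <= P) by (unfold P; generalize (q_ge_1 w); nra).
  assert (HPl : INR (length w) + 1 <= P) by (unfold P; generalize (q_prod_ge w) (q_level w); lra).
  assert (Hlen : 0 <= INR (length w)) by apply pos_INR.
  apply Rle_trans with (600 * K / sqrt P).
  2: { apply Rmult_le_compat_l; [lra |]. apply Rinv_le_contravar; [apply sqrt_lt_R0; lra |].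
       apply sqrt_le_1; lra. }
  generalize (edge_arc_le r w). fold P. intro Hl.
  assert (Zl : Cmod (expi phi - pl r w) <= 4 * / P).
  { eapply Rle_trans; [apply Cmod_expi_minus |]. rewrite Rabs_right; lra. }
  assert (Zr : Cmod (expi phi - pr r w) <= 4 * / P).
  { eapply Rle_trans; [apply Cmod_expi_minus |]. rewrite Rabs_minus_sym, Rabs_right; lra. }
  set (S := sqrt P).
  assert (HS : S * S = P) by (apply sqrt_sqrt; lra).
  assert (HS1 : 1 <= S) by (unfold S; rewrite <- sqrt_1; apply sqrt_le_1; lra).
  assert (T1 : Cmod (V (expi phi) - V (pl r w)) <= 8 * K / S).
  { set (rho := sqrt S).
    assert (Hrho : rho * rho = S) by (apply sqrt_sqrt; lra).
    assert (Hrho1 : 1 <= rho) by (unfold rho; rewrite <- sqrt_1; apply sqrt_le_1; lra).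
    apply Rle_trans with (K * (2 / rho) ^ 3).
    - apply HV; [apply Rlt_le, Rdiv_lt_0_compat; lra |].
      rewrite Rabs_right by lra. apply Rle_trans with (4 * / P).
      + lra.
      + replace ((2 / rho) ^ 4) with (16 * / ((rho * rho) * (rho * rho))) by (field; lra).
        rewrite Hrho, HS. assert (0 < / P) by (apply Rinv_0_lt_compat; lra). lra.
    - replace (K * (2 / rho) ^ 3) with (8 * K / S * / rho) by (rewrite <- Hrho; field; lra).
      rewrite <- (Rmult_1_r (8 * K / S)) at 2. apply Rmult_le_compat_l.
      + apply Rdiv_le_0_compat; lra.
      + rewrite <- Rinv_1. apply Rinv_le_contravar; lra. }
  destruct (node_slopes V K r w _ HV (Rle_refl _)) as (_ & _ & B).
  generalize (div2_bound V K r w HV H0). fold P. intro D.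
  generalize (sqrt_sum_le w). fold P S. intro HN.
  set (Q := sqrt (ql w + qr w)) in *.
  assert (HQ : 0 <= Q) by apply sqrt_pos.
  assert (HiP : 0 < / P) by (apply Rinv_0_lt_compat; lra).
  replace (V (expi phi) - quad V r w (expi phi))%C with
    ((V (expi phi) - V (pl r w)) + (- (slope V (pl r w) (pr r w) * (expi phi - pl r w)) +
      - (div2 V (pin r w) (pl r w) (pr r w) * ((expi phi - pl r w) * (expi phi - pr r w)))))%C
    by (unfold quad, interp; ring).
  eapply Rle_trans; [apply Cmod_triangle |].
  eapply Rle_trans; [apply Rplus_le_compat_l, Cmod_triangle |].
  rewrite !Cmod_opp, !Cmod_mult.
  assert (T2 : Cmod (slope V (pl r w) (pr r w)) * Cmod (expi phi - pl r w) <= 64 * K / S).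
  { apply Rle_trans with (8 * K * (2 * S) * (4 * / P)).
    - apply Rmult_le_compat; try apply Cmod_ge_0; [| exact Zl].
      eapply Rle_trans; [exact B |]. apply Rmult_le_compat_l; lra.
    - right. rewrite <- HS. field. lra. }
  assert (T3 : Cmod (div2 V (pin r w) (pl r w) (pr r w)) *
     (Cmod (expi phi - pl r w) * Cmod (expi phi - pr r w)) <= 512 * K / S).
  { apply Rle_trans with (16 * K * (2 * S) * P * ((4 * / P) * (4 * / P))).
    - apply Rmult_le_compat; [apply Cmod_ge_0 | apply Rmult_le_pos; apply Cmod_ge_0 | |].
      + eapply Rle_trans; [exact D |]. apply Rmult_le_compat_r; [lra |].
        apply Rmult_le_compat_l; lra.
      + apply Rmult_le_compat; try apply Cmod_ge_0; assumption.
    - right. rewrite <- HS. field. lra. }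
  assert (0 <= K / S) by (apply Rdiv_le_0_compat; lra).
  unfold Rdiv in *. lra.
Qed.

Lemma edge_poly_bound r w phi :
  ang_l r w <= phi <= ang_r r w ->
  Cmod (edge_poly (pl r w) (pr r w) (expi phi)) <= 16 * / (ql w * qr w).
Proof.
  intro Hphi. set (P := ql w * qr w).
  assert (HP1 : 1 <= P) by (unfold P; generalize (q_ge_1 w); nra).
  generalize (edge_arc_le r w) (edge_chord_ge r w). fold P. intros Hl Hc.
  assert (HiP : 0 < / P) by (apply Rinv_0_lt_compat; lra).
  unfold edge_poly. rewrite Cmod_div by (intro F; rewrite F, Cmod_0 in Hc; lra).
  apply Rle_div_l; [lra |].
  apply Rle_trans with (16 * / P * / P); [| apply Rmult_le_compat_l; lra].
  rewrite Cmod_mult.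
  replace (16 * / P * / P) with ((4 * / P) * (4 * / P)) by ring.
  apply Rmult_le_compat; try apply Cmod_ge_0; (eapply Rle_trans; [apply Cmod_expi_minus |]).
  - rewrite Rabs_right; lra.
  - rewrite Rabs_minus_sym, Rabs_right; lra.
Qed.

Lemma elementary_inside (t0 t1 phi : R) :
  t0 <= phi <= t1 -> t1 < t0 + 2 * PI ->
  elementary_field t0 t1 (expi phi) = edge_poly (expi t0) (expi t1) (expi phi).
Proof.
  intros H Hl. unfold elementary_field, edge_poly.
  destruct (excluded_middle_informative _) as [_ | N]; [reflexivity |].
  destruct (Req_dec phi t0) as [-> | N0]; [unfold Cdiv; ring |].
  destruct (Req_dec phi t1) as [-> | N1]; [unfold Cdiv; ring |].
  exfalso. apply N. exists phi. split; [reflexivity | lra].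
Qed.

Lemma elementary_outside (t0 t1 phi : R) :
  0 <= t0 -> t1 <= 2 * PI -> 0 <= phi <= 2 * PI -> ~ (t0 < phi < t1) ->
  elementary_field t0 t1 (expi phi) = RtoC 0.
Proof.
  intros H0 H1 Hphi N. unfold elementary_field.
  destruct (excluded_middle_informative _) as [[psi [E Hpsi]] | _]; [exfalso | reflexivity].
  (* The range [0, 2 PI] names the point 1 twice, so its right end is compared with the angle 0
     instead. *)
  destruct (Req_dec phi (2 * PI)) as [-> | Hn].
  - rewrite <- (Rplus_0_l (2 * PI)), expi_2PI_shift in E. apply expi_inj in E; lra.
  - apply expi_inj in E; lra.
Qed.

(** * Sums of elementary fields *)

Lemma Csum_cons {T : Type} (f : T -> C) x l : Csum_list f (x :: l) = (f x + Csum_list f l)%C.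
Proof. reflexivity. Qed.

Lemma Csum_app {T : Type} (f : T -> C) l l' : Csum_list f (l ++ l') = (Csum_list f l + Csum_list f l')%C.
Proof.
  induction l as [| x l IH]; simpl app.
  - change (Csum_list f []) with (RtoC 0). ring.
  - rewrite !Csum_cons, IH. ring.
Qed.

Lemma Csum_ext {T : Type} (f g : T -> C) l : (forall x, In x l -> f x = g x) -> Csum_list f l = Csum_list g l.
Proof.
  induction l as [| x l IH]; intro H; [reflexivity |].
  rewrite !Csum_cons, IH, (H x); auto using in_eq, in_cons.
Qed.

Lemma Csum_zero {T : Type} (f : T -> C) l : (forall x, In x l -> f x = RtoC 0) -> Csum_list f l = RtoC 0.
Proof.
  induction l as [| x l IH]; intro H; [reflexivity |].
  rewrite Csum_cons, IH, (H x); auto using in_eq, in_cons. ring.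
Qed.

Lemma Csum_single {T : Type} (f : T -> C) x l :
  NoDup l -> In x l -> (forall y, In y l -> y <> x -> f y = RtoC 0) -> Csum_list f l = f x.
Proof.
  induction l as [| y l IH]; intros N I H; [contradiction |].
  inversion N as [| ? ? Ny Nl]; subst. rewrite Csum_cons.
  destruct I as [-> | I].
  - rewrite Csum_zero; [ring |]. intros z Hz. apply H; [right; exact Hz |].
    intros ->. contradiction.
  - rewrite IH; try assumption.
    + rewrite (H y); [ring | left; reflexivity |]. intros ->. contradiction.
    + intros z Hz. apply H. right; exact Hz.
Qed.

Lemma Csum_scal {T : Type} (f : T -> C) (c : C) l : Csum_list (fun x => (c * f x)%C) l = (c * Csum_list f l)%C.
Proof.
  induction l as [| x l IH].
  - change (RtoC 0 = (c * RtoC 0)%C). ring.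
  - rewrite !Csum_cons, IH. ring.
Qed.

Lemma Csum_filter {T : Type} (f : T -> C) (p : T -> bool) l :
  Csum_list f (filter p l) = Csum_list (fun x => if p x then f x else RtoC 0) l.
Proof.
  induction l as [| x l IH]; [reflexivity |].
  simpl. rewrite Csum_cons. destruct (p x).
  - rewrite Csum_cons, IH. reflexivity.
  - rewrite IH. ring.
Qed.

Lemma Csum_map {S T : Type} (h : S -> T) (f : T -> C) (l : list S) :
  Csum_list f (map h l) = Csum_list (fun x => f (h x)) l.
Proof. unfold Csum_list. rewrite map_map. reflexivity. Qed.

(** * Enumeration of the edges by level and the telescoping sum *)

Definition node : Type := (sector * list bool)%type.

Definition mk (i : node) : edge := mk_edge (fst i) (snd i).

Fixpoint words (k : nat) : list (list bool) :=
  match k with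
  | O => [[]]
  | S k => map (cons true) (words k) ++ map (cons false) (words k)
  end.

Definition nodes (k : nat) : list node :=
  list_prod [sector1; sector2; sector3] (words k).

Fixpoint nodes_lt (k : nat) : list node :=
  match k with O => [] | S k => nodes_lt k ++ nodes k end.

Lemma in_words (k : nat) (w : list bool) : In w (words k) <-> length w = k.
Proof.
  revert w. induction k as [| k IH]; intro w; simpl.
  - destruct w; simpl; split; intro H; try lia; auto. destruct H; [discriminate | contradiction].
  - rewrite in_app_iff, !in_map_iff. split.
    + intros [[v [<- H]] | [v [<- H]]]; simpl; f_equal; apply IH, H.
    + destruct w as [| [|] w]; simpl; intro H; [discriminate | left | right];
        (exists w; split; [reflexivity | apply IH; lia]).
Qed.

Lemma NoDup_words (k : nat) : NoDup (words k).
Proof.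
  induction k as [| k IH]; simpl.
  - constructor; [intros [] | constructor].
  - apply NoDup_app.
    + apply NoDup_map_NoDup_ForallPairs; [| exact IH]. intros x y _ _ H. injection H. trivial.
    + apply NoDup_map_NoDup_ForallPairs; [| exact IH]. intros x y _ _ H. injection H. trivial.
    + intros a H H'. apply in_map_iff in H, H'. destruct H as [x [<- _]], H' as [y [E _]]. discriminate.
Qed.

Lemma NoDup_list_prod {A B : Type} (l : list A) (l' : list B) :
  NoDup l -> NoDup l' -> NoDup (list_prod l l').
Proof.
  intros N N'. induction N as [| x l Hx N IH]; simpl; [constructor |].
  apply NoDup_app.
  - apply NoDup_map_NoDup_ForallPairs; [| exact N']. intros a b _ _ H. injection H. trivial.
  - exact IH.
  - intros [a b] H H'. apply in_map_iff in H. destruct H as [c [E _]]. injection E as <- _.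
    apply in_prod_iff in H'. destruct H'. contradiction.
Qed.

Lemma in_nodes (k : nat) (i : node) : In i (nodes k) <-> length (snd i) = k.
Proof.
  destruct i as [r w]. etransitivity; [apply in_prod_iff |]. rewrite in_words. simpl.
  split; [tauto |]. intro H. split; [destruct r; auto | exact H].
Qed.

Lemma NoDup_nodes (k : nat) : NoDup (nodes k).
Proof.
  apply NoDup_list_prod; [| apply NoDup_words].
  repeat constructor; simpl; intuition discriminate.
Qed.

Lemma in_nodes_lt (k : nat) (i : node) : In i (nodes_lt k) <-> (length (snd i) < k)%nat.
Proof.
  induction k as [| k IH]; simpl; [split; [intros [] | lia] |].
  rewrite in_app_iff, IH, in_nodes. lia.
Qed.

Lemma NoDup_nodes_lt (k : nat) : NoDup (nodes_lt k).
Proof.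
  induction k as [| k IH]; simpl; [constructor |].
  apply NoDup_app; [exact IH | apply NoDup_nodes |].
  intros i H H'. apply in_nodes_lt in H. apply in_nodes in H'. lia.
Qed.

Lemma mk_inj (i j : node) : mk i = mk j -> i = j.
Proof.
  destruct i, j. intro H. apply mk_edge_inj in H. simpl in H. destruct H; subst; reflexivity.
Qed.

Lemma mk_surj (e : edge) : exists i, e = mk i.
Proof. destruct (edge_code e) as [r [w H]]. exists (r, w). exact H. Qed.

Definition edges_lt (k : nat) : list edge := map mk (nodes_lt k).

Lemma in_edges_lt (k : nat) (i : node) : In (mk i) (edges_lt k) <-> (length (snd i) < k)%nat.
Proof.
  unfold edges_lt. rewrite in_map_iff. split.
  - intros [j [E H]]. apply mk_inj in E. subst. apply in_nodes_lt, H.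
  - intro H. exists i. split; [reflexivity | apply in_nodes_lt, H].
Qed.

Lemma NoDup_edges_lt (k : nat) : NoDup (edges_lt k).
Proof.
  apply NoDup_map_NoDup_ForallPairs; [| apply NoDup_nodes_lt].
  intros i j _ _. apply mk_inj.
Qed.

Definition in_arc (phi : R) (i : node) : Prop :=
  ang_l (fst i) (snd i) < phi < ang_r (fst i) (snd i).

Lemma in_arc_cons phi r b w : in_arc phi (r, b :: w) -> in_arc phi (r, w).
Proof.
  unfold in_arc; simpl. generalize (ang_lt r w).
  destruct b; rewrite ?ang_l_true, ?ang_r_true, ?ang_l_false, ?ang_r_false; lra.
Qed.

(* The path of nested arcs of the sector [r] containing the angle [phi]. *)
Fixpoint chain (r : sector) (phi : R) (k : nat) : list bool :=
  match k with
  | O => []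
  | S k => (if Rle_dec phi (ang_m r (chain r phi k)) then true else false) :: chain r phi k
  end.

Lemma chain_length r phi k : length (chain r phi k) = k.
Proof. induction k as [| k IH]; simpl; [reflexivity | rewrite IH; reflexivity]. Qed.

Definition in_sector (r : sector) (phi : R) : Prop := sec_angle r 0 <= phi <= sec_angle r 1.

Lemma chain_arc r phi k :
  in_sector r phi -> ang_l r (chain r phi k) <= phi <= ang_r r (chain r phi k).
Proof.
  intro H. induction k as [| k IH]; simpl.
  - unfold ang_l, ang_r, sl, sr, lv, rv, val; simpl.
    replace (0 / 1) with 0 by field. replace (1 / 1) with 1 by field. exact H.
  - destruct (Rle_dec phi (ang_m r (chain r phi k)));
      rewrite ?ang_l_true, ?ang_r_true, ?ang_l_false, ?ang_r_false; lra.
Qed.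

Lemma in_sector_range r phi : in_sector r phi -> 0 <= phi <= 2 * PI.
Proof.
  unfold in_sector. destruct (sec_angle_ends r) as [-> ->]. generalize PI_RGT_0. destruct r; lra.
Qed.

Lemma sector_exists (phi : R) : 0 <= phi <= 2 * PI -> exists r, in_sector r phi.
Proof.
  intro H. unfold in_sector. generalize PI_RGT_0; intro.
  destruct (Rle_dec phi (PI / 2)); [exists sector1 | destruct (Rle_dec phi PI); [exists sector2 | exists sector3]];
    (match goal with |- sec_angle ?r _ <= _ <= _ => destruct (sec_angle_ends r) as [-> ->] end); lra.
Qed.

(** An angle interior to an arc lies strictly on one side of the mediant of every ancestor, and this
    is the side that [chain] takes. *)
Lemma in_arc_chain r phi (i : node) :
  in_sector r phi -> in_arc phi i -> i = (r, chain r phi (length (snd i))).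
Proof.
  destruct i as [r' w]. intros Hr Hi. simpl.
  assert (r' = r).
  { unfold in_arc, in_sector in *; simpl in *. generalize (ang_range r' w) PI_RGT_0.
    destruct (sec_angle_ends r) as [E1 E2], (sec_angle_ends r') as [-> ->].
    rewrite E1, E2 in Hr.
    destruct r, r'; intros; try reflexivity; exfalso; lra. }
  subst r'. f_equal.
  induction w as [| b w IH]; simpl; [reflexivity |].
  rewrite <- IH by (eapply in_arc_cons, Hi).
  unfold in_arc in Hi; simpl in Hi. f_equal.
  destruct b; rewrite ?ang_l_true, ?ang_r_true, ?ang_l_false, ?ang_r_false in *;
    destruct (Rle_dec phi (ang_m r w)); try reflexivity; lra.
Qed.

Lemma nodes_sum (g : node -> C) r phi k :
  in_sector r phi -> (forall i, ~ in_arc phi i -> g i = RtoC 0) ->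
  Csum_list g (nodes k) = g (r, chain r phi k).
Proof.
  intros Hr Hg. apply Csum_single.
  - apply NoDup_nodes.
  - apply in_nodes. apply chain_length.
  - intros j Hj Nj. destruct (excluded_middle_informative (in_arc phi j)) as [A | A]; [exfalso | apply Hg, A].
    apply Nj. rewrite (in_arc_chain r phi j Hr A). apply in_nodes in Hj. rewrite Hj. reflexivity.
Qed.

Definition field_term (sdot : edge -> R) (z : C) (e : edge) : C :=
  (RtoC (sdot e) * elementary_field (phi0 e) (phi1 e) z)%C.

Lemma field_term_outside sdot phi (i : node) :
  0 <= phi <= 2 * PI -> ~ in_arc phi i -> field_term sdot (expi phi) (mk i) = RtoC 0.
Proof.
  intros H N. unfold field_term. rewrite elementary_outside; try assumption.
  - ring.
  - apply (edge_range (mk i)).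
  - apply (edge_range (mk i)).
Qed.

Lemma field_term_inside sdot phi r w :
  ang_l r w <= phi <= ang_r r w ->
  field_term sdot (expi phi) (mk_edge r w) =
  (RtoC (sdot (mk_edge r w)) * edge_poly (pl r w) (pr r w) (expi phi))%C.
Proof.
  intro H. unfold field_term. simpl. rewrite elementary_inside; [reflexivity | exact H |].
  generalize (ang_length r w) PI_RGT_0. lra.
Qed.

Lemma field_term_chain (V : C -> C) sdot r phi k :
  is_inf_shear V sdot -> in_sector r phi ->
  field_term sdot (expi phi) (mk (r, chain r phi k)) =
  (quad V r (chain r phi (S k)) (expi phi) - quad V r (chain r phi k) (expi phi))%C.
Proof.
  intros Hs Hr. unfold mk; simpl fst; simpl snd.
  rewrite field_term_inside by (apply chain_arc, Hr).
  simpl chain. rewrite (quad_child V sdot r (chain r phi k) _ _ Hs). ring.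
Qed.

Lemma edges_sum_telescope (V : C -> C) sdot r phi k :
  is_inf_shear V sdot -> vanish3 V -> in_sector r phi ->
  Csum_list (field_term sdot (expi phi)) (edges_lt k) = quad V r (chain r phi k) (expi phi).
Proof.
  intros Hs H0 Hr. unfold edges_lt. rewrite Csum_map.
  induction k as [| k IH]; simpl nodes_lt.
  - simpl chain. rewrite quad_base by exact H0. reflexivity.
  - rewrite Csum_app, IH.
    rewrite (nodes_sum (fun i => field_term sdot (expi phi) (mk i)) r phi k Hr).
    + rewrite (field_term_chain V) by assumption. ring.
    + intros i Hi. apply field_term_outside; [| exact Hi]. apply in_sector_range with r, Hr.
Qed.

Definition rate (K : R) (k : nat) : R := 600 * K / sqrt (INR k + 1).

Lemma rate_mono K k j : 0 <= K -> (k <= j)%nat -> rate K j <= rate K k.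
Proof.
  intros HK H. unfold rate. apply Rmult_le_compat_l; [lra |].
  assert (0 <= INR k) by apply pos_INR. apply le_INR in H.
  apply Rinv_le_contravar; [apply sqrt_lt_R0; lra | apply sqrt_le_1; lra].
Qed.

Lemma rate_lim K : is_lim_seq (rate K) 0.
Proof.
  unfold rate.
  assert (L : is_lim_seq (fun k => / sqrt (INR k + 1)) 0).
  { apply (is_lim_seq_inv (fun k => sqrt (INR k + 1)) p_infty); [| discriminate].
    apply (filterlim_comp _ _ _ (fun k => INR k + 1) sqrt eventually (Rbar_locally p_infty) (Rbar_locally p_infty)).
    - apply (is_lim_seq_ext (fun k => INR (S k))); [intro; apply S_INR |].
      apply (is_lim_seq_incr_1 INR), is_lim_seq_INR.
    - apply filterlim_sqrt_p. }
  replace (Finite 0) with (Rbar_mult (600 * K) 0) by (simpl; f_equal; ring).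
  apply is_lim_seq_scal_l. exact L.
Qed.

Lemma edges_sum_approx (V : C -> C) sdot K phi k :
  holder34 V K -> is_inf_shear V sdot -> vanish3 V -> 0 <= phi <= 2 * PI ->
  Cmod (V (expi phi) - Csum_list (field_term sdot (expi phi)) (edges_lt k)) <= rate K k.
Proof.
  intros HV Hs H0 Hphi. destruct (sector_exists phi Hphi) as [r Hr].
  rewrite (edges_sum_telescope V sdot r) by assumption.
  eapply Rle_trans; [apply quad_approx; [exact HV | exact H0 | apply chain_arc, Hr] |].
  rewrite chain_length. apply Rle_refl.
Qed.

(** * Sums over the edges ending at one vertex *)

Definition incidentb (p : C) (e : edge) : bool :=
  if excluded_middle_informative (incident p e) then true else false.

Lemma incidentb_true p e : incidentb p e = true <-> incident p e.
Proof. unfold incidentb. destruct (excluded_middle_informative _); split; intros; auto; discriminate. Qed.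

Definition fan_lt (p : C) (k : nat) : list edge := filter (incidentb p) (edges_lt k).

Lemma in_fan_lt p k (i : node) :
  In (mk i) (fan_lt p k) <-> (length (snd i) < k)%nat /\ incident p (mk i).
Proof. unfold fan_lt. rewrite filter_In, in_edges_lt, incidentb_true. tauto. Qed.

Lemma NoDup_fan_lt p k : NoDup (fan_lt p k).
Proof. apply NoDup_filter, NoDup_edges_lt. Qed.

(* Once [p] is an endpoint of an arc of the path but not of the next one, it
   lies outside all later arcs. *)
Definition off_arc (p : C) r w : Prop :=
  forall psi, ang_l r w <= psi <= ang_r r w -> expi psi <> p.

Lemma off_arc_leave p r w b :
  incident p (mk_edge r w) -> ~ incident p (mk_edge r (b :: w)) -> off_arc p r (b :: w).
Proof.
  intros Hp Hn psi Hpsi E. apply Hn. clear Hn.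
  unfold incident, src, tgt in *; simpl in *.
  generalize (ang_lt r w) (ang_length r w) PI_RGT_0. intros L1 L2 L3.
  destruct b; rewrite ?ang_l_true, ?ang_r_true, ?ang_l_false, ?ang_r_false in *.
  - destruct Hp as [-> | ->]; [left; reflexivity |].
    exfalso. apply expi_eq_close in E; lra.
  - destruct Hp as [-> | ->]; [| right; reflexivity].
    exfalso. symmetry in E. apply expi_eq_close in E; lra.
Qed.

Lemma off_arc_cons p r w b : off_arc p r w -> off_arc p r (b :: w).
Proof.
  intros H psi Hpsi. apply H. generalize (ang_lt r w).
  destruct b; rewrite ?ang_l_true, ?ang_r_true, ?ang_l_false, ?ang_r_false in *; lra.
Qed.

Lemma off_arc_not_incident p r w : off_arc p r w -> ~ incident p (mk_edge r w).
Proof.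
  intros H [E | E]; unfold src, tgt in E; simpl in E; symmetry in E; revert E; apply H;
    generalize (ang_lt r w); lra.
Qed.

Lemma fan_lt_S (f : edge -> C) p k :
  Csum_list f (fan_lt p (S k)) =
  (Csum_list f (fan_lt p k) +
   Csum_list (fun i => if incidentb p (mk i) then f (mk i) else RtoC 0) (nodes k))%C.
Proof.
  unfold fan_lt, edges_lt. simpl nodes_lt.
  rewrite map_app, filter_app, Csum_app. f_equal.
  rewrite Csum_filter, Csum_map. reflexivity.
Qed.

(** The path meets edges at p in the levels from a to b - 1, and the sum telescopes over this run.
    The final disjunction is the invariant of the induction on n: the run has not begun, it reaches
    the current level, or the path has left p for good. *)
Lemma fan_sum_run (V : C -> C) sdot p r phi k n :
  is_inf_shear V sdot -> in_sector r phi ->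
  exists a b, (k <= a <= b)%nat /\ (b <= k + n)%nat /\
    (Csum_list (field_term sdot (expi phi)) (fan_lt p (k + n)) -
     Csum_list (field_term sdot (expi phi)) (fan_lt p k))%C =
    (quad V r (chain r phi b) (expi phi) - quad V r (chain r phi a) (expi phi))%C /\
    ((a = k + n /\ b = k + n)%nat \/
     (exists b', b = S b' /\ b = (k + n)%nat /\ incident p (mk_edge r (chain r phi b'))) \/
     off_arc p r (chain r phi (k + n))).
Proof.
  intros Hs Hr. assert (Hphi := in_sector_range _ _ Hr).
  assert (Step : forall m, Csum_list (fun i => if incidentb p (mk i) then field_term sdot (expi phi) (mk i) else RtoC 0) (nodes m) =
     if incidentb p (mk_edge r (chain r phi m)) then
      (quad V r (chain r phi (S m)) (expi phi) - quad V r (chain r phi m) (expi phi))%C else RtoC 0).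
  { intro m. rewrite (nodes_sum _ r phi m Hr).
    - unfold mk at 1; simpl fst; simpl snd.
      destruct (incidentb p (mk_edge r (chain r phi m))); [| reflexivity].
      apply field_term_chain; assumption.
    - intros i Hi. rewrite field_term_outside by assumption. destruct (incidentb p (mk i)); reflexivity. }
  induction n as [| n IH].
  - exists k, k. rewrite Nat.add_0_r. split; [lia |]. split; [lia |]. split; [ring | left; lia].
  - destruct IH as (a & b & Hab & Hb & E & Cases).
    rewrite Nat.add_succ_r, fan_lt_S, Step.
    set (m := (k + n)%nat) in *.
    destruct (incidentb p (mk_edge r (chain r phi m))) eqn:Ei.
    + apply incidentb_true in Ei.
      (* An incident edge at level m rules out that the path has left p, so the run can only start
         here or be prolonged. *)
      assert (Hbm : b = m).
      { destruct Cases as [[_ ?] | [[b' (_ & ? & _)] | H]]; try assumption.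
        exfalso. exact (off_arc_not_incident _ _ _ H Ei). }
      subst b. exists a, (S m). split; [lia |]. split; [lia |]. split.
      * transitivity ((Csum_list (field_term sdot (expi phi)) (fan_lt p m) -
          Csum_list (field_term sdot (expi phi)) (fan_lt p k)) +
          (quad V r (chain r phi (S m)) (expi phi) - quad V r (chain r phi m) (expi phi)))%C; [ring |].
        rewrite E. ring.
      * right; left. exists m. repeat split. exact Ei.
    + assert (Ei' : ~ incident p (mk_edge r (chain r phi m))).
      { rewrite <- incidentb_true, Ei. discriminate. }
      replace (Csum_list (field_term sdot (expi phi)) (fan_lt p m) + 0 -
        Csum_list (field_term sdot (expi phi)) (fan_lt p k))%C with
        (Csum_list (field_term sdot (expi phi)) (fan_lt p m) -
        Csum_list (field_term sdot (expi phi)) (fan_lt p k))%C by ring.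
      rewrite E.
      destruct Cases as [[Ha Hb'] | [[b' (Hb' & Hbm & Hi)] | H]].
      * exists (S m), (S m). split; [lia |]. split; [lia |]. split; [subst a b; ring | left; lia].
      * exists a, b. split; [lia |]. split; [lia |]. split; [reflexivity |]. right; right.
        simpl chain. apply off_arc_cons.
        rewrite <- Hbm, Hb' in Ei' |- *. simpl chain in Ei' |- *. apply off_arc_leave; assumption.
      * exists a, b. split; [lia |]. split; [lia |]. split; [reflexivity |]. right; right. simpl chain. apply off_arc_cons, H.
Qed.

Lemma fan_sum_tail (V : C -> C) sdot K p phi k n :
  holder34 V K -> is_inf_shear V sdot -> vanish3 V -> 0 <= phi <= 2 * PI ->
  Cmod (Csum_list (field_term sdot (expi phi)) (fan_lt p (k + n)) -
        Csum_list (field_term sdot (expi phi)) (fan_lt p k)) <= 2 * rate K k.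
Proof.
  intros HV Hs H0 Hphi. destruct (sector_exists phi Hphi) as [r Hr].
  destruct (fan_sum_run V sdot p r phi k n Hs Hr) as (a & b & Hab & _ & -> & _).
  assert (HK : 0 <= K) by apply HV.
  assert (Q : forall j, (k <= j)%nat ->
    Cmod (V (expi phi) - quad V r (chain r phi j) (expi phi)) <= rate K k).
  { intros j Hj. eapply Rle_trans; [apply quad_approx; [exact HV | exact H0 | apply chain_arc, Hr] |].
    rewrite chain_length. apply rate_mono; assumption. }
  replace (quad V r (chain r phi b) (expi phi) - quad V r (chain r phi a) (expi phi))%C with
    ((V (expi phi) - quad V r (chain r phi a) (expi phi)) +
     - (V (expi phi) - quad V r (chain r phi b) (expi phi)))%C by ring.
  eapply Rle_trans; [apply Cmod_triangle |]. rewrite Cmod_opp.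
  generalize (Q a ltac:(lia)) (Q b ltac:(lia)). lra.
Qed.

(** The point p is an end of every arc of its fan, so no open arc of the fan contains p itself. An
    arc ending at p and containing another point z is at least |z - p| long, while arcs of level k
    have length at most 4 / (k + 1). *)
Lemma fan_term_finite sdot p phi :
  0 <= phi <= 2 * PI -> exists k0, forall e, incident p e -> ~ In e (fan_lt p k0) ->
    field_term sdot (expi phi) e = RtoC 0.
Proof.
  intro Hphi. destruct (excluded_middle_informative (expi phi = p)) as [E | N].
  - exists 0%nat. intros e He _. destruct (mk_surj e) as [[r w] ->].
    destruct (excluded_middle_informative (in_arc phi (r, w))) as [A | A];
      [| apply field_term_outside; assumption].
    exfalso. unfold in_arc in A; simpl in A.
    generalize (ang_length r w) PI_RGT_0; intros.
    destruct He as [He | He]; unfold src, tgt in He; simpl in He; rewrite <- E in He.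
    + symmetry in He. apply expi_eq_close in He; lra.
    + apply expi_eq_close in He; lra.
  - assert (HD : 0 < Cmod (expi phi - p)).
    { apply Cmod_gt_0. apply Cminus_neq_0, N. }
    destruct (nfloor_ex (4 / Cmod (expi phi - p))) as [k0 [_ Hk]].
    { apply Rdiv_le_0_compat; lra. }
    exists (S k0). intros e He Hn. destruct (mk_surj e) as [[r w] ->].
    destruct (excluded_middle_informative (in_arc phi (r, w))) as [A | A];
      [| apply field_term_outside; assumption].
    exfalso. apply Hn. apply in_fan_lt. split; [| exact He]. simpl.
    unfold in_arc in A; simpl in A.
    assert (B : Cmod (expi phi - p) <= ang_r r w - ang_l r w).
    { destruct He as [-> | ->]; unfold src, tgt; simpl;
        (eapply Rle_trans; [apply Cmod_expi_minus |]; unfold Rabs; destruct Rcase_abs; lra). }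
    generalize (edge_arc_le r w) (q_prod_ge w) (q_level w). intros B1 B2 B3.
    assert (Hlen : 0 <= INR (length w)) by apply pos_INR.
    assert (B4 : / (ql w * qr w) <= / (INR (length w) + 1)) by (apply Rinv_le_contravar; lra).
    assert (B5 : INR (length w) + 1 <= 4 / Cmod (expi phi - p)).
    { apply Rle_div_r; [exact HD |].
      apply Rle_trans with ((INR (length w) + 1) * (4 * / (INR (length w) + 1))).
      - apply Rmult_le_compat_l; lra.
      - right. field. lra. }
    apply INR_lt. rewrite S_INR. lra.
Qed.

(** * Fourier integrals *)

Ltac to_C := match goal with |- @eq _ ?a ?b => change (@eq C a b) end.

(** Integration is taken over the real module structure of C, so a complex factor is not a scalar
    and is treated componentwise. *)
Lemma is_RInt_Cmult_l (c l : C) (f : R -> C) (a b : R) :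
  is_RInt (V := C_R_NormedModule) f a b l ->
  is_RInt (V := C_R_NormedModule) (fun x => (c * f x)%C) a b (c * l)%C.
Proof.
  intro H. destruct l as [l1 l2], c as [c1 c2].
  assert (H1 := is_RInt_fct_extend_fst (U := R_NormedModule) (V := R_NormedModule) _ _ _ _ H).
  assert (H2 := is_RInt_fct_extend_snd (U := R_NormedModule) (V := R_NormedModule) _ _ _ _ H).
  simpl in H1, H2.
  apply (is_RInt_fct_extend_pair (U := R_NormedModule) (V := R_NormedModule)); simpl.
  - apply (is_RInt_minus (V := R_NormedModule) (fun x => c1 * fst (f x)) (fun x => c2 * snd (f x)));
      apply (is_RInt_scal (V := R_NormedModule)); assumption.
  - apply (is_RInt_plus (V := R_NormedModule) (fun x => c1 * snd (f x)) (fun x => c2 * fst (f x)));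
      apply (is_RInt_scal (V := R_NormedModule)); assumption.
Qed.

Lemma is_RInt_Cplus (f g : R -> C) (l l' : C) (a b : R) :
  is_RInt (V := C_R_NormedModule) f a b l -> is_RInt (V := C_R_NormedModule) g a b l' ->
  is_RInt (V := C_R_NormedModule) (fun x => (f x + g x)%C) a b (l + l')%C.
Proof. apply (is_RInt_plus (V := C_R_NormedModule)). Qed.

Lemma is_RInt_expi (m : Z) (t0 t1 : R) :
  is_RInt (V := C_R_NormedModule) (fun t => expi (IZR m * t)) t0 t1 (exp_quot m t0 t1).
Proof.
  unfold exp_quot. destruct (Z.eq_dec m 0) as [-> | Hm].
  - apply (is_RInt_ext (V := C_R_NormedModule) (fun _ => RtoC 1)).
    + intros x _. rewrite Rmult_0_l, expi_0. reflexivity.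
    + replace (RtoC (t1 - t0)) with (scal (V := C_R_NormedModule) (t1 - t0) (RtoC 1)).
      * apply (is_RInt_const (V := C_R_NormedModule)).
      * apply C_eq; simpl; unfold scal; simpl; unfold mult; simpl; ring.
  - assert (Hm' : IZR m <> 0) by (intro E; apply eq_IZR in E; contradiction).
    replace ((expi (IZR m * t1) - expi (IZR m * t0)) / (Ci * RtoC (IZR m)))%C with
      (sin (IZR m * t1) / IZR m - sin (IZR m * t0) / IZR m,
       - cos (IZR m * t1) / IZR m - - cos (IZR m * t0) / IZR m).
    + apply (is_RInt_fct_extend_pair (U := R_NormedModule) (V := R_NormedModule)); simpl.
      * apply (is_RInt_derive (V := R_CompleteNormedModule) (fun t => sin (IZR m * t) / IZR m)).
        -- intros x _. auto_derive; [trivial | field; exact Hm'].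
        -- intros x _. apply (ex_derive_continuous (K := R_AbsRing) (V := R_NormedModule)). auto_derive. trivial.
      * apply (is_RInt_derive (V := R_CompleteNormedModule) (fun t => - cos (IZR m * t) / IZR m)).
        -- intros x _. auto_derive; [trivial | field; exact Hm'].
        -- intros x _. apply (ex_derive_continuous (K := R_AbsRing) (V := R_NormedModule)). auto_derive. trivial.
    + apply C_eq; simpl; field; nra.
Qed.

Lemma is_RInt_zero (f : R -> C) (a b : R) :
  a <= b -> (forall x, a < x < b -> f x = RtoC 0) ->
  is_RInt (V := C_R_NormedModule) f a b (RtoC 0).
Proof.
  intros Hab H. apply (is_RInt_ext (V := C_R_NormedModule) (fun _ => RtoC 0)).
  - intros x Hx. rewrite Rmin_left, Rmax_right in Hx by exact Hab. symmetry. apply H, Hx.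
  - assert (X := is_RInt_const (V := C_R_NormedModule) a b (RtoC 0)).
    refine (eq_ind _ (is_RInt (V := C_R_NormedModule) (fun _ => RtoC 0) a b) X _ _).
    apply C_eq; simpl; unfold scal; simpl; unfold mult; simpl; ring.
Qed.

Lemma is_RInt_edge_poly n (t0 t1 : R) :
  is_RInt (V := C_R_NormedModule)
    (fun t => (edge_poly (expi t0) (expi t1) (expi t) * expi (- IZR n * t))%C) t0 t1
    (/ (expi t0 - expi t1) *
     (exp_quot (2 - n) t0 t1 - (expi t0 + expi t1) * exp_quot (1 - n) t0 t1
      + expi (t0 + t1) * exp_quot (- n) t0 t1))%C.
Proof.
  apply (is_RInt_ext (V := C_R_NormedModule)
    (fun t => (/ (expi t0 - expi t1) *
      (expi (IZR (2 - n) * t) + (- (expi t0 + expi t1)) * expi (IZR (1 - n) * t)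
       + expi (t0 + t1) * expi (IZR (- n) * t)))%C)).
  - intros t _. unfold edge_poly, Cdiv.
    replace (IZR (2 - n) * t) with (t + t + - IZR n * t) by (rewrite minus_IZR; ring).
    replace (IZR (1 - n) * t) with (t + - IZR n * t) by (rewrite minus_IZR; ring).
    rewrite opp_IZR, !expi_plus. to_C. ring.
  - apply is_RInt_Cmult_l. apply is_RInt_Cplus; [apply is_RInt_Cplus |].
    + apply is_RInt_expi.
    + replace (- ((expi t0 + expi t1) * exp_quot (1 - n) t0 t1))%C
        with (- (expi t0 + expi t1) * exp_quot (1 - n) t0 t1)%C by ring.
      apply is_RInt_Cmult_l, is_RInt_expi.
    + apply is_RInt_Cmult_l, is_RInt_expi.
Qed.

Lemma is_RInt_arc_term sdot n r w :
  is_RInt (V := C_R_NormedModule)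
    (fun t => (RtoC (/ 2 * sdot (mk_edge r w)) *
      (edge_poly (pl r w) (pr r w) (expi t) * expi (- IZR n * t)))%C)
    (ang_l r w) (ang_r r w) (RtoC (2 * PI) * fan_coef_term sdot n (mk_edge r w))%C.
Proof.
  assert (D : (pl r w - pr r w)%C <> RtoC 0) by (apply Cminus_neq_0, node_distinct).
  replace (RtoC (2 * PI) * fan_coef_term sdot n (mk_edge r w))%C with
    (RtoC (/ 2 * sdot (mk_edge r w)) * (/ (pl r w - pr r w) *
      (exp_quot (2 - n) (ang_l r w) (ang_r r w)
       - (pl r w + pr r w) * exp_quot (1 - n) (ang_l r w) (ang_r r w)
       + expi (ang_l r w + ang_r r w) * exp_quot (- n) (ang_l r w) (ang_r r w))))%C.
  - apply is_RInt_Cmult_l. apply is_RInt_edge_poly.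
  - unfold fan_coef_term, src, tgt; simpl. fold (pl r w) (pr r w).
    assert (P : RtoC PI <> RtoC 0) by (intro E; apply RtoC_inj in E; generalize PI_RGT_0; lra).
    rewrite !RtoC_mult, RtoC_inv by lra. field.
    repeat split; try assumption; intro E; apply RtoC_inj in E; lra.
Qed.

Lemma is_RInt_fan_term sdot n r w :
  is_RInt (V := C_R_NormedModule)
    (fun t => (fan_field_term sdot (expi t) (mk_edge r w) * expi (- IZR n * t))%C)
    0 (2 * PI) (RtoC (2 * PI) * fan_coef_term sdot n (mk_edge r w))%C.
Proof.
  destruct (mk_range r w) as (B0 & B1 & B2).
  replace (RtoC (2 * PI) * fan_coef_term sdot n (mk_edge r w))%C with
    ((RtoC 0 + RtoC (2 * PI) * fan_coef_term sdot n (mk_edge r w)) + RtoC 0)%C by ring.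
  apply (is_RInt_Chasles (V := C_R_NormedModule)) with (ang_r r w);
    [apply (is_RInt_Chasles (V := C_R_NormedModule)) with (ang_l r w) |].
  - apply is_RInt_zero; [exact B0 |]. intros t Ht. unfold fan_field_term; simpl.
    rewrite elementary_outside by lra. ring.
  - eapply (is_RInt_ext (V := C_R_NormedModule)); [| apply is_RInt_arc_term].
    intros t Ht. rewrite Rmin_left, Rmax_right in Ht by lra.
    unfold fan_field_term; simpl. rewrite elementary_inside; [unfold pl, pr; to_C; ring | lra |].
    generalize (ang_length r w) PI_RGT_0. lra.
  - apply is_RInt_zero; [exact B2 |]. intros t Ht. unfold fan_field_term; simpl.
    rewrite elementary_outside by lra. ring.
Qed.

Lemma is_RInt_fan_sum sdot n (l : list edge) :
  is_RInt (V := C_R_NormedModule)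
    (fun t => (Csum_list (fan_field_term sdot (expi t)) l * expi (- IZR n * t))%C)
    0 (2 * PI) (RtoC (2 * PI) * Csum_list (fan_coef_term sdot n) l)%C.
Proof.
  induction l as [| e l IH].
  - change (Csum_list (fan_coef_term sdot n) []) with (RtoC 0).
    replace (RtoC (2 * PI) * RtoC 0)%C with (RtoC 0) by ring.
    apply is_RInt_zero; [generalize PI_RGT_0; lra |].
    intros t _. change (Csum_list (fan_field_term sdot (expi t)) []) with (RtoC 0). ring.
  - destruct (mk_surj e) as [[r w] ->].
    rewrite Csum_cons, Cmult_plus_distr_l.
    eapply (is_RInt_ext (V := C_R_NormedModule)); [| apply is_RInt_Cplus; [apply is_RInt_fan_term | exact IH]].
    intros t _. rewrite Csum_cons. unfold mk; simpl. to_C. ring.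
Qed.

Lemma ball_of_Cmod (x y : C) (eps : posreal) : Cmod (y - x) < eps -> ball (M := C_UniformSpace) x eps y.
Proof.
  intro H. generalize (Rmax_Cmod (y - x)%C). intro M.
  generalize (Rmax_l (Rabs (fst (y - x)%C)) (Rabs (snd (y - x)%C)))
    (Rmax_r (Rabs (fst (y - x)%C)) (Rabs (snd (y - x)%C))). intros.
  split; unfold ball; simpl; unfold AbsRing_ball, abs, minus, plus, opp; simpl in *; lra.
Qed.

Lemma Cmod_of_ball (x y : C) (eps : posreal) :
  ball (M := C_UniformSpace) x eps y -> Cmod (y - x) <= 2 * eps.
Proof.
  intros [H1 H2]. unfold ball in *; simpl in *; unfold AbsRing_ball, abs, minus, plus, opp in *; simpl in *.
  apply Cmod_le_of_sq; [generalize (cond_pos eps); lra |]. simpl.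
  apply Rabs_def2 in H1. apply Rabs_def2 in H2. unfold Rsqr. generalize (cond_pos eps). nra.
Qed.

Definition Clim (u : nat -> C) (l : C) : Prop :=
  forall eps, 0 < eps -> exists N, forall k, (N <= k)%nat -> Cmod (u k - l) < eps.

Lemma Clim_filterlim (u : nat -> C) (l : C) :
  Clim u l <-> filterlim u eventually (locally (T := C_UniformSpace) l).
Proof.
  split.
  - intros H P [eps HP]. destruct (H eps (cond_pos eps)) as [N HN].
    exists N. intros k Hk. apply HP, ball_of_Cmod, HN, Hk.
  - intros H eps He. assert (He4 : 0 < eps / 4) by lra.
    destruct (H _ (locally_ball (T := C_UniformSpace) l (mkposreal _ He4))) as [N HN].
    exists N. intros k Hk. specialize (HN k Hk). apply Cmod_of_ball in HN. simpl in HN. lra.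
Qed.

Lemma uniform_RInt (f : nat -> R -> C) (g : R -> C) (a b : R) (h : nat -> C) (d : nat -> R) :
  (forall k, is_RInt (V := C_R_NormedModule) (f k) a b (h k)) ->
  (forall k x, Cmod (f k x - g x) <= d k) -> is_lim_seq d 0 ->
  exists I, is_RInt (V := C_R_NormedModule) g a b I /\ Clim h I.
Proof.
  intros Hf Hd Hl.
  destruct (filterlim_RInt (V := C_R_CompleteNormedModule) f a b eventually eventually_filter g h Hf)
    as [I [H1 H2]].
  - intros P [eps HP]. apply is_lim_seq_spec in Hl. destruct (Hl eps) as [N HN].
    exists N. intros k Hk. apply HP. intro x. apply ball_of_Cmod.
    eapply Rle_lt_trans; [apply Hd |]. specialize (HN k Hk). rewrite Rminus_0_r in HN.
    eapply Rle_lt_trans; [apply Rle_abs | exact HN].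
  - exists I. split; [exact H2 | apply Clim_filterlim; exact H1].
Qed.

Lemma fourier_coef_unique (F : C -> C) n I :
  is_RInt (V := C_R_NormedModule) (fourier_integrand F n) 0 (2 * PI) I ->
  fourier_coef F n = (RtoC (/ (2 * PI)) * I)%C.
Proof.
  intro H. unfold fourier_coef. f_equal.
  apply (is_RInt_unique (V := C_R_CompleteNormedModule)). exact H.
Qed.

Lemma fan_field_term_half sdot z e : fan_field_term sdot z e = (RtoC (/ 2) * field_term sdot z e)%C.
Proof. unfold fan_field_term, field_term. rewrite RtoC_mult. ring. Qed.

Lemma Csum_fan_half sdot z l :
  Csum_list (fan_field_term sdot z) l = (RtoC (/ 2) * Csum_list (field_term sdot z) l)%C.
Proof. rewrite <- Csum_scal. apply Csum_ext. intros. apply fan_field_term_half. Qed.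

Lemma Clim_scal (u : nat -> C) (c l : C) : Clim u l -> Clim (fun k => (c * u k)%C) (c * l)%C.
Proof.
  intros H eps He. assert (Hc : 0 < Cmod c + 1) by (generalize (Cmod_ge_0 c); lra).
  destruct (H (eps / (Cmod c + 1))) as [N HN]; [apply Rdiv_lt_0_compat; lra |].
  exists N. intros k Hk. replace (c * u k - c * l)%C with (c * (u k - l))%C by ring.
  rewrite Cmod_mult. specialize (HN k Hk). apply Rlt_div_r in HN; [| exact Hc].
  generalize (Cmod_ge_0 (u k - l)) (Cmod_ge_0 c). nra.
Qed.

Lemma Clim_ext (u v : nat -> C) (l : C) : (forall k, u k = v k) -> Clim u l -> Clim v l.
Proof. intros E H eps He. destruct (H eps He) as [N HN]. exists N. intros k Hk. rewrite <- E. apply HN, Hk. Qed.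

Lemma uniform_fourier sdot n (F : C -> C) (L : nat -> list edge) (d : nat -> R) :
  (forall phi k, 0 <= phi <= 2 * PI ->
     Cmod (Csum_list (fan_field_term sdot (expi phi)) (L k) - F (expi phi)) <= d k) ->
  is_lim_seq d 0 ->
  ex_RInt (V := C_R_NormedModule) (fourier_integrand F n) 0 (2 * PI) /\
  Clim (fun k => Csum_list (fan_coef_term sdot n) (L k)) (fourier_coef F n).
Proof.
  intros Hd Hl.
  destruct (uniform_RInt
    (fun k t => (Csum_list (fan_field_term sdot (expi t)) (L k) * expi (- IZR n * t))%C)
    (fourier_integrand F n) 0 (2 * PI)
    (fun k => (RtoC (2 * PI) * Csum_list (fan_coef_term sdot n) (L k))%C) d) as [I [H1 H2]].
  - intro k. apply is_RInt_fan_sum.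
  - intros k x. unfold fourier_integrand.
    (* The convergence has to be uniform on the whole line; an arbitrary x is replaced by an angle
       of the same point in [0, 2 PI]. *)
    destruct (S1_polar (expi x) (S1_expi x)) as [t [Ht ->]].
    replace (_ - _)%C with
      ((Csum_list (fan_field_term sdot (expi t)) (L k) - F (expi t)) * expi (- IZR n * x))%C by ring.
    rewrite Cmod_mult, Cmod_expi, Rmult_1_r. apply Hd, Ht.
  - exact Hl.
  - split; [exists I; exact H1 |].
    rewrite (fourier_coef_unique F n I H1).
    eapply Clim_ext; [| apply Clim_scal, H2]. intro k. cbv beta.
    rewrite Cmult_assoc, <- RtoC_mult, Rinv_l, Cmult_1_l; [reflexivity |].
    generalize PI_RGT_0. lra.
Qed.

Lemma fourier_half (V : C -> C) sdot K n :
  holder34 V K -> is_inf_shear V sdot -> vanish3 V ->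
  Clim (fun k => Csum_list (fan_coef_term sdot n) (edges_lt k)) (RtoC (/ 2) * fourier_coef V n)%C.
Proof.
  intros HV Hs H0.
  destruct (uniform_fourier sdot n (fun z => (RtoC (/ 2) * V z)%C) edges_lt (rate K)) as [_ H].
  - intros phi k Hphi. rewrite Csum_fan_half.
    replace (_ - _)%C with (RtoC (- / 2) *
      (V (expi phi) - Csum_list (field_term sdot (expi phi)) (edges_lt k)))%C by (rewrite RtoC_opp; ring).
    rewrite Cmod_mult, Cmod_R, Rabs_Ropp, Rabs_right by lra.
    generalize (edges_sum_approx V sdot K phi k HV Hs H0 Hphi)
      (Cmod_ge_0 (V (expi phi) - Csum_list (field_term sdot (expi phi)) (edges_lt k))). lra.
  - apply rate_lim.
  (* Listing every edge twice cancels the factor 1/2 of the fan terms, so the same limit argument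
     gives integrability of V itself. *)
  - destruct (uniform_fourier sdot n V (fun k => edges_lt k ++ edges_lt k) (rate K)) as [[I HI] _].
    + intros phi k Hphi. rewrite Csum_app, Csum_fan_half.
      replace (_ - _)%C with (- (V (expi phi) - Csum_list (field_term sdot (expi phi)) (edges_lt k)))%C.
      * rewrite Cmod_opp. apply edges_sum_approx; assumption.
      * apply C_eq; simpl; field.
    + apply rate_lim.
    + replace (RtoC (/ 2) * fourier_coef V n)%C with (fourier_coef (fun z => (RtoC (/ 2) * V z)%C) n); [exact H |].
      rewrite (fourier_coef_unique V n I HI).
      rewrite (fourier_coef_unique (fun z => (RtoC (/ 2) * V z)%C) n (RtoC (/ 2) * I)%C); [ring |].
      eapply (is_RInt_ext (V := C_R_NormedModule)); [| apply is_RInt_Cmult_l, HI].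
      intros x _. unfold fourier_integrand. cbv beta. to_C. ring.
Qed.

(** The estimate uses the integral over the arc rather than the closed formula, in which
    cancellation would have to be exhibited. With P = q q' and S = sqrt P, arc length 4 / P, shear
    64 K S, the factor 1/2 and field 16 / P multiply to 2048 K / (P S), uniformly in n; dividing by
    2 PI > 1 only improves the bound. *)
Lemma norm_fan_coef (V : C -> C) sdot K n r w :
  holder34 V K -> is_inf_shear V sdot -> vanish3 V ->
  Cmod (fan_coef_term sdot n (mk_edge r w)) <=
  2048 * K * (/ (ql w * sqrt (ql w)) * / (qr w * sqrt (qr w))).
Proof.
  intros HV Hs H0. assert (HK : 0 <= K) by apply HV.
  set (P := ql w * qr w).
  assert (HP1 : 1 <= P) by (unfold P; generalize (q_ge_1 w); nra).
  assert (HiP : 0 < / P) by (apply Rinv_0_lt_compat; lra).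
  generalize (shear_bound V sdot K r w HV H0 Hs) (sqrt_sum_le w) (edge_arc_le r w) (ang_lt r w).
  fold P. set (S := sqrt P). intros Bs Bq Bl Bt.
  set (B := / 2 * Rabs (sdot (mk_edge r w)) * (16 * / P)).
  assert (HB : Cmod (RtoC (2 * PI) * fan_coef_term sdot n (mk_edge r w)) <= (ang_r r w - ang_l r w) * B).
  { rewrite Cmod_norm.
    apply (norm_RInt_le (V := C_R_NormedModule)
      (fun t => (RtoC (/ 2 * sdot (mk_edge r w)) *
        (edge_poly (pl r w) (pr r w) (expi t) * expi (- IZR n * t)))%C) (fun _ => B) (ang_l r w) (ang_r r w)).
    - lra.
    - intros t Ht. rewrite <- Cmod_norm, !Cmod_mult, Cmod_R, Cmod_expi, Rmult_1_r, Rabs_mult.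
      rewrite (Rabs_right (/ 2)) by lra. unfold B.
      apply Rmult_le_compat_l; [generalize (Rabs_pos (sdot (mk_edge r w))); lra |].
      apply edge_poly_bound, Ht.
    - apply is_RInt_arc_term.
    - apply (is_RInt_const (V := R_NormedModule)). }
  rewrite Cmod_mult, Cmod_R, Rabs_right in HB by (generalize PI_RGT_0; lra).
  assert (HS : S * S = P) by (apply sqrt_sqrt; lra).
  assert (HS1 : 1 <= S) by (unfold S; rewrite <- sqrt_1; apply sqrt_le_1; lra).
  assert (HX : (ang_r r w - ang_l r w) * B <= 2048 * K * (/ P * / S)).
  { apply Rle_trans with ((4 * / P) * (/ 2 * (32 * K * (2 * S)) * (16 * / P))).
    - assert (0 <= B).
      { unfold B. generalize (Rabs_pos (sdot (mk_edge r w))). intros.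
        apply Rmult_le_pos; lra. }
      apply Rmult_le_compat; try lra.
      unfold B. apply Rmult_le_compat_r; [lra |]. apply Rmult_le_compat_l; [lra |].
      eapply Rle_trans; [exact Bs |]. apply Rmult_le_compat_l; lra.
    - right. rewrite <- HS. field. lra. }
  replace (/ (ql w * sqrt (ql w)) * / (qr w * sqrt (qr w))) with (/ P * / S).
  - generalize PI_RGT_0 PI2_1 (Cmod_ge_0 (fan_coef_term sdot n (mk_edge r w))). nra.
  - unfold S, P. destruct (q_ge_1 w). rewrite sqrt_mult by lra.
    field. repeat split; try lra; apply Rgt_not_eq, sqrt_lt_R0; lra.
Qed.

(** * Absolute summability *)

Definition Rsum {T : Type} (g : T -> R) (l : list T) : R := fold_right Rplus 0 (map g l).

Lemma Rsum_cons {T : Type} (g : T -> R) x l : Rsum g (x :: l) = g x + Rsum g l.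
Proof. reflexivity. Qed.

Lemma Rsum_app {T : Type} (g : T -> R) l l' : Rsum g (l ++ l') = Rsum g l + Rsum g l'.
Proof.
  induction l as [| x l IH]; simpl app.
  - unfold Rsum at 2; simpl. ring.
  - rewrite !Rsum_cons, IH. ring.
Qed.

Lemma Rsum_le {T : Type} (f g : T -> R) l : (forall x, In x l -> f x <= g x) -> Rsum f l <= Rsum g l.
Proof.
  induction l as [| x l IH]; intro H; [apply Rle_refl |].
  rewrite !Rsum_cons. apply Rplus_le_compat; [apply H, in_eq |].
  apply IH. intros y Hy. apply H, in_cons, Hy.
Qed.

Lemma Rsum_nonneg {T : Type} (g : T -> R) l : (forall x, In x l -> 0 <= g x) -> 0 <= Rsum g l.
Proof.
  induction l as [| x l IH]; intro H; [apply Rle_refl |].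
  rewrite Rsum_cons. apply Rplus_le_le_0_compat; [apply H, in_eq |].
  apply IH. intros y Hy. apply H, in_cons, Hy.
Qed.

Lemma Rsum_scal {T : Type} (c : R) (g : T -> R) l : Rsum (fun x => c * g x) l = c * Rsum g l.
Proof.
  induction l as [| x l IH]; [unfold Rsum; simpl; ring |].
  rewrite !Rsum_cons, IH. ring.
Qed.

Lemma Rsum_map {S T : Type} (h : S -> T) (g : T -> R) l : Rsum g (map h l) = Rsum (fun x => g (h x)) l.
Proof. unfold Rsum. rewrite map_map. reflexivity. Qed.

Lemma Rsum_perm {T : Type} (g : T -> R) l l' : Permutation l l' -> Rsum g l = Rsum g l'.
Proof. induction 1; rewrite ?Rsum_cons; lra. Qed.

Lemma Csum_perm {T : Type} (f : T -> C) l l' : Permutation l l' -> Csum_list f l = Csum_list f l'.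
Proof.
  induction 1; rewrite ?Csum_cons; try congruence; try reflexivity. ring.
Qed.

Lemma Cmod_Csum {T : Type} (f : T -> C) l : Cmod (Csum_list f l) <= Rsum (fun x => Cmod (f x)) l.
Proof.
  induction l as [| x l IH].
  - change (Cmod (RtoC 0) <= 0). rewrite Cmod_0. apply Rle_refl.
  - rewrite Csum_cons, Rsum_cons. eapply Rle_trans; [apply Cmod_triangle | lra].
Qed.

Definition minus_list {T : Type} (l s : list T) : list T :=
  filter (fun x => if excluded_middle_informative (In x s) then false else true) l.

Lemma in_minus_list {T : Type} (l s : list T) x : In x (minus_list l s) <-> In x l /\ ~ In x s.
Proof.
  unfold minus_list. rewrite filter_In.
  destruct (excluded_middle_informative (In x s)); split; intros []; split; auto; discriminate.
Qed.

Lemma split_perm {T : Type} (s l : list T) :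
  NoDup s -> NoDup l -> incl s l -> Permutation l (s ++ minus_list l s).
Proof.
  intros Ns Nl H. apply NoDup_Permutation; [exact Nl | |].
  - apply NoDup_app; [exact Ns | apply NoDup_filter, Nl |].
    intros x Hx Hx'. apply in_minus_list in Hx'. tauto.
  - intro x. rewrite in_app_iff, in_minus_list. split.
    + intro Hx. destruct (excluded_middle_informative (In x s)); tauto.
    + intros [Hx | [Hx _]]; [apply H |]; exact Hx.
Qed.

Lemma Rsum_incl {T : Type} (g : T -> R) s l :
  NoDup s -> NoDup l -> incl s l -> (forall x, In x l -> 0 <= g x) -> Rsum g s <= Rsum g l.
Proof.
  intros Ns Nl H Hg. rewrite (Rsum_perm g l _ (split_perm s l Ns Nl H)), Rsum_app.
  assert (0 <= Rsum g (minus_list l s)).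
  { apply Rsum_nonneg. intros x Hx. apply Hg. apply in_minus_list in Hx. tauto. }
  lra.
Qed.

Lemma Csum_incl {T : Type} (f : T -> C) s l :
  NoDup s -> NoDup l -> incl s l -> (forall x, In x l -> ~ In x s -> f x = RtoC 0) ->
  Csum_list f l = Csum_list f s.
Proof.
  intros Ns Nl H Hf. rewrite (Csum_perm f l _ (split_perm s l Ns Nl H)), Csum_app.
  rewrite (Csum_zero f (minus_list l s)); [ring |].
  intros x Hx. apply in_minus_list in Hx. apply Hf; tauto.
Qed.

Definition abs_bounded {T : Type} (P : T -> Prop) (f : T -> C) : Prop :=
  exists M, forall s, list_in P s -> Rsum (fun x => Cmod (f x)) s <= M.

Lemma eventually_incl {T : Type} (L : nat -> list T) (s : list T) :
  (forall x, In x s -> exists K, forall k, (K <= k)%nat -> In x (L k)) ->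
  exists K, forall k, (K <= k)%nat -> incl s (L k).
Proof.
  induction s as [| x s IH]; intro H.
  - exists 0%nat. intros k _ y [].
  - destruct (H x (in_eq _ _)) as [K1 H1].
    destruct IH as [K2 H2]; [intros y Hy; apply H, in_cons, Hy |].
    exists (Nat.max K1 K2). intros k Hk y [<- | Hy]; [apply H1; lia | apply H2; [lia | exact Hy]].
Qed.

(** Absolute boundedness turns convergence along one exhaustion into unconditional convergence. Take
    s1 with absolute sum within eps / 2 of the supremum m and a level k with s1 inside [L k]:
    whatever is added to [L k] is disjoint from s1, hence has absolute sum below eps / 2. *)
Lemma exhaustion_sum {T : Type} (P : T -> Prop) (f : T -> C) (L : nat -> list T) (l : C) :
  abs_bounded P f -> (forall k, list_in P (L k)) ->
  (forall x, P x -> exists K, forall k, (K <= k)%nat -> In x (L k)) ->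
  Clim (fun k => Csum_list f (L k)) l ->
  forall eps, 0 < eps -> exists s0, list_in P s0 /\
    forall s, list_in P s -> incl s0 s -> Cmod (Csum_list f s - l) < eps.
Proof.
  intros [M HM] HL Hex Hlim eps He.
  set (g := fun x => Cmod (f x)) in *.
  destruct (completeness (fun x => exists s, list_in P s /\ x = Rsum g s)) as [m [Hub Hlub]].
  - exists M. intros x [s [Hs ->]]. apply HM, Hs.
  - exists (Rsum g []). exists []. split; [split; [constructor | intros x []] | reflexivity].
  - destruct (excluded_middle_informative (exists s, list_in P s /\ m - eps / 2 < Rsum g s)) as [[s1 [Hs1 Hm]] | N].
    2: { exfalso. assert (m <= m - eps / 2); [| lra]. apply Hlub. intros x [s [Hs ->]].
         destruct (Rle_dec (Rsum g s) (m - eps / 2)); [assumption |].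
         exfalso. apply N. exists s. split; [exact Hs | lra]. }
    destruct (eventually_incl L s1) as [K1 H1].
    { intros x Hx. apply Hex. apply Hs1, Hx. }
    destruct (Hlim (eps / 2)) as [K2 H2]; [lra |].
    set (k := Nat.max K1 K2). exists (L k). split; [apply HL |].
    intros s Hs Hincl.
    rewrite (Csum_perm f s _ (split_perm (L k) s (proj1 (HL k)) (proj1 Hs) Hincl)), Csum_app.
    set (d := minus_list s (L k)).
    assert (Hd : Rsum g d < eps / 2).
    { assert (Rsum g (s1 ++ d) <= m).
      { apply Hub. exists (s1 ++ d). split; [| reflexivity]. split.
        - apply NoDup_app; [apply Hs1 | apply NoDup_filter, Hs |].
          intros x Hx Hx'. apply in_minus_list in Hx'. apply (proj2 Hx').
          apply (H1 k); [unfold k; lia | exact Hx].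
        - intros x Hx. apply in_app_iff in Hx. destruct Hx as [Hx | Hx]; [apply Hs1, Hx |].
          apply in_minus_list in Hx. apply Hs, Hx. }
      rewrite Rsum_app in H. lra. }
    replace (Csum_list f (L k) + Csum_list f d - l)%C with
      ((Csum_list f (L k) - l) + Csum_list f d)%C by ring.
    eapply Rle_lt_trans; [apply Cmod_triangle |].
    generalize (H2 k ltac:(unfold k; lia)) (Cmod_Csum f d). fold g. lra.
Qed.

Definition inv_pow32 (x : R) : R := / (x * sqrt x).

Lemma inv_pow32_pos x : 0 < x -> 0 < inv_pow32 x.
Proof.
  intro H. apply Rinv_0_lt_compat, Rmult_lt_0_compat; [exact H | apply sqrt_lt_R0, H].
Qed.

(* Telescoping comparison with [2 / sqrt x]. *)
Lemma sum_inv_pow32 (M : nat) :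
  Rsum (fun n => inv_pow32 (INR n)) (seq 1 (S M)) <= 3 - 2 / sqrt (INR (S M)).
Proof.
  induction M as [| M IH].
  - unfold Rsum, inv_pow32; simpl. rewrite sqrt_1. lra.
  - rewrite seq_S, Rsum_app, Rsum_cons. change (1 + S M)%nat with (S (S M)).
    change (Rsum (fun n : nat => inv_pow32 (INR n)) []) with 0.
    set (x := sqrt (INR (S M))) in *. set (y := sqrt (INR (S (S M)))).
    assert (Hx : x * x = INR (S M)) by (apply sqrt_sqrt, pos_INR).
    assert (Hy : y * y = INR (S M) + 1) by (rewrite <- S_INR; apply sqrt_sqrt, pos_INR).
    assert (HM : 1 <= INR (S M)) by (rewrite S_INR; generalize (pos_INR M); lra).
    assert (Hx0 : 0 < x) by (apply sqrt_lt_R0; lra).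
    assert (Hy0 : 0 < y) by (apply sqrt_lt_R0; rewrite S_INR; lra).
    assert (Hxy : x <= y) by (apply sqrt_le_1; rewrite ?S_INR; rewrite ?S_INR in HM; lra).
    (* Since y^2 - x^2 = 1, the right side is 2 / (x y (x + y)), and x (x + y) <= 2 y^2. *)
    assert (E : inv_pow32 (INR (S (S M))) <= 2 / x - 2 / y).
    { unfold inv_pow32. fold y. rewrite (S_INR (S M)), <- Hy.
      replace (2 / x - 2 / y) with (2 * (y * y - x * x) * / (x * y * (x + y))) by (field; lra).
      rewrite Hx, Hy. replace (2 * (INR (S M) + 1 - INR (S M))) with 2 by ring.
      rewrite <- Hy.
      assert (A : 0 < x * y * (x + y)) by (apply Rmult_lt_0_compat; nra).
      assert (B : x * (x + y) <= 2 * (y * y)) by nra.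
      apply (Rmult_le_reg_r (y * y * y * (x * y * (x + y)))).
      { apply Rmult_lt_0_compat; [| exact A]. apply Rmult_lt_0_compat; nra. }
      replace (/ (y * y * y) * (y * y * y * (x * y * (x + y)))) with (x * y * (x + y)) by (field; lra).
      replace (2 * / (x * y * (x + y)) * (y * y * y * (x * y * (x + y)))) with (2 * (y * y) * y) by (field; lra).
      replace (x * y * (x + y)) with (x * (x + y) * y) by ring. apply Rmult_le_compat_r; lra. }
    lra.
Qed.

Lemma Rsum_list_prod {A B : Type} (f : A -> R) (g : B -> R) (l : list A) (l' : list B) :
  Rsum (fun u => f (fst u) * g (snd u)) (list_prod l l') = Rsum f l * Rsum g l'.
Proof.
  induction l as [| x l IH]; simpl list_prod.
  - unfold Rsum; simpl. ring.
  - rewrite Rsum_app, Rsum_map, IH, Rsum_cons. cbn [fst snd]. rewrite Rsum_scal. ring.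
Qed.

Definition den_l (w : list bool) : nat := Z.to_nat (snd (lv w)).
Definition den_r (w : list bool) : nat := Z.to_nat (snd (rv w)).

Lemma den_spec w : INR (den_l w) = ql w /\ INR (den_r w) = qr w.
Proof.
  destruct (ends_spec w) as (_ & H1 & H2 & _).
  unfold den_l, den_r, ql, qr. rewrite !INR_IZR_INZ, !Z2Nat.id by lia. split; reflexivity.
Qed.

(** A node is determined by its sector and its two denominators, so the sum is dominated by one over
    a finite box, which factors. The bound 27 is three sectors times 3 for each of the two
    denominator sums. *)
Lemma nodes_summable (J : list node) :
  NoDup J -> Rsum (fun i => inv_pow32 (ql (snd i)) * inv_pow32 (qr (snd i))) J <= 27.
Proof.
  intro N.
  set (h := fun i : node => (fst i, (den_l (snd i), den_r (snd i)))).
  set (F := fun u : sector * (nat * nat) => 1 * (inv_pow32 (INR (fst (snd u))) * inv_pow32 (INR (snd (snd u))))).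
  set (M := list_max (map (fun i => den_l (snd i) + den_r (snd i))%nat J)).
  set (box := list_prod [sector1; sector2; sector3] (list_prod (seq 1 (S M)) (seq 1 (S M)))).
  apply Rle_trans with (Rsum F (map h J)).
  { rewrite Rsum_map. right. unfold Rsum. f_equal. apply map_ext. intro i.
    unfold F, h; cbn [fst snd]. destruct (den_spec (snd i)) as [-> ->]. ring. }
  assert (Pos : forall n, In n (seq 1 (S M)) -> 0 < inv_pow32 (INR n)).
  { intros n Hn. apply in_seq in Hn. apply inv_pow32_pos, lt_0_INR. lia. }
  apply Rle_trans with (Rsum F box).
  - apply Rsum_incl.
    + apply NoDup_map_NoDup_ForallPairs; [| exact N].
      intros [r w] [r' w'] _ _ E. unfold h in E; simpl in E. injection E as -> E1 E2.
      f_equal.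
      apply q_inj.
      * destruct (den_spec w) as [<- _], (den_spec w') as [<- _]. rewrite E1. reflexivity.
      * destruct (den_spec w) as [_ <-], (den_spec w') as [_ <-]. rewrite E2. reflexivity.
    + apply NoDup_list_prod; [repeat constructor; simpl; intuition discriminate |].
      apply NoDup_list_prod; apply seq_NoDup.
    + intros u Hu. apply in_map_iff in Hu. destruct Hu as [[r w] [<- Hi]].
      unfold h, box; cbn [fst snd]. apply in_prod; [destruct r; simpl; auto |].
      assert (Hmax : (den_l w + den_r w <= M)%nat).
      { assert (X := proj1 (list_max_le (map (fun i => den_l (snd i) + den_r (snd i))%nat J) M) (le_n _)).
        rewrite Forall_forall in X. apply X. apply in_map_iff. exists (r, w). split; [reflexivity | exact Hi]. }
      destruct (ends_spec w) as (_ & H1 & H2 & _).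
      apply in_prod; apply in_seq; unfold den_l, den_r in *; lia.
    + intros [r [a b]] Hu. apply in_prod_iff in Hu. destruct Hu as [_ Hu]. apply in_prod_iff in Hu.
      unfold F; simpl. destruct Hu as [Ha Hb]. generalize (Pos a Ha) (Pos b Hb). nra.
  - unfold box, F.
    rewrite (Rsum_list_prod (fun _ : sector => 1)
      (fun u : nat * nat => inv_pow32 (INR (fst u)) * inv_pow32 (INR (snd u)))).
    rewrite (Rsum_list_prod (fun n => inv_pow32 (INR n)) (fun n => inv_pow32 (INR n))).
    replace (Rsum (fun _ : sector => 1) [sector1; sector2; sector3]) with 3 by (unfold Rsum; simpl; ring).
    assert (X : 0 <= Rsum (fun n => inv_pow32 (INR n)) (seq 1 (S M))).
    { apply Rsum_nonneg. intros n Hn. apply Rlt_le, Pos, Hn. }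
    assert (Y := sum_inv_pow32 M).
    assert (0 < 2 / sqrt (INR (S M))).
    { apply Rdiv_lt_0_compat; [lra | apply sqrt_lt_R0, lt_0_INR; lia]. }
    nra.
Qed.

Lemma edges_preimage (l : list edge) : exists J, l = map mk J.
Proof.
  induction l as [| e l [J ->]]; [exists []; reflexivity |].
  destruct (mk_surj e) as [i ->]. exists (i :: J). reflexivity.
Qed.

Lemma coef_abs_bounded (V : C -> C) sdot K n :
  holder34 V K -> is_inf_shear V sdot -> vanish3 V ->
  abs_bounded (fun _ => True) (fan_coef_term sdot n).
Proof.
  intros HV Hs H0. assert (HK : 0 <= K) by apply HV.
  exists (2048 * K * 27). intros s [N _]. destruct (edges_preimage s) as [J ->].
  apply NoDup_map_inv in N. rewrite Rsum_map.
  apply Rle_trans with (Rsum (fun i => 2048 * K * (inv_pow32 (ql (snd i)) * inv_pow32 (qr (snd i)))) J).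
  - apply Rsum_le. intros [r w] _. apply (norm_fan_coef V); assumption.
  - rewrite Rsum_scal. apply Rmult_le_compat_l; [lra | apply nodes_summable, N].
Qed.

Lemma abs_bounded_sub {T : Type} (P Q : T -> Prop) (f : T -> C) :
  (forall x, Q x -> P x) -> abs_bounded P f -> abs_bounded Q f.
Proof.
  intros H [M HM]. exists M. intros s [N Hs]. apply HM. split; [exact N |].
  intros x Hx. apply H, Hs, Hx.
Qed.

Lemma coef_edges_sum (V : C -> C) sdot K n :
  holder34 V K -> is_inf_shear V sdot -> vanish3 V ->
  forall eps, 0 < eps -> exists s0 : list edge, NoDup s0 /\
    forall s, NoDup s -> incl s0 s ->
      Cmod (Csum_list (fan_coef_term sdot n) s - RtoC (/ 2) * fourier_coef V n) < eps.
Proof.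
  intros HV Hs H0 eps He.
  destruct (exhaustion_sum (fun _ => True) (fan_coef_term sdot n) edges_lt (RtoC (/ 2) * fourier_coef V n)%C) with (eps := eps)
    as [s0 [[N0 _] H]]; try assumption.
  - apply (coef_abs_bounded V sdot K); assumption.
  - intro k. split; [apply NoDup_edges_lt | trivial].
  - intros e _. destruct (mk_surj e) as [i ->]. exists (S (length (snd i))). intros k Hk.
    apply in_edges_lt. lia.
  - apply (fourier_half V sdot K); assumption.
  - exists s0. split; [exact N0 |]. intros s Ns Hi. apply H; [split; [exact Ns | trivial] | exact Hi].
Qed.

(** * Comparison of fan order with level order *)

Definition zrange (N : nat) : list Z := map (fun k => (Z.of_nat k - Z.of_nat N)%Z) (seq 0 (S (2 * N))).

Lemma in_zrange N j : In j (zrange N) <-> (Z.abs j <= Z.of_nat N)%Z.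
Proof.
  unfold zrange. rewrite in_map_iff. split.
  - intros [k [<- H]]. apply in_seq in H. lia.
  - intro H. exists (Z.to_nat (j + Z.of_nat N)). split; [lia | apply in_seq; lia].
Qed.

Lemma NoDup_zrange N : NoDup (zrange N).
Proof.
  apply NoDup_map_NoDup_ForallPairs; [| apply seq_NoDup]. intros a b _ _ H. lia.
Qed.

Lemma zpartial_sum_list (u : Z -> C) N : zpartial_sum u N = Csum_list u (zrange N).
Proof.
  unfold zpartial_sum, zrange. rewrite Csum_map. generalize (2 * N)%nat as m.
  induction m as [| m IH].
  - rewrite sum_O. unfold Csum_list; simpl. to_C. ring.
  - rewrite sum_Sn, IH, (seq_S (S m)), Csum_app. unfold Csum_list at 3; simpl. 
    change plus with Cplus. to_C. ring.
Qed.

Definition fan_list (f : Z -> edge) (N : nat) : list edge := map f (zrange N).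

Lemma fan_list_spec p (f : Z -> edge) :
  is_fan p f ->
  (forall N, list_in (incident p) (fan_list f N)) /\
  (forall e, incident p e -> exists K, forall k, (K <= k)%nat -> In e (fan_list f k)).
Proof.
  intros (F1 & F2 & F3 & _). split.
  - intro N. split.
    + apply NoDup_map_NoDup_ForallPairs; [| apply NoDup_zrange]. intros a b _ _. apply F2.
    + intros e He. apply in_map_iff in He. destruct He as [j [<- _]]. apply F1.
  - intros e He. destruct (F3 e He) as [j <-]. exists (Z.to_nat (Z.abs j)). intros k Hk.
    apply in_map_iff. exists j. split; [reflexivity |]. apply in_zrange. lia.
Qed.

Lemma is_zsum_fan_iff (f : Z -> edge) (g : edge -> C) (l : C) :
  is_zsum (fun j => g (f j)) l <-> Clim (fun N => Csum_list g (fan_list f N)) l.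
Proof.
  unfold is_zsum.
  assert (E : forall N, zpartial_sum (fun j => g (f j)) N = Csum_list g (fan_list f N)).
  { intro N. rewrite zpartial_sum_list. unfold fan_list. rewrite Csum_map. reflexivity. }
  rewrite Clim_filterlim. split; apply filterlim_ext; intro N; [| symmetry]; apply E.
Qed.

Lemma fan_zsum_finite p (f : Z -> edge) (g : edge -> C) (s : list edge) :
  is_fan p f -> list_in (incident p) s ->
  (forall e, incident p e -> ~ In e s -> g e = RtoC 0) ->
  is_zsum (fun j => g (f j)) (Csum_list g s).
Proof.
  intros Hf [Ns Hs] Hz. apply is_zsum_fan_iff.
  destruct (fan_list_spec p f Hf) as [L1 L2].
  destruct (eventually_incl (fan_list f) s) as [K HK].
  { intros e He. apply L2, Hs, He. }
  intros eps He. exists K. intros k Hk.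
  rewrite (Csum_incl g s (fan_list f k)).
  - replace (Csum_list g s - Csum_list g s)%C with (RtoC 0) by ring. rewrite Cmod_0. exact He.
  - exact Ns.
  - apply L1.
  - apply HK, Hk.
  - intros e H. apply Hz. apply (L1 k), H.
Qed.

Lemma zsum_unique (u : Z -> C) (l : C) : is_zsum u l -> zsum u = l.
Proof.
  intro H. unfold zsum, is_zsum.
  apply (iota_filterlim_locally (V := C_R_CompleteNormedModule) (F := eventually)). exact H.
Qed.

Lemma list_in_fan_lt p k : list_in (incident p) (fan_lt p k).
Proof.
  split; [apply NoDup_fan_lt |]. intros e He. apply filter_In in He. apply incidentb_true, He.
Qed.

(** Both the symmetric sums along the fan and the sums by level eventually contain the finitely many
    nonzero terms at this point. The depth k may be as large as desired, which the uniform estimate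
    exploits. *)
Lemma fan_field_eq sdot p f phi :
  is_fan p f -> 0 <= phi <= 2 * PI ->
  exists k0, forall k, (k0 <= k)%nat ->
    is_zsum (fun j => fan_field_term sdot (expi phi) (f j))
      (Csum_list (fan_field_term sdot (expi phi)) (fan_lt p k)).
Proof.
  intros Hf Hphi. destruct (fan_term_finite sdot p phi Hphi) as [k0 H].
  exists k0. intros k Hk. apply fan_zsum_finite with p; [exact Hf | apply list_in_fan_lt |].
  intros e He Hn. rewrite fan_field_term_half, H; [ring | exact He |].
  intro Hi. apply Hn. destruct (mk_surj e) as [i ->]. apply in_fan_lt in Hi. apply in_fan_lt.
  split; [lia | tauto].
Qed.

Lemma fan_field_approx (V : C -> C) sdot K p f phi k :
  holder34 V K -> is_inf_shear V sdot -> vanish3 V -> is_fan p f -> 0 <= phi <= 2 * PI ->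
  Cmod (Csum_list (fan_field_term sdot (expi phi)) (fan_lt p k) - fan_field sdot f (expi phi)) <= rate K k.
Proof.
  intros HV Hs H0 Hf Hphi.
  destruct (fan_field_eq sdot p f phi Hf Hphi) as [k0 H].
  (* The value of the field is itself the level sum of depth k + k0, and the tail bound is uniform
     in k0, so no limit has to be taken. *)
  unfold fan_field. rewrite (zsum_unique _ _ (H (k + k0)%nat ltac:(lia))).
  rewrite !Csum_fan_half.
  replace (_ - _)%C with (RtoC (- / 2) *
    (Csum_list (field_term sdot (expi phi)) (fan_lt p (k + k0)) -
     Csum_list (field_term sdot (expi phi)) (fan_lt p k)))%C by (rewrite RtoC_opp; ring).
  rewrite Cmod_mult, Cmod_R, Rabs_Ropp, Rabs_right by lra.
  generalize (fan_sum_tail V sdot K p phi k k0 HV Hs H0 Hphi). lra.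
Qed.

Lemma fan_fourier (V : C -> C) sdot K p f n :
  holder34 V K -> is_inf_shear V sdot -> vanish3 V -> is_fan p f ->
  ex_RInt (V := C_R_NormedModule) (fourier_integrand (fan_field sdot f) n) 0 (2 * PI) /\
  Clim (fun N => Csum_list (fan_coef_term sdot n) (fan_list f N)) (fourier_coef (fan_field sdot f) n).
Proof.
  intros HV Hs H0 Hf.
  destruct (uniform_fourier sdot n (fan_field sdot f) (fan_lt p) (rate K)) as [H1 H2].
  - intros phi k Hphi. apply (fan_field_approx V); assumption.
  - apply rate_lim.
  (* Up to here the coefficients converge by level. Absolute summability makes every large finite
     part of the fan equally good, in particular the symmetric ones. *)
  - split; [exact H1 |]. intros eps He.
    destruct (exhaustion_sum (incident p) (fan_coef_term sdot n) (fan_lt p)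
      (fourier_coef (fan_field sdot f) n)) with (eps := eps) as [s0 [[N0 P0] H]]; try assumption.
    + eapply abs_bounded_sub; [| apply (coef_abs_bounded V sdot K); assumption].
      intros; exact I.
    + apply list_in_fan_lt.
    + intros e He'. destruct (mk_surj e) as [i ->]. exists (S (length (snd i))). intros k Hk.
      apply in_fan_lt. split; [lia | exact He'].
    + destruct (fan_list_spec p f Hf) as [L1 L2].
      destruct (eventually_incl (fan_list f) s0) as [K0 HK0].
      { intros e Hin. apply L2, P0, Hin. }
      exists K0. intros k Hk. apply H; [apply L1 | apply HK0, Hk].
Qed.

(** * Regrouping the edges by vertices *)

Lemma src_neq_tgt (e : edge) : src e <> tgt e.
Proof. destruct (mk_surj e) as [[r w] ->]. apply (node_distinct r w). Qed.

Definition srcb (p : C) (e : edge) : bool :=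
  if excluded_middle_informative (src e = p) then true else false.

Definition tgtb (p : C) (e : edge) : bool :=
  if excluded_middle_informative (tgt e = p) then true else false.

Lemma Csum_src_tgt (g : edge -> C) p (l : list edge) :
  (forall e, In e l -> incident p e) ->
  Csum_list g l = (Csum_list g (filter (srcb p) l) + Csum_list g (filter (tgtb p) l))%C.
Proof.
  induction l as [| e l IH]; intro H; [change (RtoC 0 = RtoC 0 + RtoC 0)%C; ring |].
  rewrite Csum_cons, IH by (intros; apply H, in_cons; assumption).
  simpl. unfold srcb at 2, tgtb at 2.
  generalize (src_neq_tgt e). intro D.
  destruct (H e (in_eq _ _)) as [E | E];
    destruct (excluded_middle_informative (src e = p)), (excluded_middle_informative (tgt e = p));
    try congruence; rewrite Csum_cons; ring.
Qed.

Lemma Csum_flat_map {S T : Type} (g : T -> C) (B : S -> list T) (s : list S) :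
  Csum_list g (flat_map B s) = Csum_list (fun p => Csum_list g (B p)) s.
Proof.
  induction s as [| p s IH]; [reflexivity |]. simpl. rewrite Csum_app, IH. reflexivity.
Qed.

Lemma Rsum_flat_map {S T : Type} (g : T -> R) (B : S -> list T) (s : list S) :
  Rsum g (flat_map B s) = Rsum (fun p => Rsum g (B p)) s.
Proof.
  induction s as [| p s IH]; [reflexivity |]. simpl. rewrite Rsum_app, IH. reflexivity.
Qed.

(** The key recovers the block of an element, so distinct blocks are disjoint. It is applied with
    the source and with the target of an edge as key. *)
Lemma NoDup_flat_map {S T : Type} (key : T -> S) (B : S -> list T) (s : list S) :
  NoDup s -> (forall p, In p s -> NoDup (B p)) ->
  (forall p x, In x (B p) -> key x = p) -> NoDup (flat_map B s).
Proof.
  intros N HB Hk. induction N as [| p s Hp N IH]; simpl; [constructor |].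
  apply NoDup_app.
  - apply HB, in_eq.
  - apply IH. intros q Hq. apply HB, in_cons, Hq.
  - intros x Hx Hx'. apply in_flat_map in Hx'. destruct Hx' as [q [Hq Hx']].
    apply Hk in Hx. apply Hk in Hx'. congruence.
Qed.

Lemma Clim_sum {T : Type} (u : T -> nat -> C) (v : T -> C) (s : list T) :
  (forall p, In p s -> Clim (u p) (v p)) ->
  forall eps, 0 < eps -> exists N, forall k, (N <= k)%nat ->
    Rsum (fun p => Cmod (u p k - v p)) s < eps.
Proof.
  induction s as [| p s IH]; intros H eps He.
  - exists 0%nat. intros k _. exact He.
  - destruct (H p (in_eq _ _) (eps / 2)) as [N1 H1]; [lra |].
    destruct (IH (fun q Hq => H q (in_cons _ _ _ Hq)) (eps / 2)) as [N2 H2]; [lra |].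
    exists (Nat.max N1 N2). intros k Hk. rewrite Rsum_cons.
    generalize (H1 k ltac:(lia)) (H2 k ltac:(lia)). lra.
Qed.

Lemma Csum_minus {T : Type} (f g : T -> C) (s : list T) :
  (Csum_list f s - Csum_list g s)%C = Csum_list (fun p => f p - g p)%C s.
Proof.
  induction s as [| p s IH]; [change (RtoC 0 - RtoC 0 = RtoC 0)%C; ring |].
  rewrite !Csum_cons, <- IH. ring.
Qed.

(** All fans at the vertices of a finite list are truncated at a common N. An edge may occur in two
    of them, so each block is split into the edges leaving p and those arriving at p: the two
    resulting lists of edges have no repetition, each is within the scope of the summability over
    all edges, and each tends to half of the coefficient of V. *)
Lemma vertices_abs_sum (V : C -> C) sdot K (fan : C -> Z -> edge) n :
  holder34 V K -> is_inf_shear V sdot -> vanish3 V ->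
  (forall p, farey_vertex p -> is_fan p (fan p)) ->
  is_abs_sum farey_vertex (fun p => fourier_coef (fan_field sdot (fan p)) n) (fourier_coef V n).
Proof.
  intros HV Hs H0 Hfan.
  set (G := fan_coef_term sdot n).
  set (Fp := fun p => fourier_coef (fan_field sdot (fan p)) n).
  set (block := fun N p => fan_list (fan p) N).
  set (srcs := fun N s => flat_map (fun p => filter (srcb p) (block N p)) s).
  set (tgts := fun N s => flat_map (fun p => filter (tgtb p) (block N p)) s).
  assert (Hlim : forall s : list C, list_in farey_vertex s -> forall eps, 0 < eps ->
    exists N, forall k, (N <= k)%nat -> Rsum (fun p => Cmod (Csum_list G (block k p) - Fp p)) s < eps).
  { intros s [_ Hv]. apply (Clim_sum (fun p k => Csum_list G (block k p)) Fp).
    intros p Hp. apply (fan_fourier V sdot K p (fan p) n HV Hs H0). apply Hfan, Hv, Hp. }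
  assert (NDs : forall N s, list_in farey_vertex s -> NoDup (srcs N s)).
  { intros N s [Nd Hv]. apply (NoDup_flat_map src).
    - exact Nd.
    - intros p Hp. apply NoDup_filter. apply (fan_list_spec p (fan p)). apply Hfan, Hv, Hp.
    - intros p e He. apply filter_In in He. destruct He as [_ He]. unfold srcb in He.
      destruct (excluded_middle_informative (src e = p)); [assumption | discriminate]. }
  assert (NDt : forall N s, list_in farey_vertex s -> NoDup (tgts N s)).
  { intros N s [Nd Hv]. apply (NoDup_flat_map tgt).
    - exact Nd.
    - intros p Hp. apply NoDup_filter. apply (fan_list_spec p (fan p)). apply Hfan, Hv, Hp.
    - intros p e He. apply filter_In in He. destruct He as [_ He]. unfold tgtb in He.
      destruct (excluded_middle_informative (tgt e = p)); [assumption | discriminate]. }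
  assert (Split : forall N s, list_in farey_vertex s -> forall p, In p s ->
    Csum_list G (block N p) =
    (Csum_list G (filter (srcb p) (block N p)) + Csum_list G (filter (tgtb p) (block N p)))%C).
  { intros N s [_ Hv] p Hp. apply Csum_src_tgt. intros e He.
    apply (proj1 (fan_list_spec p (fan p) (Hfan p (Hv p Hp))) N), He. }
  split.
  - destruct (coef_abs_bounded V sdot K n HV Hs H0) as [M HM]. fold G in HM.
    (* M bounds the absolute sum over the outgoing edges and again over the incoming ones; 1 is the
       error of truncating the fans. *)
    exists (2 * M + 1). intros s Hsv.
    destruct (Hlim s Hsv 1 Rlt_0_1) as [N HN]. specialize (HN N (le_n N)).
    apply Rle_trans with (Rsum (fun p => Cmod (Csum_list G (block N p) - Fp p) +
      (Rsum (fun e => Cmod (G e)) (filter (srcb p) (block N p)) +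
       Rsum (fun e => Cmod (G e)) (filter (tgtb p) (block N p)))) s).
    + apply Rsum_le. intros p Hp. fold (Fp p).
      replace (Fp p) with (- (Csum_list G (block N p) - Fp p) + Csum_list G (block N p))%C at 1 by ring.
      eapply Rle_trans; [apply Cmod_triangle |]. rewrite Cmod_opp. apply Rplus_le_compat_l.
      rewrite (Split N s Hsv p Hp). eapply Rle_trans; [apply Cmod_triangle |].
      apply Rplus_le_compat; apply Cmod_Csum.
    + assert (Add : forall (f g : C -> R) l, Rsum (fun p => f p + g p) l = Rsum f l + Rsum g l).
      { intros f g l. induction l as [| x l IH]; [unfold Rsum; simpl; ring |].
        rewrite !Rsum_cons, IH. ring. }
      rewrite !Add, <- !Rsum_flat_map.
      assert (A1 := HM (srcs N s) (conj (NDs N s Hsv) (fun _ _ => I))).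
      assert (A2 := HM (tgts N s) (conj (NDt N s Hsv) (fun _ _ => I))).
      unfold srcs, tgts in A1, A2. lra.
  - intros eps He.
    destruct (coef_edges_sum V sdot K n HV Hs H0 (eps / 3)) as [L0 [NL HL]]; [lra |].
    fold G in HL.
    (* Once every endpoint of the edges in L0 is among the vertices, long enough fans make both the
       outgoing and the incoming list contain L0. *)
    set (s0 := nodup (fun a b : C => excluded_middle_informative (a = b)) (map src L0 ++ map tgt L0)).
    assert (Hs0 : forall e, In e L0 -> In (src e) s0 /\ In (tgt e) s0).
    { intros e Hin. unfold s0. rewrite !nodup_In, !in_app_iff.
      split; [left | right]; apply in_map, Hin. }
    exists s0. split.
    + split; [apply NoDup_nodup |]. intros p Hp. unfold s0 in Hp. apply nodup_In, in_app_iff in Hp.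
      destruct Hp as [Hp | Hp]; apply in_map_iff in Hp; destruct Hp as [e [<- _]]; exists e;
        [left | right]; reflexivity.
    + intros s Hsv Hincl. fold Fp.
      destruct (Hlim s Hsv (eps / 3)) as [N1 HN1]; [lra |].
      assert (Vtx : forall e, In e L0 -> farey_vertex (src e) /\ farey_vertex (tgt e)).
      { intros e _. split; exists e; [left | right]; reflexivity. }
      destruct (eventually_incl (fun N => srcs N s) L0) as [N2 HN2].
      { intros e Hin. destruct (Vtx e Hin) as [Vs _]. destruct (Hs0 e Hin) as [Is _].
        destruct (proj2 (fan_list_spec _ _ (Hfan _ Vs)) e (or_introl eq_refl)) as [k0 Hk0].
        exists k0. intros k Hk. apply in_flat_map. exists (src e). split; [apply Hincl, Is |].
        apply filter_In. split; [apply Hk0, Hk |]. unfold srcb.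
        destruct (excluded_middle_informative (src e = src e)); [reflexivity | contradiction]. }
      destruct (eventually_incl (fun N => tgts N s) L0) as [N3 HN3].
      { intros e Hin. destruct (Vtx e Hin) as [_ Vt]. destruct (Hs0 e Hin) as [_ It].
        destruct (proj2 (fan_list_spec _ _ (Hfan _ Vt)) e (or_intror eq_refl)) as [k0 Hk0].
        exists k0. intros k Hk. apply in_flat_map. exists (tgt e). split; [apply Hincl, It |].
        apply filter_In. split; [apply Hk0, Hk |]. unfold tgtb.
        destruct (excluded_middle_informative (tgt e = tgt e)); [reflexivity | contradiction]. }
      set (N := Nat.max N1 (Nat.max N2 N3)).
      assert (E1 := HN1 N ltac:(unfold N; lia)).
      assert (E2 := HL (srcs N s) (NDs N s Hsv) (HN2 N ltac:(unfold N; lia))).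
      assert (E3 := HL (tgts N s) (NDt N s Hsv) (HN3 N ltac:(unfold N; lia))).
      assert (ES : Csum_list (fun p => Csum_list G (block N p)) s =
        (Csum_list G (srcs N s) + Csum_list G (tgts N s))%C).
      { unfold srcs, tgts. rewrite !Csum_flat_map.
        rewrite (Csum_ext _ _ s (Split N s Hsv)).
        clear. induction s as [| p s IH]; [change (RtoC 0 = RtoC 0 + RtoC 0)%C; ring |].
        rewrite !Csum_cons, IH. ring. }
      replace (Csum_list Fp s - fourier_coef V n)%C with
        (- (Csum_list (fun p => Csum_list G (block N p)) s - Csum_list Fp s) +
         ((Csum_list G (srcs N s) - RtoC (/ 2) * fourier_coef V n) +
          (Csum_list G (tgts N s) - RtoC (/ 2) * fourier_coef V n)))%C.
      * eapply Rle_lt_trans; [apply Cmod_triangle |]. rewrite Cmod_opp, Csum_minus.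
        eapply Rle_lt_trans; [apply Rplus_le_compat; [apply Cmod_Csum | apply Cmod_triangle] |].
        lra.
      * rewrite ES. generalize (fourier_coef V n). intro v. apply C_eq; simpl; field.
Qed.

(** [zsum] and [RInt] return some value even when nothing converges. Pointwise convergence of the
    series of V_p and integrability of its Fourier integrand are therefore part of the conclusion,
    next to the two summation formulas. *)
Theorem theorem4 :
  forall (V : C -> C) (sdot : edge -> R) (fan : C -> Z -> edge),
    zygmund_circle V ->
    V (RtoC 1) = RtoC 0 -> V Ci = RtoC 0 -> V (RtoC (-1)) = RtoC 0 ->
    is_inf_shear V sdot ->
    (forall p : C, farey_vertex p -> is_fan p (fan p)) ->
    forall n : Z,
      is_abs_sum farey_vertex
        (fun p => fourier_coef (fan_field sdot (fan p)) n)
        (fourier_coef V n) /\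
      (forall p : C, farey_vertex p ->
         (forall z : C, S1 z ->
            exists l : C, is_zsum (fun j => fan_field_term sdot z (fan p j)) l) /\
         ex_RInt (V := C_R_NormedModule)
           (fourier_integrand (fan_field sdot (fan p)) n) 0 (2 * PI) /\
         is_zsum (fun j => fan_coef_term sdot n (fan p j))
           (fourier_coef (fan_field sdot (fan p)) n)).
Proof.
  intros V sdot fan HZ V1 Vi Vm Hs Hfan n.
  destruct (expi_holder V HZ Vm) as [K HV]. change (holder34 V K) in HV.
  assert (H0 : vanish3 V) by (repeat split; assumption).
  split; [apply (vertices_abs_sum V sdot K); assumption |].
  intros p Hp. destruct (fan_fourier V sdot K p (fan p) n HV Hs H0 (Hfan p Hp)) as [I1 I2].
  split; [| split; [exact I1 | apply is_zsum_fan_iff, I2]].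
  intros z Hz. destruct (S1_polar z Hz) as [phi [Hphi ->]].
  destruct (fan_field_eq sdot p (fan p) phi (Hfan p Hp) Hphi) as [k0 H].
  exists (Csum_list (fan_field_term sdot (expi phi)) (fan_lt p k0)). apply H, le_n.
Qed.
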